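(* Suppose that $f \in C^\infty(\mathbb{R}^d)$ satisfies $$\|(1+|x|^2)^{n/2}\partial^\beta f\|_{L^2(\mathbb{R}^d)} \leq D_1 D_2^{n+|\beta|}(n!)^{\nu}(|\beta|!)^{\mu}\quad\text{for all } n\in\mathbb{N}_0,\ \beta\in\mathbb{N}_0^d,$$ with some $D_1>0$, $D_2\geq 1$, $\nu\geq 0$, and $0\leq\mu<1$. Let $\delta\in[0,1]$ with $s:=\delta\nu+\mu<1$, and let $\rho\colon\mathbb{R}^d\to(0,\infty)$ be a measurable function satisfying $$\rho(x)\leq R(1+|x|^2)^{\delta/2}\quad\text{for all } x\in\mathbb{R}^d$$ with some $R\geq 1$ and $$\rho(x)\leq\eta|x|\quad\text{for all } |x|\geq r_0$$ with some $\eta\in(0,1)$ and some $r_0\geq 1$. Then, for every measurable set $\omega\subset\mathbb{R}^d$ satisfying $$\frac{|B(x,\rho(x))\cap\omega|}{|B(x,\rho(x))|}\geq\gamma\quad\text{for all } x\in\mathbb{R}^d$$ with some $\gamma\in(0,1)$, and for every $\varepsilon\in(0,1]$, we have $$\|f\|_{L^2(\mathbb{R}^d)}^2\leq \mathrm{e}^{K\cdot\bigl(1+\log\frac{1}{\varepsilon}+D_2^{2/(1-s)}\bigr)}\|f\|_{L^2(\omega)}^2+\varepsilon D_1^2,$$ where $K\geq 1$ is a constant depending only on $\gamma,R,r_0,\eta,\nu,s$, and the dimension $d$.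
   Context: $B(x,\tau)$ denotes the open Euclidean ball of radius $\tau>0$ centered at $x\in\mathbb{R}^d$; $|A|$ denotes the Lebesgue measure of a measurable set $A\subset\mathbb{R}^d$, $|x|$ the Euclidean norm of $x\in\mathbb{R}^d$, and $|\beta|=\beta_1+\dots+\beta_d$ for a multi-index $\beta\in\mathbb{N}_0^d$. $\mathbb{N}_0=\{0,1,2,\dots\}$. *)

(* Defs.v *)
From HB Require Import structures.
From mathcomp Require Import all_boot all_order all_algebra.
From mathcomp Require Import all_classical all_reals all_analysis.
From mathcomp Require Import complex.
Import Order.TTheory GRing.Theory Num.Theory.
Import numFieldNormedType.Exports.

Set Implicit Arguments.
Unset Strict Implicit.
Unset Printing Implicit Defensive.

Local Open Scope classical_set_scope.
Local Open Scope ring_scope.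
Local Open Scope complex_scope.

Definition measure_row_display : measure_display.
Proof. exact. Qed.

Section row_sigma_algebra.
Variables (R : realType) (n : nat).

(* The sigma-algebra generated by the coordinates, i.e. the Borel one. *)
Definition row_measurable : set (set 'rV[R]_n) :=
  g_sigma_preimage (fun (i : 'I_n) (x : 'rV[R]_n) => x ord0 i : measurableTypeR R).

Let row_set0 : row_measurable set0.
Proof. exact: sigma_algebra0. Qed.

Let row_setC A : row_measurable A -> row_measurable (~` A).
Proof. exact: sigma_algebraC. Qed.

Let row_bigcup (F : (set 'rV[R]_n)^nat) :
  (forall i, row_measurable (F i)) -> row_measurable (\bigcup_i F i).
Proof. exact: sigma_algebra_bigcup. Qed.

HB.instance Definition _ := @isMeasurable.Build measure_row_display
  'rV[R]_n row_measurable row_set0 row_setC row_bigcup.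

End row_sigma_algebra.

Section row_measurability.
Variables (R : realType) (n : nat).

Lemma measurable_row_coord (i : 'I_n) :
  measurable_fun [set: 'rV[R]_n] (fun x => x ord0 i : measurableTypeR R).
Proof.
move=> _ Y mY; rewrite setTI; apply: sub_sigma_algebra => /=.
rewrite -bigcup_seq/=; exists i => /=; first by rewrite mem_index_enum.
by exists Y => //; rewrite setTI.
Qed.

Lemma measurable_fun_rowP d (T : measurableType d) (f : T -> 'rV[R]_n) :
  (forall i, measurable_fun [set: T] (fun t => f t ord0 i : measurableTypeR R)) ->
  measurable_fun [set: T] f.
Proof.
move=> mf _ Y mY; rewrite setTI.
have /(_ Y mY) : @row_measurable R n `<=` image_set_system [set: T] f measurable.
  apply: smallest_sub.
    by apply: sigma_algebra_image; exact: sigma_algebra_measurable.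
  rewrite -bigcup_seq/= => A [i _ [B mB <-]].
  rewrite /image_set_system/= !setTI.
  by rewrite -[X in measurable X]setTI; exact: mf.
by rewrite /image_set_system/= setTI.
Qed.

End row_measurability.

Section row_cons.
Variables (R : realType) (n : nat).

Definition row_cons (p : measurableTypeR R * 'rV[R]_n) : 'rV[R]_n.+1 :=
  row_mx (const_mx p.1 : 'rV[R]_1) p.2.

Definition row_uncons (x : 'rV[R]_n.+1) : measurableTypeR R * 'rV[R]_n :=
  (x ord0 ord0, \row_j x ord0 (lift ord0 j)).

Lemma row_consK : cancel row_cons row_uncons.
Proof.
move=> [t y]; rewrite /row_uncons /row_cons/=; congr (_, _).
  have -> : ord0 = lshift n (ord0 : 'I_1) by exact: val_inj.
  by rewrite (row_mxEl (const_mx t : 'rV[R]_1)) mxE.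
apply/rowP => j; rewrite mxE.
have -> : lift ord0 j = rshift 1 j by exact: val_inj.
by rewrite (row_mxEr (const_mx t : 'rV[R]_1)).
Qed.

Lemma measurable_row_cons : measurable_fun [set: _] row_cons.
Proof.
apply: measurable_fun_rowP => i.
have [j ->|->] := unliftP ord0 i.
  rewrite (_ : (fun _ => _) = (fun y : 'rV[R]_n => y ord0 j) \o snd).
    by apply: measurableT_comp; [exact: measurable_row_coord|exact: measurable_snd].
  apply/funext => p /=; have /(congr1 (fun q : _ * 'rV[R]_n => q.2 ord0 j))/= := row_consK p.
  by rewrite mxE.
rewrite (_ : (fun _ => _) = fst); first exact: measurable_fst.
by apply/funext => p; have /(congr1 fst) := row_consK p.
Qed.

Lemma measurable_row_uncons : measurable_fun [set: _] row_uncons.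
Proof.
apply: measurable_fun_pair; first exact: measurable_row_coord.
apply: measurable_fun_rowP => i.
rewrite (_ : (fun _ => _) = (fun x : 'rV[R]_n.+1 => x ord0 (lift ord0 i))).
  exact: measurable_row_coord.
by apply/funext => x; rewrite mxE.
Qed.

End row_cons.

Section row_lebesgue_step.
Local Open Scope ereal_scope.
Variables (R : realType) (n : nat).
Variable mu : {sigma_finite_measure set 'rV[R]_n -> \bar R}.

Definition row_lebesgue_step : set 'rV[R]_n.+1 -> \bar R :=
  pushforward (@lebesgue_measure R \x mu) (@row_cons R n).

Let step0 : row_lebesgue_step set0 = 0.
Proof. by rewrite /row_lebesgue_step /pushforward preimage_set0 measure0. Qed.

Let step_ge0 A : 0 <= row_lebesgue_step A.
Proof. by apply: integral_ge0 => x _; exact: measure_ge0. Qed.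

Let step_sigma_additive : semi_sigma_additive row_lebesgue_step.
Proof.
move=> F mF tF mUF; rewrite /row_lebesgue_step /pushforward preimage_bigcup.
apply: measure_semi_sigma_additive.
- by move=> k; rewrite -[X in measurable X]setTI; exact: measurable_row_cons.
- apply/trivIsetP => /= i j _ _ ij; rewrite -preimage_setI.
  by move/trivIsetP : tF => /(_ _ _ _ _ ij) ->//; rewrite preimage_set0.
- rewrite -preimage_bigcup -[X in measurable X]setTI.
  exact: measurable_row_cons.
Qed.

HB.instance Definition _ := isMeasure.Build _ _ _
  row_lebesgue_step step0 step_ge0 step_sigma_additive.

Let step_sigma_finite : sigma_finite setT row_lebesgue_step.
Proof.
have /sigma_finiteP[F [TF ndF Foo]] := sigma_finiteT (@lebesgue_measure R).
have /sigma_finiteP[G [TG ndG Goo]] := sigma_finiteT mu.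
exists (fun k => @row_uncons R n @^-1` (F k `*` G k)).
  rewrite -preimage_bigcup (_ : \bigcup_i _ = setT) ?preimage_setT//.
  rewrite -subTset => -[x y] _.
  have [k _ Fx] : (\bigcup_i F i) x by rewrite -TF.
  have [l _ Gy] : (\bigcup_i G i) y by rewrite -TG.
  exists (maxn k l) => //; split => /=.
    by move: x Fx; exact/subsetPset/ndF/leq_maxl.
  by move: y Gy; exact/subsetPset/ndG/leq_maxr.
move=> k; have [mF Fk] := Foo k; have [mG Gk] := Goo k; split.
  rewrite -[X in measurable X]setTI.
  by apply: measurable_row_uncons => //; exact: measurableX.
rewrite /row_lebesgue_step /pushforward -comp_preimage.
rewrite (_ : _ \o _ = id); last by apply/funext => p; exact: row_consK.
by rewrite preimage_id product_measure1E// lte_mul_pinfty// ge0_fin_numE.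
Qed.

HB.instance Definition _ := @Measure_isSigmaFinite.Build _ _ _
  row_lebesgue_step step_sigma_finite.

End row_lebesgue_step.

Section lebesgue.
Variables (R : realType) (d : nat).

(* The d-fold product of the one-dimensional Lebesgue measure, on Borel sets. *)
Fixpoint borel_lebesgue (n : nat) :
    {sigma_finite_measure set 'rV[R]_n -> \bar R} :=
  match n with
  | 0 => dirac (0 : 'rV[R]_0)
  | n'.+1 => row_lebesgue_step (borel_lebesgue n')
  end.

(* R^d with the sigma-algebra of Lebesgue measurable (not only Borel) sets. *)
Definition lebesgue_space : measurableType _ :=
  caratheodory_type ((borel_lebesgue d)^*)%mu.

Definition lebesgue_row : {measure set lebesgue_space -> \bar R} :=
  @completed_measure_extension _ _ _ (borel_lebesgue d).

End lebesgue.

Arguments lebesgue_row : clear implicits.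

Section euclidean.
Variables (R : realType) (d : nat).

(* The library's norm on 'rV[R]_d is the sup norm. *)
Definition enorm (x : 'rV[R]_d) : R := Num.sqrt (\sum_(i < d) x ord0 i ^+ 2).

Definition eball (x : 'rV[R]_d) (r : R) : set 'rV[R]_d :=
  [set y | enorm (y - x) < r].

End euclidean.

Section smooth.
Variables (R : realType) (d : nat).
Implicit Type g : 'rV[R]_d -> R.

Definition partial (i : 'I_d) g : 'rV[R]_d -> R :=
  fun x => 'D_(delta_mx ord0 i) g x.

(* 'D_v is total (a possibly meaningless limit), hence the derivability clause. *)
Definition smoothR g : Prop :=
  forall s : seq 'I_d, let h := foldr partial g s in
    continuous h /\ forall i x, derivable h x (delta_mx ord0 i).

(* The order in which the partial derivatives are taken is immaterial for
   smooth g, by symmetry of second derivatives. *)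
Definition mpartialR (beta : 'I_d -> nat) g : 'rV[R]_d -> R :=
  foldr (fun i => iter (beta i) (partial i)) g (enum 'I_d).

Definition msize (beta : 'I_d -> nat) : nat := (\sum_(i < d) beta i)%N.

Implicit Type f : 'rV[R]_d -> R[i].

(* Differentiation of complex-valued functions is componentwise, since R[i] is
   not a normed module over R in the library. *)
Definition smooth f : Prop :=
  smoothR (fun x => complex.Re (f x)) /\ smoothR (fun x => complex.Im (f x)).

Definition mpartial (beta : 'I_d -> nat) f : 'rV[R]_d -> R[i] :=
  fun x => mpartialR beta (fun y => complex.Re (f y)) x +i*
           mpartialR beta (fun y => complex.Im (f y)) x.

Definition L2norm (D : set 'rV[R]_d) f : \bar R :=
  'N[lebesgue_row R d]_(2%:E) [((fun x => (Normc.normc (f x))%:E) \_ D)].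

End smooth.

(* Main.v *)
(** On a box of side l, a function g of one variable is compared with its
Lagrange interpolant at N+1 well separated nodes chosen in the part of a set E
where g is at most of its mean size on E: if E fills a fixed proportion of the
interval, this bounds the L2 norm of g there by C^N times its L2 norm on E plus
l^N/N! times that of its N-th derivative. Slicing with Fubini extends the bound
to boxes in dimension d, with only the pure derivatives d_i^N g on the right
(the order N+1 also enters, to trade the sup norm for the L2 norm).

Thickness of omega transfers from the balls B(x, rho(x)) to boxes by a Vitali
selection as soon as the balls centered in the middle of the box stay inside it.
Since rho(x) <= eta |x| at infinity and rho(x) <= R (1+|x|^2)^(delta/2), the
space is covered, with bounded multiplicity, by such boxes of side l at most
B (1+|x|^2)^(delta/2) at all their points x. Hence l^N may be absorbed into the
weight, and summing over the boxes bounds the norm of f by C^N times its norm on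
omega plus an error controlled by the hypothesis with n about delta N, namely
C^N D_2^(4N) N!^(2s-2) D_1^2. Taking N of order D_2^(2/(1-s)) + log(1/eps) makes
the error at most eps D_1^2. *)
Require Import Defs.
From HB Require Import structures.
From mathcomp Require Import all_boot all_order all_algebra.
From mathcomp Require Import all_classical all_reals all_analysis.
From mathcomp Require Import measurable_realfun complex ring lra zify.
Import Order.TTheory GRing.Theory Num.Theory.
Import numFieldNormedType.Exports.

Set Implicit Arguments.
Unset Strict Implicit.
Unset Printing Implicit Defensive.

Local Open Scope classical_set_scope.
Local Open Scope ring_scope.

(** * Lagrange interpolation *)

Section interpolation.
Context {R : realType}.
Implicit Types (g : nat -> R -> R) (x z : nat -> R) (a b h y B : R).

(** The exponent [2/(1-s)] comes from a balance. The hypothesis offers integer weight exponents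
    only, so [n] is the ceiling of [delta N]. Then [n <= N] makes [D_2^(n+N)] at most [D_2^(2N)],
    and [n!^nu N!^mu] is at most [N!^s] up to a factor [C^N]. After squaring and division by [N!^2]
    the error is about [(A D_2^2 / N^(1-s))^(2N)], which is small once [N^(1-s)] exceeds a multiple
    of [D_2^2]. Only [s] survives, and the covering constants do not involve [delta]; hence [K] is
    fixed before [delta] and [mu]. The two bounds on [rho] do different work in the covering. By
    [rho <= eta |x|], a slab of size comparable to [|x|] contains the balls centered in its middle,
    but such a slab may be too long for the weight. The power bound then allows it to be cut down to
    side about [|x|^delta]. Fubini is run on Borel sets while [omega] is only Lebesgue measurable,
    so inside each box a Borel subset of [omega] is used, at the cost of half the density. Real and
    imaginary parts are estimated separately and added at the end. *)

Lemma iterated_Rolle n : forall g z,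
  (forall k (t : R), is_derive t 1 (g k) (g k.+1 t)) ->
  (forall i, (i < n)%N -> z i < z i.+1) ->
  (forall i, (i <= n)%N -> g 0%N (z i) = 0) ->
  exists2 xi, z 0%N <= xi <= z n & g n xi = 0.
Proof.
elim: n => [|n IHn] g z dg zlt gz.
  by exists (z 0%N); [rewrite lexx|exact: gz].
(* The choice of zeros is made total: outside the range the witness 0 is a dummy, so [w] is a
   function on all naturals. *)
have step i : {w | (i < n.+1)%N -> z i < w < z i.+1 /\ g 1%N w = 0}.
  apply/cid; have [iN|iN] := boolP (i < n.+1)%N; last by exists 0.
  have [||||w] := @Rolle R (g 0%N) (z i) (z i.+1).
  - exact: zlt.
  - by move=> t _; have [] := dg 0%N t.
  - by apply: derivable_within_continuous => t _; have [] := dg 0%N t.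
  - by rewrite !gz // ltnW.
  rewrite in_itv/= => wz dw; exists w => _; split => //.
  by have [_ <-] := dg 0%N w; have [_ <-] := dw.
pose w i := sval (step i).
have wP i : (i < n.+1)%N -> z i < w i < z i.+1 /\ g 1%N (w i) = 0.
  exact: (svalP (step i)).
have [||xi /andP[w0 wn] gxi] := IHn (fun k => g k.+1) w (fun k => dg k.+1).
- move=> i iN; have [/andP[_ h1] _] := wP i (ltnW iN).
  by have [/andP[h2 _] _] := wP i.+1 iN; exact: lt_trans h1 h2.
- by move=> i iN; have [] := wP i iN.
exists xi => //; have [/andP[h1 _] _] := wP 0%N isT.
have [/andP[_ h2] _] := wP n (ltnSn n).
by rewrite (le_trans (ltW h1) w0) (le_trans wn (ltW h2)).
Qed.

Lemma iterated_Rolle_seq g (s : seq R) n a b :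
  (forall k (t : R), is_derive t 1 (g k) (g k.+1 t)) ->
  uniq s -> size s = n.+1 ->
  (forall t, t \in s -> a <= t <= b /\ g 0%N t = 0) ->
  exists2 xi, a <= xi <= b & g n xi = 0.
Proof.
move=> dg us ss sab; pose r := sort <=%R s.
have rs t : t \in r -> a <= t <= b /\ g 0%N t = 0 by rewrite mem_sort; exact: sab.
have sr : size r = n.+1 by rewrite size_sort.
have ltr : sorted <%R r by rewrite lt_sorted_uniq_le sort_uniq us sort_le_sorted.
have mr i : (i <= n)%N -> r`_i \in r by move=> iN; apply: mem_nth; rewrite sr.
have [||xi /andP[r0 rn] gxi] := @iterated_Rolle n g (nth 0 r) dg.
- by move=> i iN; rewrite (lt_sorted_ltn_nth 0 ltr) ?inE ?sr// ltnW.
- by move=> i iN; have [] := rs _ (mr _ iN).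
exists xi => //; have [/andP[ar _] _] := rs _ (mr 0%N isT).
have [/andP[_ rb] _] := rs _ (mr n (leqnn n)).
by rewrite (le_trans ar r0) (le_trans rn rb).
Qed.

Lemma card_ord_neq n j : (j < n)%N ->
  #|[pred i : 'I_n | i != j :> nat]| = n.-1.
Proof.
move=> jn; rewrite -[in RHS](card_ord n) -(cardC1 (Ordinal jn)).
by apply: eq_card => i; rewrite !inE.
Qed.

Definition lagrange_basis n x (j : nat) : {poly R} :=
  \prod_(i < n | i != j :> nat) ((x j - x i)^-1 *: ('X - (x i)%:P)).

Lemma size_lagrange_basis n x j : (j < n)%N ->
  (size (lagrange_basis n x j) <= n)%N.
Proof.
move=> jn; rewrite /lagrange_basis.
rewrite (leq_trans (size_prod_leq _ _))//.
have cardj := card_ord_neq jn.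
apply: (@leq_trans ((\sum_(i < n | i != j :> nat) 2).+1 - n.-1)%N).
  rewrite cardj leq_sub2r// ltnS; apply: leq_sum => i _.
  by rewrite (leq_trans (size_scale_leq _ _))// size_XsubC.
by rewrite sum_nat_const cardj; case: n jn cardj => // n _ _ /=; rewrite muln2 -addnn -addnS addKn.
Qed.

Lemma lagrange_basisE n x j k : (forall i j, (i < j < n)%N -> x i != x j) ->
  (j < n)%N -> (k < n)%N -> (lagrange_basis n x j).[x k] = (j == k)%:R.
Proof.
move=> xinj jn kn; rewrite /lagrange_basis horner_prod.
have xne i l : (i < n)%N -> (l < n)%N -> i != l -> x i - x l != 0.
  move=> ii ll; rewrite subr_eq0 neq_ltn => /orP[il|li].
    by apply: xinj; rewrite il.
  by rewrite eq_sym; apply: xinj; rewrite li.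
have [<-|jk] := eqVneq.
  rewrite big1// => i ij; rewrite !hornerE mulVf//.
  by apply: xne => //; rewrite eq_sym.
rewrite (bigD1 (Ordinal kn))/=; last by rewrite eq_sym.
by rewrite !hornerE subrr mulr0 mul0r.
Qed.

(** With [p] the interpolant and [w] the nodal polynomial, [g - p - c w] vanishes at the [n] nodes
    and, by the choice of [c], at [y]. These [n + 1] zeros give a zero [xi] of its [n]-th
    derivative, to which [p] contributes 0 and [w] the constant [n!]. Hence
    [g(y) - p(y) = w(y) g^(n)(xi) / n!], and each factor of [w(y)] is at most [b - a]. *)
Lemma interpolation_error n g x a b y B :
  (forall k (t : R), is_derive t 1 (g k) (g k.+1 t)) ->
  (forall i j, (i < j < n)%N -> x i != x j) ->
  (forall i, (i < n)%N -> a <= x i <= b) -> a <= y <= b ->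
  (forall t, a <= t <= b -> `|g n t| <= B) ->
  `|g 0%N y| <= \sum_(j < n) `|g 0%N (x j)| * `|(lagrange_basis n x j).[y]|
                + (b - a) ^+ n / n`!%:R * B.
Proof.
move=> dg xinj xab yab gB.
have [a_le_b B0] : a <= b /\ 0 <= B.
  case/andP: (yab) => ay yb; split; first exact: le_trans ay yb.
  by rewrite (le_trans _ (gB y yab)).
have err0 : 0 <= (b - a) ^+ n / n`!%:R * B.
  by rewrite mulr_ge0// divr_ge0// exprn_ge0// subr_ge0.
(* At a node [w(y)] is 0 and [c] makes no sense; there a single term of the sum, with basis value 1,
   already gives the bound. *)
have [/existsP[j /eqP yxj]|/existsPn yx] := boolP [exists j : 'I_n, y == x j].
  rewrite (bigD1 j)//= {2}yxj lagrange_basisE// eqxx normr1 mulr1 -yxj.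
  by rewrite -addrA lerDl addr_ge0// sumr_ge0// => i _; rewrite mulr_ge0.
pose p : {poly R} := \sum_(j < n) g 0%N (x j) *: lagrange_basis n x j.
pose w : {poly R} := \prod_(j < n) ('X - (x j)%:P).
have wy : w.[y] != 0.
  rewrite horner_prod; apply/prodf_neq0 => i _.
  by rewrite !hornerE subr_eq0; exact: yx.
pose c := (g 0%N y - p.[y]) / w.[y].
pose phi k t := g k t - (p^`(k)).[t] - c * (w^`(k)).[t].
have dphi k (t : R) : is_derive t 1 (phi k) (phi k.+1 t).
  rewrite /phi !derivnS.
  have -> : (fun t => g k t - (p^`(k)).[t] - c * (w^`(k)).[t])
          = g k - horner p^`(k) - c \*: horner w^`(k) by apply/funext => u.
  by apply: is_deriveB; apply: is_deriveB; exact: dg.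
have wx k : (k < n)%N -> w.[x k] = 0.
  move=> kn; rewrite horner_prod (bigD1 (Ordinal kn))//= !hornerE subrr.
  by rewrite mul0r.
have px k : (k < n)%N -> p.[x k] = g 0%N (x k).
  move=> kn; rewrite horner_sum (bigD1 (Ordinal kn))//= big1 ?addr0.
    by rewrite hornerZ lagrange_basisE// eqxx mulr1.
  move=> i ik; have ik' : (i == k :> nat) = false.
    by apply: contraNF ik => /eqP ik; apply/eqP/val_inj.
  by rewrite hornerZ lagrange_basisE// ik' mulr0.
have [|||xi xiab] := @iterated_Rolle_seq phi (y :: mkseq x n) n a b dphi.
- rewrite cons_uniq; apply/andP; split.
    apply/mapP => -[k]; rewrite mem_iota/= add0n => kN yk.
    by have := yx (Ordinal kN); rewrite yk eqxx.
  apply/mkseq_uniqP => i j; rewrite !inE => iN jN xij.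
  case: (ltngtP i j) => // ij.
    by have := xinj i j; rewrite ij jN xij eqxx => /(_ isT).
  by have := xinj j i; rewrite ij iN xij eqxx => /(_ isT).
- by rewrite /= size_mkseq.
- move=> t; rewrite inE => /orP[/eqP ->|].
    by split => //; rewrite /phi /= /c divfK// subrr.
  move=> /mapP[k]; rewrite mem_iota/= add0n => kN ->; split; first exact: xab.
  by rewrite /phi /= px// wx// subrr mulr0 subrr.
rewrite /phi.
have -> : p^`(n) = 0.
  apply: derivn_poly0; rewrite (leq_trans (size_sum _ _ _))//.
  apply/bigmax_leqP => i _; rewrite (leq_trans (size_scale_leq _ _))//.
  exact: size_lagrange_basis.
have -> : w^`(n) = (n`!%:R)%:P.
  have sw : size w = n.+1 by rewrite size_prod_XsubC /index_enum -enumT size_enum_ord.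
  have mw : w \is monic by rewrite monic_prod// => i _; rewrite monicXsubC.
  apply/polyP => i; rewrite coef_derivn coefC.
  have [->|i0] := eqVneq i 0%N.
    rewrite addn0 ffactnn; move/monicP : mw; rewrite /lead_coef sw/= => ->.
    by [].
  rewrite nth_default ?mul0rn// sw.
  by rewrite -addn1 leq_add2l lt0n.
rewrite hornerC horner0 subr0 => /eqP; rewrite subr_eq0 => /eqP cE.
have -> : g 0%N y = p.[y] + w.[y] / n`!%:R * g n xi.
  rewrite cE /c; field.
  by rewrite wy/= pnatr_eq0 -lt0n fact_gt0.
rewrite (le_trans (ler_normD _ _))// lerD//.
  rewrite horner_sum (le_trans (ler_norm_sum _ _ _))//.
  by apply: ler_sum => i _; rewrite hornerZ normrM.
rewrite !normrM ler_pM ?mulr_ge0//; last exact: gB.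
rewrite ler_pM//; last by rewrite normfV normr_nat.
rewrite horner_prod normr_prod -[X in _ ^+ X]card_ord -prodr_const.
apply: ler_prod => i _; rewrite normr_ge0 !hornerE ler_norml.
by move: (xab i (ltn_ord i)) yab => /andP[? ?] /andP[? ?]; apply/andP; split; lra.
Qed.

(** With truncated subtraction, [(i - j) + (j - i)] is the distance [|i - j|]; the indices below and
    above [j] give one factorial each. *)
Lemma prod_dist_ord n j : (j <= n)%N ->
  \prod_(0 <= i < n.+1 | i != j) ((i - j) + (j - i))%N = (j`! * (n - j)`!)%N.
Proof.
move=> jn; rewrite (@big_cat_nat _ _ _ j)//=; last exact: leqW.
congr (_ * _)%N.
  rewrite fact_prod big_nat_rev/= big_add1 /= add0n big_nat_cond [RHS]big_nat_cond.
  apply: eq_big => [i|i]; last first.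
    move=> /andP[/andP[_ ij] _]; have := subnK ij; lia.
  by rewrite /= andbT; case: ltnP => //= ij; apply/eqP; lia.
rewrite big_ltn_cond// eqxx/= fact_prod -{1}(add0n j.+1) big_addn/=.
rewrite subSS big_add1 /=.
rewrite big_nat_cond [RHS]big_nat_cond; apply: eq_big => [i|i _]; last by lia.
by rewrite andbT andbC; case: eqP => //; lia.
Qed.

Lemma sum_inv_fact n :
  \sum_(j < n.+1) ((j`! * (n - j)`!)%N%:R : R)^-1 = 2 ^+ n / n`!%:R.
Proof.
rewrite -[2]/(1 + 1) exprDn mulr_suml; apply: eq_bigr => j _.
rewrite !expr1n mulr1 -(bin_fact (leq_ord j)) (natrM _ 'C(n, j)) invfM mulrA.
rewrite divff ?mul1r//.
by rewrite pnatr_eq0 -lt0n bin_gt0 leq_ord.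
Qed.

(** Gaps of at least [h] give [|x j - x i| >= |i - j| h], so the [j]-th basis polynomial is at most
    [((b - a) / h)^n / (j! (n - j)!)]; the binomial theorem sums the reciprocals to [2^n / n!]. *)
Lemma sum_lagrange_basis n x h a b y : 0 < h ->
  (forall i, (i < n)%N -> x i + h <= x i.+1) ->
  (forall i, (i <= n)%N -> a <= x i <= b) -> a <= y <= b ->
  \sum_(j < n.+1) `|(lagrange_basis n.+1 x j).[y]|
    <= (2 * (b - a) / h) ^+ n / n`!%:R.
Proof.
move=> h0 xh xab yab.
have gap i k : (i + k <= n)%N -> x i + k%:R * h <= x (i + k)%N.
  elim: k => [|k IHk] ik; first by rewrite mul0r addr0 addn0.
  have := IHk (ltnW (leq_trans (eq_leq (esym (addnS i k))) ik)).
  by have := xh (i + k)%N; rewrite -addnS => /(_ ik); rewrite mulrS; lra.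
have gap' i j : (i <= n)%N -> (j <= n)%N ->
    ((i - j) + (j - i))%N%:R * h <= `|x j - x i|.
  move=> iN jN; have [ij|ji] := leqP i j.
    have := gap i (j - i)%N; rewrite (subnKC ij) => /(_ jN).
    rewrite (eqP ij) add0n => le1.
    by rewrite (le_trans _ (ler_norm _))//; lra.
  have := gap j (i - j)%N; rewrite (subnKC (ltnW ji)) => /(_ iN).
  rewrite (eqP (ltnW ji)) addn0 => le1.
  by rewrite distrC (le_trans _ (ler_norm _))//; lra.
have -> : (2 * (b - a) / h) ^+ n / n`!%:R
        = \sum_(j < n.+1) ((b - a) / h) ^+ n / (j`! * (n - j)`!)%N%:R.
  by rewrite -mulr_sumr sum_inv_fact -mulrA exprMn mulrA [_ * 2 ^+ n]mulrC.
apply: ler_sum => j _.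
rewrite /lagrange_basis horner_prod normr_prod -prod_dist_ord ?leq_ord//.
rewrite natr_prod big_mkord -prodfV.
have -> : ((b - a) / h) ^+ n
        = \prod_(i < n.+1 | i != j :> nat) ((b - a) / h).
  by rewrite prodr_const; congr (_ ^+ _); rewrite (@card_ord_neq n.+1).
rewrite -big_split/=; apply: ler_prod => i ij.
rewrite normr_ge0 !hornerE normrM normfV/=.
have k0 : (0 < (i - j) + (j - i))%N.
  by rewrite lt0n; apply: contraNneq ij => ij; apply/eqP; lia.
have kh0 : 0 < (i - j + (j - i))%N%:R * h by rewrite mulr_gt0// ltr0n.
rewrite -mulrA -invfM mulrC [h * _]mulrC.
apply: ler_pM => //.
  rewrite ler_norml; move: (xab i (leq_ord i)) yab => /andP[? ?] /andP[? ?].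
  by apply/andP; split; lra.
have le1 := gap' _ _ (leq_ord i) (leq_ord j).
by rewrite lef_pV2// posrE; exact: lt_le_trans le1.
Qed.

End interpolation.

(** * A Remez inequality on intervals *)

Section one_dimensional.
Context {R : realType}.
Local Notation mu := (@lebesgue_measure R).
Implicit Types (g : nat -> R -> R) (a b h l y : R) (E : set (measurableTypeR R)).

(** Greedy choice: take a point of [E] within [h] of its infimum, then keep only the part of [E] at
    least [h] beyond that point. Each choice discards measure at most [2 h]. *)
Lemma separated_points (m h : R) n : 0 < h -> forall E,
  measurable E -> (forall t, E t -> m <= t) ->
  ((2 * h * n%:R)%:E < mu E)%E ->
  exists x : nat -> R, (forall i, (i <= n)%N -> E (x i)) /\
    (forall i, (i < n)%N -> x i + h <= x i.+1).
Proof.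
move=> h0; elim: n => [|n IHn] E mE Em hE.
  have [E0|/set0P[t Et]] := eqVneq E set0.
    by move: hE; rewrite E0 mulr0 measure0 ltxx.
  by exists (fun=> t); split.
have [E0|/set0P E0] := eqVneq E set0.
  by move: hE; rewrite E0 measure0 ltNge lee_fin !mulr_ge0// ltW.
have hinf : has_inf E by split => //; exists m => t; exact: Em.
have [x0 Ex0 x0lt] := inf_adherent h0 hinf.
pose E' := E `&` `[x0 + h, +oo[%classic.
have mE' : measurable E' by apply: measurableI.
have E'E : (mu E <= (2 * h)%:E + mu E')%E.
  have -> : (2 * h)%:E = mu `[inf E, inf E + 2 * h[%classic.
    rewrite lebesgue_measure_itv/= lte_fin ltrDl mulr_gt0//.
    by rewrite -EFinD addrAC subrr add0r.
  apply: (@le_trans _ _ (mu (`[inf E, inf E + 2 * h[%classic `|` E'))).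
    apply: le_measure; rewrite ?inE//; first exact: measurableU.
    move=> t Et; have [tl|tl] := ltP t (x0 + h).
      left; rewrite /= in_itv/= ge_inf//; last exact: hinf.2.
      by rewrite (lt_trans tl)//; lra.
    by right; split => //; rewrite /= in_itv/= tl.
  exact: measureU2.
have [||x [xE' xh]] := IHn E' mE'.
- by move=> t [Et _]; exact: Em.
- rewrite -(@lteD2lE _ (2 * h)%:E)// (lt_le_trans _ E'E)//.
  by rewrite -EFinD (le_lt_trans _ hE)// lee_fin mulrS; lra.
exists (fun i => if i is j.+1 then x j else x0); split => [[|i] iN//|[|i] iN].
- by have [] := xE' i iN.
- by have [_] := xE' 0%N isT; rewrite /= in_itv/= andbT.
- exact: xh.
Qed.

Lemma derive_continuous g k :
  (forall k (t : R), is_derive t 1 (g k) (g k.+1 t)) -> continuous (g k).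
Proof.
move=> dg t; apply/differentiable_continuous/derivable1_diffP.
by have [] := dg k t.
Qed.

(** For [F = g^2], the value at [y] exceeds the minimum by at most the integral of
    [|F'| = 2 |g g'| <= g^2 / l + l g'^2], and the minimum is at most the mean. The mean and the
    first term of this bound together make the constant 2. *)
Lemma sup_le_integral g a b y :
  (forall k (t : R), is_derive t 1 (g k) (g k.+1 t)) -> a < b -> a <= y <= b ->
  ((g 0%N y ^+ 2)%:E <=
    (2 / (b - a))%:E * \int[mu]_(t in `[a, b]) (g 0%N t ^+ 2)%:E
    + (b - a)%:E * \int[mu]_(t in `[a, b]) (g 1%N t ^+ 2)%:E)%E.
Proof.
move=> dg ab yab; set l := b - a; have l0 : 0 < l by rewrite subr_gt0.
have cg k : continuous (g k) by exact: derive_continuous.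
pose F k t := g k t ^+ 2.
have cF k : continuous (F k).
  have -> : F k = g k * g k by apply/funext => t; rewrite /F expr2.
  by move=> t; apply: continuousM; exact: cg.
have mF k (D : set (measurableTypeR R)) : measurable D ->
    measurable_fun D (fun t => (F k t)%:E).
  move=> mD; apply/measurable_EFinP/measurable_funTS.
  exact: continuous_measurable_fun.
pose K t := 2 * (g 0%N t * g 1%N t).
have cK : continuous K.
  by move=> t; apply: cvgM; [exact: cvg_cst|apply: cvgM; exact: cg].
pose H t := l^-1 * F 0%N t + l * F 1%N t.
have cH : continuous H.
  by move=> t; apply: cvgD; (apply: cvgM; first exact: cvg_cst); exact: cF.
have mH (D : set (measurableTypeR R)) : measurable D ->
    measurable_fun D (fun t => (H t)%:E).
  move=> mD; apply/measurable_EFinP/measurable_funTS.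
  exact: continuous_measurable_fun.
have F0 k t : 0 <= F k t by exact: sqr_ge0.
have H0 t : 0 <= H t by rewrite addr_ge0// mulr_ge0// ?invr_ge0 ltW.
have KH t : `|K t| <= H t.
  rewrite /K /H /F; set p := g 0%N t; set q := g 1%N t.
  have e1 : l^-1 * p ^+ 2 + l * q ^+ 2 - 2 * (p * q) = (p - l * q) ^+ 2 / l.
    by field; rewrite gt_eqF.
  have e2 : l^-1 * p ^+ 2 + l * q ^+ 2 + 2 * (p * q) = (p + l * q) ^+ 2 / l.
    by field; rewrite gt_eqF.
  have h1 : 0 <= (p - l * q) ^+ 2 / l by rewrite divr_ge0 ?sqr_ge0// ltW.
  have h2 : 0 <= (p + l * q) ^+ 2 / l by rewrite divr_ge0 ?sqr_ge0// ltW.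
  by rewrite ler_norml; apply/andP; split; lra.
have dF (t : R) : is_derive t 1 (F 0%N) (K t).
  rewrite /F /K; have -> : (fun t => g 0%N t ^+ 2) = g 0%N * g 0%N.
    by apply/funext => u; rewrite expr2.
  have h := dg 0%N t; apply: trigger_derive; rewrite /GRing.scale/=; ring.
have step u v : a <= u -> v <= b -> u < v ->
    ((`|F 0%N v - F 0%N u|)%:E <= \int[mu]_(t in `[a, b]) (H t)%:E)%E.
  move=> au vb uv.
  have fI : (\int[mu]_(x in `[u, v]) (K x)%:E = (F 0%N v)%:E - (F 0%N u)%:E)%E.
    apply: continuous_FTC2 => //.
    - exact: continuous_subspaceT.
    - split => [t _||]; first by have [] := dF t.
      + exact/cvg_at_right_filter/cF.
      + exact/cvg_at_left_filter/cF.
    - by move=> t _; rewrite derive1E; have [_ ->] := dF t.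
  rewrite -abse_EFin EFinB -fI.
  apply: (@le_trans _ _ (\int[mu]_(t in `[u, v]) (H t)%:E)%E).
    apply: (le_trans (le_abse_integral _ _ _)) => //.
      apply/measurable_EFinP/measurable_funTS; exact: continuous_measurable_fun.
    apply: ge0_le_integral => //.
    - apply/measurableT_comp => //; apply/measurable_EFinP/measurable_funTS.
      exact: continuous_measurable_fun.
    - exact: mH.
    - by move=> t _; rewrite lee_fin; exact: KH.
  apply: ge0_subset_integral => //; first exact: mH.
    by move=> t _; rewrite lee_fin.
  move=> t /=; rewrite !in_itv/= => /andP[ut tv].
  by rewrite (le_trans au ut) (le_trans tv vb).
have [c cab cmin] : exists2 c, c \in `[a, b] & forall t, t \in `[a, b] -> F 0%N c <= F 0%N t.
  by apply: EVT_min; [exact: ltW|exact: continuous_subspaceT].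
have Fc : ((F 0%N c)%:E <= l^-1%:E * \int[mu]_(t in `[a, b]) (F 0%N t)%:E)%E.
  rewrite lee_pdivlMl//.
  have mul : mu `[a, b]%classic = l%:E by rewrite lebesgue_measure_itv/= lte_fin ab.
  have -> : (l%:E * (F 0%N c)%:E = \int[mu]_(t in `[a, b]) (cst (F 0%N c)%:E t))%E.
    rewrite integral_cst// muleC; congr (_ * _)%E; exact/esym/mul.
  apply: ge0_le_integral => //.
  - by move=> t _; rewrite lee_fin.
  - exact: mF.
have Fyc : ((F 0%N y)%:E <= (F 0%N c)%:E + \int[mu]_(t in `[a, b]) (H t)%:E)%E.
  move: cab; rewrite in_itv/= => /andP[ac cb]; case/andP: yab => ay yb.
  have [yc|cy|->] := ltgtP y c.
  - rewrite -leeBlDl//; apply: le_trans (step _ _ ay cb yc).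
    by rewrite -EFinB lee_fin distrC ler_norm.
  - rewrite -leeBlDl//; apply: le_trans (step _ _ ac yb cy).
    by rewrite -EFinB lee_fin ler_norm.
  - by rewrite leeDl// integral_ge0// => t _; rewrite lee_fin.
apply: (le_trans Fyc).
have -> : (\int[mu]_(t in `[a, b]) (H t)%:E = l^-1%:E * \int[mu]_(t in `[a, b]) (F 0%N t)%:E
    + l%:E * \int[mu]_(t in `[a, b]) (F 1%N t)%:E)%E.
  transitivity (\int[mu]_(t in `[a, b]) (l^-1%:E * (F 0%N t)%:E + l%:E * (F 1%N t)%:E))%E.
    by apply: eq_integral => t _.
  rewrite ge0_integralD//; last 4 first.
  - by move=> t _; rewrite -EFinM lee_fin mulr_ge0// invr_ge0 ltW.
  - by apply: measurable_funeM; exact: mF.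
  - by move=> t _; rewrite -EFinM lee_fin mulr_ge0// ltW.
  - by apply: measurable_funeM; exact: mF.
  by rewrite !ge0_integralZl_EFin//; try exact: mF; try (by move=> t _; rewrite lee_fin);
    rewrite ?invr_ge0 ltW.
rewrite addeA leeD2r//.
have -> : ((2 / l)%:E = l^-1%:E + l^-1%:E)%E by rewrite -EFinD; congr EFin; lra.
rewrite ge0_muleDl ?lee_fin ?invr_ge0 ?(ltW l0)//.
exact: leeD2r.
Qed.

Lemma exprn_fact_le n : (n.+1%:R ^+ n / n`!%:R : R) <= expR 1 ^+ n.+1.
Proof.
have -> : (n.+1%:R ^+ n / n`!%:R : R) = n.+1%:R ^+ n.+1 / n.+1`!%:R.
  rewrite factS natrM exprS; field.
  by rewrite nat1r !pnatr_eq0 -lt0n fact_gt0.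
have expRn : expR n.+1%:R = expR 1 ^+ n.+1 :> R by rewrite -expRM_natl mulr1.
by have := expR_ge1Dxn n (ler0n R n.+1); rewrite expRn; lra.
Qed.

(* The nodes are taken in the part of [E] where [g] is at most twice its mean
   square on [E]. *)
Lemma Remez_sup (c J : R) n g a b E y :
  (forall k (t : R), is_derive t 1 (g k) (g k.+1 t)) ->
  0 < c <= 1 -> a < b -> a <= y <= b -> measurable E -> E `<=` `[a, b[%classic ->
  ((c * (b - a))%:E <= mu E)%E ->
  0 < J -> (\int[mu]_(t in E) (g 0%N t ^+ 2)%:E <= J%:E)%E ->
  ((g 0%N y ^+ 2)%:E <=
    ((8 * expR 1 / c) ^+ (2 * n.+1) * (6 * J / (c * (b - a))))%:E
    + (2 * ((b - a) ^+ n.+1 / n.+1`!%:R) ^+ 2)%:E *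
      ((2 / (b - a))%:E * \int[mu]_(t in `[a, b]) (g n.+1 t ^+ 2)%:E
      + (b - a)%:E * \int[mu]_(t in `[a, b]) (g n.+2 t ^+ 2)%:E))%E.
Proof.
move=> dg /andP[c0 c1] ab yab mE Eab cE J0 EJ.
set l := b - a; have l0 : 0 < l by rewrite subr_gt0.
have cg k : continuous (g k) by exact: derive_continuous.
pose F k t := g k t ^+ 2.
have cF k : continuous (F k).
  have -> : F k = g k * g k by apply/funext => t; rewrite /F expr2.
  by move=> t; apply: continuousM; exact: cg.
have mF k (D : set (measurableTypeR R)) : measurable D ->
    measurable_fun D (fun t => (F k t)%:E).
  move=> mD; apply/measurable_EFinP/measurable_funTS.
  exact: continuous_measurable_fun.
have Ioo k : (\int[mu]_(t in `[a, b]) (F k t)%:E < +oo)%E.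
  have /integrableP[_] : mu.-integrable `[a, b]%classic (EFin \o F k).
    apply: continuous_compact_integrable; first exact: segment_compact.
    exact: continuous_subspaceT.
  apply: le_lt_trans; rewrite le_eqVlt; apply/orP; left; apply/eqP.
  by apply: eq_integral => t _ /=; rewrite ger0_norm// sqr_ge0.
have I0 k : (0 <= \int[mu]_(t in `[a, b]) (F k t)%:E)%E.
  by apply: integral_ge0 => t _; rewrite lee_fin sqr_ge0.
(* By Chebyshev, removing the part of [E] where [g^2] exceeds this level costs at most a third of
   [c * l]. What remains exceeds [2 * h * n], which is at most [c * l / 2] for the [h] chosen
   below. *)
pose lam := 3 * J / (c * l).
have cl0 : 0 < c * l by rewrite mulr_gt0.
have lam0 : 0 < lam by rewrite divr_gt0// mulr_gt0.
pose U : set (measurableTypeR R) := [set t | F 0%N t <= lam].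
have mU : measurable U.
  have -> : U = setT `&` (F 0%N) @^-1` `]-oo, lam]%classic.
    by rewrite setTI; apply/seteqP; split => t; rewrite /= in_itv.
  by apply: (continuous_measurable_fun (cF 0%N)) => //; exact: measurable_itv.
have mEU : measurable (E `&` U) by exact: measurableI.
have mED : measurable (E `\` U) by exact: measurableD.
have ED : (mu (E `\` U) <= (c * l / 3)%:E)%E.
  have -> : (c * l / 3)%:E = (lam^-1 * J)%:E.
    by congr EFin; rewrite /lam; field; rewrite !gt_eqF.
  rewrite EFinM -lee_pdivrMl ?invr_gt0// invrK.
  apply: le_trans EJ.
  apply: (@le_trans _ _ (\int[mu]_(t in E `\` U) (F 0%N t)%:E)%E).
    rewrite -integral_cst//; apply: ge0_le_integral => //.
    - by move=> t _; rewrite lee_fin ltW.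
    - exact: mF.
    - by move=> t [_ /negP Ut]; rewrite lee_fin ltW// ltNge.
  apply: ge0_subset_integral => //; first exact: mF.
  by move=> t _; rewrite lee_fin sqr_ge0.
have n0 : 0 < n.+1%:R :> R by rewrite ltr0n.
pose h := c * l / (4 * n.+1%:R).
have h0 : 0 < h by rewrite divr_gt0// mulr_gt0.
have [|||x [xE xh]] := @separated_points a h n h0 (E `&` U).
- exact: mEU.
- by move=> t [/Eab + _]; rewrite /= in_itv/= => /andP[].
- rewrite ltNge; apply/negP => EU.
  have : (mu E <= mu (E `&` U) + mu (E `\` U))%E.
    by rewrite -{1}(setUIDK E U); exact: measureU2.
  apply/negP; rewrite -ltNge; apply: lt_le_trans cE.
  apply: (le_lt_trans (leeD EU ED)); rewrite -EFinD lte_fin -/l.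
  have -> : 2 * h * n%:R = c * l * (n%:R / n.+1%:R) / 2.
    by rewrite /h; field; rewrite nat1r gt_eqF.
  have : n%:R / n.+1%:R <= 1 :> R by rewrite ler_pdivrMr// mul1r ler_nat.
  move: (c * l) cl0 (n%:R / n.+1%:R : R) => p p0 r r1.
  by have := ler_wpM2l (ltW p0) r1; lra.
have xab i : (i <= n)%N -> a <= x i <= b.
  by move=> /xE[/Eab]; rewrite /= in_itv/= => /andP[-> /ltW ->].
have gx i : (i <= n)%N -> `|g 0%N (x i)| <= Num.sqrt lam.
  by move=> /xE[_ /= Ux]; rewrite -sqrtr_sqr ler_wsqrtr.
(* By [sup_le_integral] this bounds the square of [g n.+1] on all of [[a, b]]; it is here that the
   order [n + 2] enters. *)
set S := ((2 / l)%:E * _ + _)%E.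
have S0 : (0 <= S)%E.
  by apply: adde_ge0; apply: mule_ge0; rewrite ?I0 ?lee_fin ?divr_ge0// ltW.
have Sfin : S \is a fin_num.
  by rewrite /S fin_numD; apply/andP; split; apply: fin_numM => //;
    rewrite ge0_fin_numE ?I0//; exact: Ioo.
have [s Ss] : exists s : R, S = s%:E by exists (fine S); rewrite fineK.
have s0 : 0 <= s by rewrite -lee_fin -Ss.
have gS t : a <= t <= b -> `|g n.+1 t| <= Num.sqrt s.
  move=> tab; rewrite -sqrtr_sqr ler_wsqrtr// -lee_fin -Ss.
  have := @sup_le_integral (fun k => g (k + n.+1)%N) a b t.
  by apply => // k u; rewrite addSn.
have xinj i j : (i < j < n.+1)%N -> x i != x j.
  move=> /andP[ij]; rewrite ltnS => jn; rewrite lt_eqF//.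
  elim: j ij jn => // j IHj; rewrite ltnS leq_eqVlt => /orP[/eqP <-|ij] jn.
    by rewrite (lt_le_trans _ (xh i jn))// ltrDl.
  by rewrite (lt_trans (IHj ij (ltnW jn)))// (lt_le_trans _ (xh j jn))// ltrDl.
have := interpolation_error dg xinj (fun i iN => xab i iN) yab gS.
set T := _ / _; set A := \sum_(_ < _) _ => gy.
(* The 8 comes from [2 l / h = (8 / c) (n + 1)], and [exprn_fact_le] turns [(n + 1)^n / n!] into
   [e^(n + 1)]. *)
set Q := 8 * expR 1 / c.
have AQ : A <= Num.sqrt lam * Q ^+ n.+1.
  apply: (@le_trans _ _ (Num.sqrt lam * \sum_(j < n.+1) `|(lagrange_basis n.+1 x j).[y]|)).
    rewrite mulr_sumr; apply: ler_sum => i _; apply: ler_wpM2r => //.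
    exact: gx (leq_ord i).
  rewrite ler_wpM2l ?sqrtr_ge0// (le_trans (sum_lagrange_basis h0 xh xab yab))//.
  have -> : 2 * (b - a) / h = 8 / c * n.+1%:R.
    by rewrite /h -/l; field; rewrite !gt_eqF.
  rewrite exprMn -mulrA (_ : Q = 8 / c * expR 1); last by rewrite /Q; lra.
  rewrite [leRHS]exprMn; apply: ler_pM.
  - by rewrite exprn_ge0// divr_ge0// ltW.
  - by rewrite divr_ge0// exprn_ge0.
  - rewrite exprS ler_peMl ?exprn_ge0 ?divr_ge0 ?(ltW c0)//.
    by rewrite ler_pdivlMr// mul1r; lra.
  - exact: exprn_fact_le.
have T0 : 0 <= T by rewrite divr_ge0// exprn_ge0// ltW.
rewrite Ss -EFinM -EFinD lee_fin -real_normK ?num_real//.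
have le1 : `|g 0%N y| <= Num.sqrt lam * Q ^+ n.+1 + T * Num.sqrt s.
  by rewrite (le_trans gy)// lerD2r.
rewrite (le_trans (ler_pM _ _ le1 le1))//.
have := sqr_sqrtr s0; have := sqr_sqrtr (ltW lam0).
have -> : 6 * J / (c * l) = 2 * lam by rewrite /lam; lra.
rewrite mulnC exprM; set q := Q ^+ n.+1; set u := Num.sqrt lam; set v := Num.sqrt s.
move=> <- <-; rewrite -subr_ge0.
have -> : q ^+ 2 * (2 * u ^+ 2) + 2 * T ^+ 2 * v ^+ 2
   - (u * q + T * v) * (u * q + T * v) = (u * q - T * v) ^+ 2 by ring.
exact: sqr_ge0.
Qed.

Lemma Remez_L2 (c : R) : 0 < c <= 1 -> exists2 C : R, 1 <= C &
  forall n g a b l E, (forall k (t : R), is_derive t 1 (g k) (g k.+1 t)) ->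
  a < b -> b - a <= l -> measurable E -> E `<=` `[a, b[%classic ->
  ((c * (b - a))%:E <= mu E)%E ->
  (\int[mu]_(t in `[a, b[) (g 0%N t ^+ 2)%:E <=
   (C ^+ n.+1)%:E * (\int[mu]_(t in E) (g 0%N t ^+ 2)%:E +
     ((l ^+ n.+1 / n.+1`!%:R) ^+ 2)%:E *
       (\int[mu]_(t in `[a, b[) (g n.+1 t ^+ 2)%:E
        + (l ^+ 2)%:E * \int[mu]_(t in `[a, b[) (g n.+2 t ^+ 2)%:E)))%E.
Proof.
move=> c01; have [c0 c1] := andP c01.
pose Q := 8 * expR 1 / c : R.
have Q0 : 0 <= Q by rewrite divr_ge0 ?(ltW c0)// mulr_ge0// expR_ge0.
have c6 : 1 <= 6 / c by rewrite ler_pdivlMr// mul1r; lra.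
(* As [6 / c >= 1], this prefactor is at most its own power of order [n + 1]; the summand 4 absorbs
   the numerical factor of the derivative terms. *)
pose C := 6 / c * Q ^+ 2 + 4.
have CQ n : 6 / c * Q ^+ (2 * n.+1) <= C ^+ n.+1.
  rewrite exprM; apply: (@le_trans _ _ ((6 / c * Q ^+ 2) ^+ n.+1)).
    rewrite [leRHS]exprMn ler_wpM2r ?exprn_ge0//.
    by rewrite exprS ler_peMr ?exprn_ege1//; lra.
  by rewrite lerXn2r ?nnegrE ?lerDl ?addr_ge0 ?mulr_ge0 ?exprn_ge0//; lra.
have C4 : 4 <= C by rewrite lerDr mulr_ge0 ?exprn_ge0//; lra.
have C1 : 1 <= C by lra.
exists C => // n g a b l E dg ab bal mE Eab cE.
have C4n : 4 <= C ^+ n.+1.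
  by rewrite (le_trans C4)// exprS ler_peMr ?exprn_ege1//; lra.
have ba0 : 0 < b - a by rewrite subr_gt0.
have mf k : measurable_fun [set: measurableTypeR R] (fun t => (g k t ^+ 2)%:E).
  apply/measurable_EFinP; apply: measurable_funX; apply: continuous_measurable_fun.
  exact: derive_continuous.
have mfD k (D : set (measurableTypeR R)) : measurable_fun D (fun t => (g k t ^+ 2)%:E).
  exact: measurable_funTS.
have Ifin k : exists2 i : R, 0 <= i & (\int[mu]_(t in `[a, b]) (g k t ^+ 2)%:E = i%:E)%E.
  have I0 : (0 <= \int[mu]_(t in `[a, b]) (g k t ^+ 2)%:E)%E.
    by apply: integral_ge0 => t _; rewrite lee_fin sqr_ge0.
  have Ioo : (\int[mu]_(t in `[a, b]) (g k t ^+ 2)%:E < +oo)%E.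
    have /integrableP[_] : mu.-integrable `[a, b]%classic (fun t => (g k t ^+ 2)%:E).
      apply: continuous_compact_integrable; first exact: segment_compact.
      apply: continuous_subspaceT.
      have -> : (fun t => g k t ^+ 2) = g k * g k by apply/funext => t; rewrite expr2.
      by move=> t; apply: continuousM; exact: derive_continuous.
    apply: le_lt_trans; rewrite le_eqVlt; apply/orP; left; apply/eqP.
    by apply: eq_integral => t _ /=; rewrite ger0_norm// sqr_ge0.
  exists (fine (\int[mu]_(t in `[a, b]) (g k t ^+ 2)%:E)); first exact: fine_ge0.
  by rewrite fineK// ge0_fin_numE.
have Ibnd k := integral_itv_bndo_bndc (mfD k `[a, b[%classic).
have [i0 i0_ge0 I0E] := Ifin 0%N.
have [i1 i1_ge0 I1E] := Ifin n.+1.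
have [i2 i2_ge0 I2E] := Ifin n.+2.
have [j j0 JE] : exists2 j : R, 0 <= j & (\int[mu]_(t in E) (g 0%N t ^+ 2)%:E = j%:E)%E.
  have J0 : (0 <= \int[mu]_(t in E) (g 0%N t ^+ 2)%:E)%E.
    by apply: integral_ge0 => t _; rewrite lee_fin sqr_ge0.
  have Joo : (\int[mu]_(t in E) (g 0%N t ^+ 2)%:E <= i0%:E)%E.
    rewrite -I0E -Ibnd; apply: ge0_subset_integral => //.
    by move=> t _; rewrite lee_fin sqr_ge0.
  exists (fine (\int[mu]_(t in E) (g 0%N t ^+ 2)%:E)); first exact: fine_ge0.
  by rewrite fineK// ge0_fin_numE// (le_lt_trans Joo)// ltry.
rewrite !Ibnd I0E I1E I2E JE -!EFinM lee_fin.
apply/ler_addgt0Pr => e e0.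
have Cn0 : 0 < C ^+ n.+1 by rewrite exprn_gt0//; lra.
(* [Remez_sup] asks for a positive bound on the integral over [E], which may vanish; the slack is
   the arbitrary [e] just introduced. *)
pose J := j + e / C ^+ n.+1.
have J0 : 0 < J by rewrite ltr_wpDl// divr_gt0.
set T := (l ^+ n.+1 / n.+1`!%:R) ^+ 2.
have T0 : 0 <= T by exact: sqr_ge0.
have T'T : ((b - a) ^+ n.+1 / n.+1`!%:R) ^+ 2 <= T.
  have l0 : 0 <= l by rewrite (le_trans (ltW ba0)).
  have b0 := ltW ba0.
  rewrite lerXn2r ?nnegrE ?divr_ge0 ?exprn_ge0//.
  by rewrite ler_wpM2r ?invr_ge0// lerXn2r ?nnegrE.
suff : i0 <= 6 / c * Q ^+ (2 * n.+1) * J + 4 * T * (i1 + l ^+ 2 * i2).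
  move=> /le_trans; apply.
  have -> : C ^+ n.+1 * (j + T * (i1 + l ^+ 2 * i2)) + e
          = C ^+ n.+1 * J + C ^+ n.+1 * T * (i1 + l ^+ 2 * i2).
    by rewrite /J; field; rewrite gt_eqF.
  apply: lerD; apply: ler_wpM2r => //; first exact: ltW.
  - by rewrite addr_ge0// mulr_ge0// sqr_ge0.
  - by rewrite ler_wpM2r.
rewrite -lee_fin -I0E -Ibnd.
set T' := (_ / _) ^+ 2 in T'T.
pose B := Q ^+ (2 * n.+1) * (6 * J / (c * (b - a)))
  + 2 * T' * (2 / (b - a) * i1 + (b - a) * i2).
apply: (@le_trans _ _ (\int[mu]_(t in `[a, b[) cst B%:E t)%E).
  apply: ge0_le_integral => //.
  - by move=> t _; rewrite lee_fin sqr_ge0.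
  - move=> t; rewrite /= in_itv/= => /andP[at_ tb].
    have := @Remez_sup c J n g a b E t dg c01 ab _ mE Eab cE J0.
    rewrite at_ ltW// JE I1E I2E -!EFinM -!EFinD; apply => //.
    by rewrite lee_fin lerDl divr_ge0// ltW.
have mul : mu `[a, b[%classic = (b - a)%:E by rewrite lebesgue_measure_itv/= lte_fin ab.
rewrite integral_cst//; have -> : (B%:E * mu `[a, b[%classic = (B * (b - a))%:E)%E.
  by rewrite mul.
rewrite lee_fin.
have -> : B * (b - a) = 6 / c * Q ^+ (2 * n.+1) * J
    + 2 * T' * (2 * i1 + (b - a) ^+ 2 * i2).
  by rewrite /B; field; rewrite !gt_eqF// -subr_gt0.
rewrite lerD2l.
have b2 : (b - a) ^+ 2 <= l ^+ 2.
  by rewrite lerXn2r ?nnegrE ?(le_trans (ltW ba0))// ltW.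
apply: (@le_trans _ _ (4 * T' * (i1 + l ^+ 2 * i2))).
  rewrite (_ : 4 * T' * _ = 2 * T' * (2 * i1 + 2 * l ^+ 2 * i2)); last by ring.
  apply: ler_wpM2l; first by rewrite mulr_ge0// sqr_ge0.
  have := ler_wpM2r i2_ge0 b2; have : 0 <= l ^+ 2 * i2 by rewrite mulr_ge0 ?sqr_ge0.
  move: (l ^+ 2) ((b - a) ^+ 2) => p q; lra.
by rewrite ler_wpM2r ?ler_wpM2l// addr_ge0// mulr_ge0 ?sqr_ge0.
Qed.

End one_dimensional.

(** * Lebesgue measure on row vectors *)

Section row_measure.
Context {R : realType}.
Local Notation mu := (@lebesgue_measure R).
Local Notation bl := (@borel_lebesgue R).

Lemma row_cons0 n (t : R) (y : 'rV[R]_n) : row_cons (t, y) ord0 ord0 = t.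
Proof. by have /(congr1 fst) := row_consK (t, y). Qed.

Lemma row_consS n (t : R) (y : 'rV[R]_n) j :
  row_cons (t, y) ord0 (lift ord0 j) = y ord0 j.
Proof.
have /(congr1 (fun q : _ * 'rV[R]_n => q.2 ord0 j))/= := row_consK (t, y).
by rewrite mxE.
Qed.

Lemma measurable_row_consr n (t : R) :
  measurable_fun [set: 'rV[R]_n] (fun y => row_cons (t, y)).
Proof.
by apply: (measurableT_comp (@measurable_row_cons R n)); exact: pair1_measurable.
Qed.

Lemma measurable_row_consl n (y : 'rV[R]_n) :
  measurable_fun [set: measurableTypeR R] (fun t => row_cons (t, y)).
Proof.
by apply: (measurableT_comp (@measurable_row_cons R n)); exact: pair2_measurable.
Qed.

(** Half-open in every coordinate, so that cutting a box along a coordinate gives two disjoint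
    boxes. *)
Definition box n (lo hi : 'I_n -> R) : set 'rV[R]_n :=
  [set x | forall i, lo i <= x ord0 i < hi i].

Lemma measurable_coord_preimage n (i : 'I_n) (A : set (measurableTypeR R)) :
  measurable A -> measurable [set x : 'rV[R]_n | A (x ord0 i)].
Proof.
move=> mA; rewrite -[X in measurable X]setTI.
exact: (@measurable_row_coord R n i).
Qed.

Lemma measurable_box n (lo hi : 'I_n -> R) : measurable (box lo hi).
Proof.
have -> : box lo hi = \bigcap_(i in [set: 'I_n]) [set x | `[lo i, hi i[%classic (x ord0 i)].
  apply/seteqP; split => x xP i => [_|]; first by rewrite /= in_itv/=.
  by have := xP i I; rewrite /= in_itv.
by apply: fin_bigcap_measurable => // i _; exact: measurable_coord_preimage.
Qed.

Definition cylinder n (A : set R) (B : set 'rV[R]_n) : set 'rV[R]_n.+1 :=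
  @row_uncons R n @^-1` (A `*` B).

Lemma cylinderE n (A : set R) (B : set 'rV[R]_n) t y :
  cylinder A B (row_cons (t, y)) = (A t /\ B y).
Proof. by rewrite -[LHS]/((A `*` B) (row_uncons (row_cons (t, y)))) row_consK. Qed.

Lemma measurable_cylinder n (A : set (measurableTypeR R)) (B : set 'rV[R]_n) :
  measurable A -> measurable B -> measurable (cylinder A B).
Proof.
move=> mA mB; rewrite -[X in measurable X]setTI.
by apply: measurable_row_uncons => //; exact: measurableX.
Qed.

Lemma box_cylinder n (lo hi : 'I_n.+1 -> R) :
  box lo hi = cylinder `[lo ord0, hi ord0[%classic
                (box (lo \o lift ord0) (hi \o lift ord0)).
Proof.
apply/seteqP; split => x; rewrite /cylinder /row_uncons /=.
  by move=> xP; rewrite in_itv/=; split; [exact: xP|move=> j; rewrite mxE; exact: xP].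
rewrite in_itv/= => -[x0 xS] i; have [j ->|->//] := unliftP ord0 i.
by have := xS j; rewrite mxE.
Qed.

Lemma borel_lebesgueS n (D : set 'rV[R]_n.+1) :
  bl n.+1 D = (mu \x bl n)%E (@row_cons R n @^-1` D).
Proof. by []. Qed.

Lemma borel_lebesgue_cylinder n (A : set (measurableTypeR R)) (B : set 'rV[R]_n) :
  measurable A -> measurable B -> bl n.+1 (cylinder A B) = (mu A * bl n B)%E.
Proof.
move=> mA mB; rewrite borel_lebesgueS /cylinder -comp_preimage.
rewrite (_ : _ \o _ = id); last by apply/funext => p; exact: row_consK.
exact: product_measure1E.
Qed.

Lemma borel_lebesgue_box n (lo hi : 'I_n -> R) : (forall i, lo i <= hi i) ->
  bl n (box lo hi) = (\prod_i (hi i - lo i))%:E.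
Proof.
elim: n lo hi => [|n IHn] lo hi lohi.
  rewrite big_ord0 /= diracE mem_set//; by case.
rewrite box_cylinder borel_lebesgue_cylinder//; last exact: measurable_box.
rewrite IHn; last by move=> i; exact: lohi.
rewrite big_ord_recl EFinM; congr (_ * _)%E.
rewrite lebesgue_measure_itv/= lte_fin; have := lohi ord0.
by rewrite le_eqVlt => /orP[/eqP ->|->//]; rewrite ltxx subrr.
Qed.

Lemma integral_row n (h : 'rV[R]_n.+1 -> \bar R) :
  measurable_fun setT h -> (forall x, 0 <= h x)%E ->
  (\int[bl n.+1]_x h x = \int[mu \x bl n]_p h (row_cons p))%E.
Proof.
move=> mh h0; rewrite [LHS](ge0_integral_pushforward (@measurable_row_cons R n))//.
Qed.

Lemma row_fubini1 n (D : set 'rV[R]_n.+1) (h : 'rV[R]_n.+1 -> \bar R) :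
  measurable D -> measurable_fun setT h -> (forall x, 0 <= h x)%E ->
  (\int[bl n.+1]_(x in D) h x = \int[mu]_t
     \int[bl n]_(y in [set y | D (row_cons (t, y))]) h (row_cons (t, y)))%E.
Proof.
move=> mD mh h0; rewrite integral_mkcond integral_row; last 2 first.
- by apply/(measurable_restrictT _ _).1 => //; exact: measurable_funTS.
- by move=> x; exact: erestrict_ge0.
rewrite fubini_tonelli1; last 2 first.
- apply: measurableT_comp; last exact: measurable_row_cons.
  by apply/(measurable_restrictT _ _).1 => //; exact: measurable_funTS.
- by move=> p; exact: erestrict_ge0.
by apply: eq_integral => t _; rewrite [RHS]integral_mkcond.
Qed.

Lemma row_fubini2 n (D : set 'rV[R]_n.+1) (h : 'rV[R]_n.+1 -> \bar R) :
  measurable D -> measurable_fun setT h -> (forall x, 0 <= h x)%E ->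
  (\int[bl n.+1]_(x in D) h x = \int[bl n]_y
     \int[mu]_(t in [set t | D (row_cons (t, y))]) h (row_cons (t, y)))%E.
Proof.
move=> mD mh h0; rewrite integral_mkcond integral_row; last 2 first.
- by apply/(measurable_restrictT _ _).1 => //; exact: measurable_funTS.
- by move=> x; exact: erestrict_ge0.
rewrite fubini_tonelli2; last 2 first.
- apply: measurableT_comp; last exact: measurable_row_cons.
  by apply/(measurable_restrictT _ _).1 => //; exact: measurable_funTS.
- by move=> p; exact: erestrict_ge0.
by apply: eq_integral => y _; rewrite [RHS]integral_mkcond.
Qed.

Lemma cylinder_fubini1 n (A : set (measurableTypeR R)) (B : set 'rV[R]_n)
    (h : 'rV[R]_n.+1 -> \bar R) : measurable A -> measurable B ->
  measurable_fun setT h -> (forall x, 0 <= h x)%E ->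
  (\int[bl n.+1]_(x in cylinder A B) h x =
   \int[mu]_(t in A) \int[bl n]_(y in B) h (row_cons (t, y)))%E.
Proof.
move=> mA mB mh h0; rewrite (row_fubini1 (measurable_cylinder mA mB) mh h0).
rewrite [RHS]integral_mkcond; apply: eq_integral => t _; rewrite patchE.
have [tA|tA] := boolP (t \in A).
  congr (integral _ _ _); apply/seteqP; split => y /=; rewrite cylinderE; first by case.
  by split => //; exact: set_mem.
rewrite (_ : [set y | _] = set0) ?integral_set0//.
by apply/seteqP; split => y //=; rewrite cylinderE => -[+ _] => /mem_set; exact/negP.
Qed.

Lemma cylinder_fubini2 n (A : set (measurableTypeR R)) (B : set 'rV[R]_n)
    (h : 'rV[R]_n.+1 -> \bar R) : measurable A -> measurable B ->
  measurable_fun setT h -> (forall x, 0 <= h x)%E ->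
  (\int[bl n.+1]_(x in cylinder A B) h x =
   \int[bl n]_(y in B) \int[mu]_(t in A) h (row_cons (t, y)))%E.
Proof.
move=> mA mB mh h0; rewrite (row_fubini2 (measurable_cylinder mA mB) mh h0).
rewrite [RHS]integral_mkcond; apply: eq_integral => y _; rewrite patchE.
have [yB|yB] := boolP (y \in B).
  congr (integral _ _ _); apply/seteqP; split => t /=; rewrite cylinderE; first by case.
  by split => //; exact: set_mem.
rewrite (_ : [set t | _] = set0) ?integral_set0//.
by apply/seteqP; split => t //=; rewrite cylinderE => -[_] => /mem_set; exact/negP.
Qed.

Lemma measurable_slice2 n (D : set 'rV[R]_n.+1) (y : 'rV[R]_n) : measurable D ->
  measurable ([set t | D (row_cons (t, y))] : set (measurableTypeR R)).
Proof.
by move=> mD; rewrite -[X in measurable X]setTI; exact: measurable_row_consl.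
Qed.

Lemma measurable_slice_integral1 n (D : set 'rV[R]_n.+1) (h : 'rV[R]_n.+1 -> \bar R) :
  measurable D -> measurable_fun setT h -> (forall x, 0 <= h x)%E ->
  measurable_fun [set: measurableTypeR R] (fun t =>
     \int[bl n]_(y in [set y | D (row_cons (t, y))]) h (row_cons (t, y)))%E.
Proof.
move=> mD mh h0.
have := @measurable_fun_fubini_tonelli_F _ _ (measurableTypeR R) 'rV[R]_n R (bl n)
  ((h \_ D) \o @row_cons R n).
have mc : measurable_fun setT ((h \_ D) \o @row_cons R n).
  apply: measurableT_comp; last exact: measurable_row_cons.
  by apply/(measurable_restrictT _ _).1 => //; exact: measurable_funTS.
move=> /(_ mc (fun p => erestrict_ge0 (fun x _ => h0 x) _)).
by apply: eq_measurable_fun => t _; rewrite [RHS]integral_mkcond.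
Qed.

Lemma measurable_slice_integral2 n (D : set 'rV[R]_n.+1) (h : 'rV[R]_n.+1 -> \bar R) :
  measurable D -> measurable_fun setT h -> (forall x, 0 <= h x)%E ->
  measurable_fun [set: 'rV[R]_n] (fun y =>
     \int[mu]_(t in [set t | D (row_cons (t, y))]) h (row_cons (t, y)))%E.
Proof.
move=> mD mh h0.
have := @measurable_fun_fubini_tonelli_G _ _ (measurableTypeR R) 'rV[R]_n R mu
  ((h \_ D) \o @row_cons R n).
have mc : measurable_fun setT ((h \_ D) \o @row_cons R n).
  apply: measurableT_comp; last exact: measurable_row_cons.
  by apply/(measurable_restrictT _ _).1 => //; exact: measurable_funTS.
move=> /(_ mc (fun p => erestrict_ge0 (fun x _ => h0 x) _)).
by apply: eq_measurable_fun => y _; rewrite [RHS]integral_mkcond.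
Qed.

End row_measure.

(** * Linear combinations of nonnegative integrands *)

Section linear_integral.
Context d (T : measurableType d) {R : realType} (m : {measure set T -> \bar R}).
Implicit Types (D : set T) (u v : T -> \bar R).
Local Open Scope ereal_scope.

Lemma ge0_integral_addZ D (q : R) u v : (0 <= q)%R -> measurable D ->
  measurable_fun setT u -> measurable_fun setT v ->
  (forall x, 0 <= u x) -> (forall x, 0 <= v x) ->
  \int[m]_(x in D) (u x + q%:E * v x)
    = \int[m]_(x in D) u x + q%:E * \int[m]_(x in D) v x.
Proof.
move=> q0 mD mu mv u0 v0.
have muD : measurable_fun D u by exact: measurable_funTS.
have mvD : measurable_fun D v by exact: measurable_funTS.
rewrite ge0_integralD//.
- by rewrite ge0_integralZl_EFin.
- by move=> x _; rewrite mule_ge0.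
- exact: measurable_funeM.
Qed.

Lemma measurable_addZ (q : R) u v : measurable_fun setT u ->
  measurable_fun setT v -> measurable_fun setT (fun x => u x + q%:E * v x).
Proof. by move=> mu mv; apply: emeasurable_funD => //; exact: measurable_funeM. Qed.

Lemma ge0_addZ (q : R) u v : (0 <= q)%R ->
  (forall x, 0 <= u x) -> (forall x, 0 <= v x) -> forall x, 0 <= u x + q%:E * v x.
Proof. by move=> q0 u0 v0 x; rewrite adde_ge0// mule_ge0. Qed.

End linear_integral.

(** * Derivatives of slices *)

Section slices.
Context {R : realType}.

(** Only iterates of a single partial derivative occur, because the one-variable estimate is applied
    along one coordinate at a time. In this form the condition passes to slices, as the induction on
    the dimension requires. *)
Definition pure_derivable n (g : 'rV[R]_n -> R) :=
  forall i k x, derivable (iter k (partial i) g) x (delta_mx ord0 i).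

Definition pure_measurable n (g : 'rV[R]_n -> R) :=
  forall i k, measurable_fun [set: 'rV[R]_n] (iter k (partial i) g).

Lemma row_cons_addr n (t : R) (y : 'rV[R]_n) (h : R) i :
  row_cons (t, h *: delta_mx ord0 i + y)
  = h *: delta_mx ord0 (lift ord0 i) + row_cons (t, y).
Proof.
apply/rowP => j; have [k ->|->] := unliftP ord0 j.
  by rewrite row_consS [LHS]mxE [RHS]mxE row_consS !mxE (inj_eq lift_inj).
by rewrite row_cons0 [RHS]mxE row_cons0 !mxE /= mulr0 add0r.
Qed.

Lemma row_cons_addl n (t : R) (y : 'rV[R]_n) (h : R) :
  row_cons (h *: 1 + t, y) = h *: delta_mx ord0 ord0 + row_cons (t, y).
Proof.
apply/rowP => j; have [k ->|->] := unliftP ord0 j.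
  by rewrite row_consS [RHS]mxE row_consS !mxE /= mulr0 add0r.
by rewrite row_cons0 [RHS]mxE row_cons0 !mxE.
Qed.

(** The difference quotients of the slice are literally those of [g], since [row_cons] commutes with
    increments; no chain rule is involved. *)
Lemma slice_partial n (g : 'rV[R]_n.+1 -> R) (t : R) i :
  partial i (fun y => g (row_cons (t, y)))
  = fun y => partial (lift ord0 i) g (row_cons (t, y)).
Proof.
apply/funext => y; rewrite /partial /derive.
by under eq_fun do rewrite /shift/= row_cons_addr.
Qed.

Lemma slice_iter_partial n (g : 'rV[R]_n.+1 -> R) (t : R) i k :
  iter k (partial i) (fun y => g (row_cons (t, y)))
  = fun y => iter k (partial (lift ord0 i)) g (row_cons (t, y)).
Proof. by elim: k => // k IHk; rewrite iterS IHk slice_partial. Qed.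

Lemma slice_pure_derivable n (g : 'rV[R]_n.+1 -> R) (t : R) :
  pure_derivable g -> pure_derivable (fun y => g (row_cons (t, y))).
Proof.
move=> dg i k y; rewrite slice_iter_partial.
have := dg (lift ord0 i) k (row_cons (t, y)); rewrite /derivable.
by under [in X in _ -> X]eq_fun do rewrite /shift/= row_cons_addr.
Qed.

Lemma slice_pure_measurable n (g : 'rV[R]_n.+1 -> R) (t : R) :
  pure_measurable g -> pure_measurable (fun y => g (row_cons (t, y))).
Proof.
move=> mg i k; rewrite slice_iter_partial.
by apply: measurableT_comp; [exact: mg|exact: measurable_row_consr].
Qed.

Lemma slice_is_derive n (g : 'rV[R]_n.+1 -> R) (y : 'rV[R]_n) k (t : R) :
  pure_derivable g ->
  is_derive t 1 (fun t => iter k (partial ord0) g (row_cons (t, y)))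
    (iter k.+1 (partial ord0) g (row_cons (t, y))).
Proof.
move=> dg; have := dg ord0 k (row_cons (t, y)); rewrite /derivable => dgk.
apply: DeriveDef.
  rewrite /derivable.
  by under eq_fun do rewrite /shift/= row_cons_addl.
rewrite iterS /partial /derive.
by under eq_fun do rewrite /shift/= row_cons_addl.
Qed.

End slices.

(** * A Remez inequality on boxes *)

Section box_Remez.
Context {R : realType}.
Local Notation mu := (@lebesgue_measure R).
Local Notation bl := (@borel_lebesgue R).
Local Open Scope ereal_scope.

Lemma measurable_cylinder_integral1 n (B : set 'rV[R]_n) (h : 'rV[R]_n.+1 -> \bar R) :
  measurable B -> measurable_fun setT h -> (forall x, 0 <= h x) ->
  measurable_fun [set: measurableTypeR R]
    (fun t => \int[bl n]_(y in B) h (row_cons (t, y))).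
Proof.
move=> mB mh h0.
have mC : measurable (cylinder setT B) by exact: measurable_cylinder.
apply: eq_measurable_fun (measurable_slice_integral1 mC mh h0) => t _.
congr (integral _ _ _); apply/seteqP; split => y /=; rewrite cylinderE//.
by case.
Qed.

Lemma measurable_cylinder_integral2 n (A : set (measurableTypeR R))
    (h : 'rV[R]_n.+1 -> \bar R) :
  measurable A -> measurable_fun setT h -> (forall x, 0 <= h x) ->
  measurable_fun [set: 'rV[R]_n]
    (fun y => \int[mu]_(t in A) h (row_cons (t, y))).
Proof.
move=> mA mh h0.
have mC : measurable (cylinder A [set: 'rV[R]_n]) by exact: measurable_cylinder.
apply: eq_measurable_fun (measurable_slice_integral2 mC mh h0) => y _.
congr (integral _ _ _); apply/seteqP; split => t /=; rewrite cylinderE//.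
by case.
Qed.

Lemma borel_lebesgue_setT0 : bl 0 setT = 1.
Proof. by rewrite /= diracE mem_set. Qed.

(** Two Remez steps in succession, from a small set ([e]) to an intermediate one ([y]) to the whole
    box ([x]). Since [A >= 1], the second error can be multiplied by [A] too, and both errors end
    under one factor. *)
Lemma lee_nested (A B : R) (x y e T g S : \bar R) :
  (1 <= A)%R -> (0 <= B)%R -> 0 <= T -> 0 <= e -> 0 <= g -> 0 <= S ->
  y <= A%:E * (e + T * g) -> x <= B%:E * (y + T * S) ->
  x <= (A * B)%:E * (e + T * (g + S)).
Proof.
move=> A1 B0 T0 e0 g0 S0 yA /le_trans; apply.
have A0 : (0 <= A)%R by exact: le_trans A1.
rewrite mulrC EFinM -muleA; apply: lee_wpmul2l; first by rewrite lee_fin.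
apply: (@le_trans _ _ (A%:E * (e + T * g) + A%:E * (T * S))).
  apply: leeD => //.
  by rewrite -[leLHS]mul1e; apply: lee_wpmul2r; rewrite ?mule_ge0// lee_fin.
by rewrite -ge0_muleDr ?adde_ge0 ?mule_ge0// -addeA -ge0_muleDr.
Qed.

(* A set of density [c] in [I * B] has slices of density [c/2] over a subset of
   [B] of density [c/2]. *)
Lemma dense_slices n (c a b V : R) (B : set 'rV[R]_n) (E : set 'rV[R]_n.+1) :
  (0 < c)%R -> (a < b)%R -> measurable B -> bl n B = V%:E -> (0 < V)%R ->
  measurable E -> E `<=` cylinder `[a, b[%classic B ->
  (c * ((b - a) * V))%:E <= bl n.+1 E ->
  exists F, [/\ measurable F, F `<=` B, (c / 2 * V)%:E <= bl n F &
    forall y, F y -> (c / 2 * (b - a))%:E <= mu [set t | E (row_cons (t, y))]].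
Proof.
move=> c0 ab mB BV V0 mE EIB cE.
set L := (b - a)%R in cE *; have L0 : (0 < L)%R by rewrite subr_gt0.
pose m y := \int[mu]_(t in [set t | E (row_cons (t, y))]) cst 1 t.
have mm : measurable_fun [set: 'rV[R]_n] m.
  by apply: (@measurable_slice_integral2 _ _ E (cst 1)).
have mEy y : measurable ([set t | E (row_cons (t, y))] : set (measurableTypeR R)).
  exact: measurable_slice2.
have mmu y : m y = mu [set t | E (row_cons (t, y))].
  by rewrite /m integral_cst// mul1e.
pose F := B `&` [set y | (c / 2 * L)%:E <= m y].
have mF : measurable F by apply: emeasurable_fun_c_infty => //; exact: measurable_funTS.
exists F; split => //; [by move=> y []| |by move=> y [_ /=]; rewrite mmu].
(* If [F] were smaller, then, slices over [F] having length at most [b - a] and the others less than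
   [c / 2 * (b - a)], the measure of [E] would stay below [c * (b - a) * V]. *)
rewrite leNgt; apply/negP => ltF.
have F0 : 0 <= bl n F by exact: measure_ge0.
have Ffin : bl n F \is a fin_num by rewrite ge0_fin_numE// (lt_trans ltF)// ltry.
have muI : mu `[a, b[%classic = L%:E by rewrite lebesgue_measure_itv/= lte_fin ab.
have bound y : B y -> m y <= (L%:E * (\1_F y)%:E) + (c / 2 * L)%:E.
  move=> By; rewrite indicE; have [yF|yF] := boolP (y \in F).
    rewrite mule1 mmu; apply: (@le_trans _ _ L%:E).
      rewrite -muI; apply: le_measure; rewrite ?inE//.
      by move=> t /= /EIB; rewrite cylinderE => -[].
    by rewrite leeDl// lee_fin !mulr_ge0// ltW.
  rewrite mule0 add0e; move: yF; rewrite notin_setE => yF.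
  by rewrite leNgt; apply/negP => my; apply: yF; split => //; exact: ltW.
have : bl n.+1 E <= L%:E * bl n F + (c / 2 * L * V)%:E.
  have -> : bl n.+1 E = \int[bl n.+1]_(x in E) cst 1 x by rewrite integral_cst// mul1e.
  rewrite row_fubini2// -/m.
  have -> : \int[bl n]_y m y = \int[bl n]_(y in B) m y.
    rewrite [RHS]integral_mkcond; apply: eq_integral => y _; rewrite patchE.
    have [//|yB] := boolP (y \in B).
    rewrite mmu (_ : [set t | _] = set0) ?measure0//.
    apply/seteqP; split => t //= /EIB; rewrite cylinderE => -[_] /mem_set.
    exact/negP.
  have mI : measurable_fun B (fun y : 'rV[R]_n => (\1_F y)%:E : \bar R).
    by apply/measurable_EFinP; exact: measurable_indic.
  apply: (@le_trans _ _ (\int[bl n]_(y in B) ((L%:E * (\1_F y)%:E) + cst (c / 2 * L)%:E y))).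
    apply: ge0_le_integral => //.
    - by move=> y _; rewrite mmu.
    - exact: measurable_funTS.
    - by apply: emeasurable_funD => //; exact: measurable_funeM.
  rewrite ge0_integralD//; last 3 first.
  - by move=> y _; rewrite mule_ge0// lee_fin// ltW.
  - exact: measurable_funeM.
  - by move=> y _; rewrite lee_fin !mulr_ge0// ltW.
  rewrite ge0_integralZl_EFin//; last exact: ltW.
  have -> : \int[bl n]_(x in B) cst (c / 2 * L)%:E x = (c / 2 * L * V)%:E.
    by rewrite integral_cst// [in RHS]EFinM; congr (_ * _).
  rewrite integral_indic// leeD2r// lee_wpmul2l ?lee_fin ?(ltW L0)//.
  by apply: le_measure; rewrite ?inE//; exact: measurableI.
apply/negP; rewrite -ltNge; apply: lt_le_trans cE.
rewrite -(fineK Ffin) -EFinM -EFinD lte_fin.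
have fF : (fine (bl n F) < c / 2 * V)%R by rewrite -lte_fin fineK.
have -> : (c * (L * V) = L * (c / 2 * V) + c / 2 * L * V)%R by field.
by rewrite ltrD2r ltr_pM2l.
Qed.

(** Induction on the dimension through the intermediate set [I * F], where [F] collects the base
    points with dense slices. Each of the two passages has density [c / 2], so the density is halved
    with every dimension and the constants multiply. *)
Lemma box_Remez n (c : R) : (0 < c <= 1)%R -> exists2 C : R, (1 <= C)%R &
  forall N (g : 'rV[R]_n -> R) (lo hi : 'I_n -> R) (l : R) E,
  pure_derivable g -> pure_measurable g ->
  (forall i, lo i < hi i)%R -> (forall i, hi i - lo i <= l)%R ->
  measurable E -> E `<=` box lo hi -> c%:E * bl n (box lo hi) <= bl n E ->
  \int[bl n]_(x in box lo hi) (g x ^+ 2)%:E <= (C ^+ N.+1)%:E *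
    (\int[bl n]_(x in E) (g x ^+ 2)%:E + ((l ^+ N.+1 / N.+1`!%:R) ^+ 2)%:E *
      \sum_(i < n)
        (\int[bl n]_(x in box lo hi) (iter N.+1 (partial i) g x ^+ 2)%:E
         + (l ^+ 2)%:E *
           \int[bl n]_(x in box lo hi) (iter N.+2 (partial i) g x ^+ 2)%:E)).
Proof.
elim: n c => [|n IHn] c /andP[c0 c1].
  exists 1%R => // N g lo hi l E _ _ _ _ mE _ cE.
  (* In dimension 0 the space is one point, and positive density forces [E] to contain it. *)
  have -> : box lo hi = E.
    have /set0P[x Ex] : E != set0.
      apply/eqP => E0; move: cE; rewrite E0 measure0.
      have -> : box lo hi = setT by apply/seteqP; split => // x _ [].
      by rewrite borel_lebesgue_setT0 mule1 lee_fin leNgt c0.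
    apply/seteqP; split => y _; last by case.
    by rewrite (_ : y = x)//; apply/rowP => -[].
  by rewrite big_ord0 mule0 adde0 expr1n mul1e.
have c2 : (0 < c / 2 <= 1)%R by rewrite divr_gt0//=; lra.
have [C1 C11 H1] := Remez_L2 c2.
have [C2 C21 H2] := IHn _ c2.
exists (C1 * C2)%R; first by rewrite mulr_ege1.
move=> N g lo hi l E dg mg lohi hil mE EB cE.
pose h i k x := (iter k (partial i) g x ^+ 2)%:E : \bar R.
have h0 i k x : 0 <= h i k x by rewrite lee_fin sqr_ge0.
have mh i k : measurable_fun setT (h i k).
  by apply/measurable_EFinP; apply: measurable_funX; exact: mg.
have hE i : h i 0%N = h ord0 0%N by [].
pose I := `[lo ord0, hi ord0[%classic : set (measurableTypeR R).
pose B : set 'rV[R]_n := box (lo \o lift ord0 : 'I_n -> R) (hi \o lift ord0).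
have mI : measurable I by exact: measurable_itv.
have mB : measurable B by exact: measurable_box.
have BE : box lo hi = cylinder I B := box_cylinder lo hi.
pose V := (\prod_(i < n) (hi (lift ord0 i) - lo (lift ord0 i)))%R.
have V0 : (0 < V)%R by apply: prodr_gt0 => i _; rewrite subr_gt0.
have BV : bl n B = V%:E by rewrite /B borel_lebesgue_box// => i; exact/ltW/lohi.
have lohi0 := lohi ord0.
have [F [mF FB cF EF]] : exists F, [/\ measurable F, F `<=` B, (c / 2 * V)%:E <= bl n F &
    forall y, F y -> (c / 2 * (hi ord0 - lo ord0))%:E <= mu [set t | E (row_cons (t, y))]].
  apply: (@dense_slices n c (lo ord0) (hi ord0) V B E) => //.
    by rewrite -/I -BE.
  rewrite (le_trans _ cE)// BE borel_lebesgue_cylinder// BV EFinM.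
  by rewrite EFinM lebesgue_measure_itv/= lte_fin lohi0.
set T := (_ ^+ 2)%:E.
have T0 : 0 <= T by rewrite lee_fin sqr_ge0.
have l2 : (0 <= l ^+ 2)%R by exact: sqr_ge0.
pose C1N := (C1 ^+ N.+1)%R; pose C2N := (C2 ^+ N.+1)%R.
have C1N1 : (1 <= C1N)%R by exact: exprn_ege1.
have C2N1 : (1 <= C2N)%R by exact: exprn_ege1.
have C1N0 : (0 <= C1N)%R by exact: le_trans C1N1.
have C2N0 : (0 <= C2N)%R by exact: le_trans C2N1.
pose G i := \int[bl n.+1]_(x in box lo hi) h i N.+1 x
  + (l ^+ 2)%:E * \int[bl n.+1]_(x in box lo hi) h i N.+2 x.
have G0 i : 0 <= G i by rewrite adde_ge0 ?mule_ge0 ?integral_ge0.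
(* First coordinate: on each line over a point of [F], the one-variable inequality leads from the
   slice of [E] to the whole interval [I]. *)
have stepA : \int[bl n.+1]_(x in cylinder I F) h ord0 0%N x
    <= C1N%:E * (\int[bl n.+1]_(x in E) h ord0 0%N x + T * G ord0).
  rewrite cylinder_fubini2//.
  pose u0 y := \int[mu]_(t in [set t | E (row_cons (t, y))]) h ord0 0%N (row_cons (t, y)).
  pose u k y := \int[mu]_(t in I) h ord0 k (row_cons (t, y)).
  have mu0 : measurable_fun [set: 'rV[R]_n] u0 by exact: measurable_slice_integral2.
  have mu_ k : measurable_fun [set: 'rV[R]_n] (u k) by exact: measurable_cylinder_integral2.
  have u00 y : 0 <= u0 y by exact: integral_ge0.
  have u_0 k y : 0 <= u k y by exact: integral_ge0.
  pose v y := u N.+1 y + (l ^+ 2)%:E * u N.+2 y.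
  have mv : measurable_fun setT v by exact: measurable_addZ.
  have v0 y : 0 <= v y by exact: ge0_addZ.
  pose w y := u0 y + T * v y.
  have mw : measurable_fun setT w by exact: measurable_addZ.
  have w0 y : 0 <= w y by exact: ge0_addZ.
  apply: (@le_trans _ _ (\int[bl n]_(y in F) (C1N%:E * w y))).
    apply: ge0_le_integral => //.
    - by move=> y _; exact: integral_ge0.
    - by apply: measurable_funTS; exact: measurable_cylinder_integral2.
    - by apply: measurable_funTS; exact: measurable_funeM.
    move=> y Fy.
    apply: (H1 N (fun k t => iter k (partial ord0) g (row_cons (t, y)))) => //.
    - by move=> k t; exact: slice_is_derive.
    - exact: measurable_slice2.
    - by move=> t /= /EB; rewrite BE cylinderE => -[].
    - exact: EF.
  rewrite ge0_integralZl_EFin//; last exact: measurable_funTS.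
  apply: lee_wpmul2l; first by rewrite lee_fin.
  rewrite /w ge0_integral_addZ// ?sqr_ge0//; apply: leeD.
    rewrite row_fubini2//; apply: ge0_subset_integral => //.
  apply: lee_wpmul2l => //; rewrite /v ge0_integral_addZ//; apply: leeD.
    rewrite BE cylinder_fubini2//; apply: ge0_subset_integral => //.
    exact: measurable_funTS.
  apply: lee_wpmul2l => //; rewrite BE cylinder_fubini2//.
  apply: ge0_subset_integral => //; exact: measurable_funTS.
(* Remaining coordinates: on each hyperplane over [t] in [I], the induction hypothesis leads from
   [F] to [B]. The same [F] serves for all [t], which is what the intermediate product set is
   for. *)
have stepB : \int[bl n.+1]_(x in box lo hi) h ord0 0%N x
    <= C2N%:E * (\int[bl n.+1]_(x in cylinder I F) h ord0 0%N x
                 + T * \sum_(i < n) G (lift ord0 i)).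
  rewrite BE !cylinder_fubini1//.
  pose p0 t := \int[bl n]_(y in F) h ord0 0%N (row_cons (t, y)).
  pose p (i : 'I_n) k t := \int[bl n]_(y in B) h (lift ord0 i) k (row_cons (t, y)).
  have mp0 : measurable_fun [set: measurableTypeR R] p0.
    exact: measurable_cylinder_integral1.
  have mp i k : measurable_fun [set: measurableTypeR R] (p i k).
    exact: measurable_cylinder_integral1.
  have p00 t : 0 <= p0 t by exact: integral_ge0.
  have p_0 i k t : 0 <= p i k t by exact: integral_ge0.
  pose v i t := p i N.+1 t + (l ^+ 2)%:E * p i N.+2 t.
  have mv i : measurable_fun [set: measurableTypeR R] (v i).
    exact: (measurable_addZ (l ^+ 2) (mp i N.+1) (mp i N.+2)).
  have v0 i t : 0 <= v i t by exact: (ge0_addZ l2 (p_0 i N.+1) (p_0 i N.+2)).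
  pose q t := \sum_(i < n) v i t.
  have mq : measurable_fun [set: measurableTypeR R] q by exact: emeasurable_sum.
  have q0 t : 0 <= q t by exact: sume_ge0.
  pose w t := p0 t + T * q t.
  have mw : measurable_fun [set: measurableTypeR R] w by exact: (measurable_addZ _ mp0 mq).
  have w0 t : 0 <= w t by apply: (ge0_addZ _ p00 q0); exact: sqr_ge0.
  apply: (@le_trans _ _ (\int[mu]_(t in I) (C2N%:E * w t))).
    apply: ge0_le_integral => //.
    - by move=> t _; exact: integral_ge0.
    - by apply: measurable_funTS; exact: measurable_cylinder_integral1.
    - by apply: measurable_funTS; exact: measurable_funeM.
    move=> t _.
    have := H2 N (fun y => g (row_cons (t, y))) (lo \o lift ord0) (hi \o lift ord0) l F
      (slice_pure_derivable dg) (slice_pure_measurable t mg).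
    rewrite -/B BV -EFinM => /(_ (fun i => lohi _) (fun i => hil _) mF FB cF).
    under eq_bigr do rewrite !slice_iter_partial.
    by [].
  rewrite ge0_integralZl_EFin//; last exact: measurable_funTS.
  apply: lee_wpmul2l; first by rewrite lee_fin.
  rewrite /w ge0_integral_addZ// ?sqr_ge0//; apply: leeD => //.
  apply: lee_wpmul2l => //; rewrite /q ge0_integral_sum//; last first.
    by move=> i; exact: measurable_funTS.
  apply: lee_sum => i _.
  have pE k : \int[bl n.+1]_(x in box lo hi) h (lift ord0 i) k x = \int[mu]_(t in I) p i k t.
    by rewrite BE (cylinder_fubini1 mI mB (mh _ k) (h0 _ k)).
  by rewrite (ge0_integral_addZ _ l2 mI (mp i N.+1) (mp i N.+2) (p_0 i _) (p_0 i _)) /G !pE.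
have E0 : 0 <= \int[bl n.+1]_(x in E) h ord0 0%N x by exact: integral_ge0.
have S0 : 0 <= \sum_(i < n) G (lift ord0 i) by exact: sume_ge0.
have := lee_nested C1N1 C2N0 T0 E0 (G0 ord0) S0 stepA stepB.
have <- : \sum_(i < n.+1) G i = G ord0 + \sum_(i < n) G (lift ord0 i).
  by rewrite big_ord_recl.
by rewrite /C1N /C2N -exprMn.
Qed.

End box_Remez.

(** * From thick balls to thick boxes *)

Section finite_measure_sums.
Context d (T : measurableType d) {R : realType} (m : {measure set T -> \bar R}).
Local Open Scope ereal_scope.

Lemma measure_seq_subadditive (I : eqType) (s : seq I) (F : I -> set T) A :
  measurable A -> (forall i, measurable (F i)) ->
  A `<=` [set x | exists2 i, i \in s & F i x] -> m A <= \sum_(i <- s) m (F i).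
Proof.
move=> + mF; elim: s A => [|j s IHs] A mA AF.
  rewrite big_nil (_ : A = set0) ?measure0//.
  by apply/seteqP; split => // x /AF[].
rewrite big_cons; apply: (@le_trans _ _ (m (A `&` F j) + m (A `\` F j))).
  rewrite -{1}(setUIDK A (F j)).
  by apply: measureU2; [exact: measurableI|exact: measurableD].
apply: leeD.
  by apply: le_measure; rewrite ?inE//; exact: measurableI.
apply: IHs; first exact: measurableD.
move=> x [/AF[k +]]; rewrite inE => /predU1P[->//|ks] Fkx _.
by exists k.
Qed.

Lemma measure_seq_superadditive (I : eqType) (s : seq I) (F : I -> set T) A :
  measurable A -> (forall i, measurable (F i)) -> uniq s ->
  (forall i j, i \in s -> j \in s -> i != j -> F i `&` F j = set0) ->
  (forall i, i \in s -> F i `<=` A) -> \sum_(i <- s) m (F i) <= m A.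
Proof.
move=> + mF; elim: s A => [|j s IHs] A mA; first by rewrite big_nil.
rewrite cons_uniq => /andP[js us] dF FA; rewrite big_cons.
have jA : F j `<=` A by apply: FA; rewrite inE eqxx.
have -> : m A = m (F j) + m (A `\` F j).
  rewrite -measureU//; [|exact: measurableD|by rewrite setDE setICA setICr setI0].
  by congr (m _); rewrite setDUK.
apply: leeD => //; apply: IHs => //.
- exact: measurableD.
- by move=> i k si sk; apply: dF; rewrite inE ?si ?sk orbT.
- move=> i si x Fix; split; first by apply: (FA i) => //; rewrite inE si orbT.
  move=> Fjx; have ij : i != j by apply: contraNneq js => <-.
  have /seteqP[+ _] : F i `&` F j = set0.
    by apply: dF => //; rewrite inE ?si ?eqxx ?orbT.
  by move=> /(_ x); apply.
Qed.

End finite_measure_sums.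

(** The list is sorted by increasing radius and treated from its end, so every ball already selected
    is at least as large as the new one. If the new ball meets a selected one, it lies in its
    triple; otherwise it is selected. *)
Lemma finite_Vitali (R : realType) (T : pseudoMetricType R) (s : seq T) (r : T -> R) :
  (forall x, 0 < r x) -> exists D : seq T, [/\ uniq D, {subset D <= s},
    forall x y, x \in D -> y \in D -> x != y -> ball x (r x) `&` ball y (r y) = set0 &
    forall x, x \in s -> exists2 y, y \in D & ball x (r x) `<=` ball y (3 * r y)].
Proof.
move=> r0; pose le := relpre r (<=%R : rel R).
have le_total : total le by move=> x y; exact: le_total.
have le_tr : transitive le by move=> y x z; exact: le_trans.
suff H u : sorted le u -> exists D : seq T, [/\ uniq D, {subset D <= u},
    forall x y, x \in D -> y \in D -> x != y -> ball x (r x) `&` ball y (r y) = set0 &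
    forall x, x \in u -> exists2 y, y \in D & ball x (r x) `<=` ball y (3 * r y)].
  have [D [uD Ds dD cD]] := H _ (sort_sorted le_total s).
  exists D; split => // [x /Ds|x xs]; first by rewrite mem_sort.
  by apply: cD; rewrite mem_sort.
elim: u => [|x u IHu] /=; first by move=> _; exists [::].
move=> xu; have [D [uD Du dD cD]] := IHu (path_sorted xu).
have xr y : y \in D -> r x <= r y.
  by move=> /Du yu; have /allP/(_ y yu) := order_path_min le_tr xu.
have b3 y : ball y (r y) `<=` ball y (3 * r y).
  by apply: le_ball; have := r0 y; lra.
have [[y yD [z [xz yz]]]|noint] :=
    pselect (exists2 y, y \in D & ball x (r x) `&` ball y (r y) !=set0).
  exists D; split => //; first by move=> w /Du wu; rewrite inE wu orbT.
  move=> w; rewrite inE => /predU1P[->|/cD//]; exists y => // v xv.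
  have yv : ball y (r y + (r x + r x)) v.
    by apply: ball_triangle yz (ball_triangle (ball_sym xz) xv).
  by apply: le_ball yv; have := xr _ yD; lra.
exists (x :: D); split.
- rewrite cons_uniq uD andbT; apply/negP => xD; apply: noint.
  by exists x => //; exists x; split; exact: ballxx.
- by move=> w; rewrite !inE => /predU1P[->|/Du ->]; rewrite ?eqxx ?orbT.
- have noint' y : y \in D -> ball x (r x) `&` ball y (r y) = set0.
    move=> yD; apply/eqP/negPn/negP => /set0P int.
    by apply: noint; exists y.
  move=> y z; rewrite !inE => /predU1P[->|yD] /predU1P[->|zD].
  + by rewrite eqxx.
  + by move=> _; exact: noint'.
  + by move=> _; rewrite setIC; exact: noint'.
  + exact: dD.
- move=> w; rewrite inE => /predU1P[->|/cD[y yD wy]].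
    by exists x; [rewrite inE eqxx|exact: b3].
  by exists y => //; rewrite inE yD orbT.
Qed.

(** * Borel and Lebesgue sets, cubes and Euclidean balls *)

Section borel_row.
Context {R : realType}.
Local Notation bl := (@borel_lebesgue R).
Local Notation lr := (lebesgue_row R).

Lemma row_ballE n (x : 'rV[R]_n) r : 0 < r ->
  ball x r = [set y | forall i, `|y ord0 i - x ord0 i| < r].
Proof.
move=> r0; apply/seteqP; split => y.
  by move=> [_ xy] i; have := xy ord0 i; rewrite /ball/= distrC.
by move=> xy; split => // i j; rewrite /ball/= (ord1 i) distrC; exact: xy.
Qed.

(** An open set is the union of the sup-norm balls of radius [1 / (m + 1)] with rational centers
    that it contains. All pairs of center and [m] serve as indices; a ball not inside [U]
    contributes the empty set. *)
Lemma measurable_open_row n (U : set 'rV[R]_n) : open U -> measurable U.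
Proof.
move=> oU.
pose Q (k : 'rV[rat]_n * nat) : set 'rV[R]_n :=
  \bigcap_(i in [set: 'I_n])
    [set y | ball (ratr (k.1 ord0 i) : R) k.2.+1%:R^-1 (y ord0 i)].
pose F k := [set y | Q k `<=` U /\ Q k y].
have -> : U = \bigcup_k F k.
  apply/seteqP; split => [x Ux|x [k _ [QU /QU]]//].
  have : nbhs x U by move: oU; rewrite openE; apply.
  move=> /nbhs_ballP[e /= e0 xeU].
  have e2 : 0 < e / 2 by rewrite divr_gt0.
  have [m me] : exists m : nat, m.+1%:R^-1 < e / 2.
    exists (Num.truncn (e / 2)^-1).
    by rewrite invf_plt ?posrE// truncnS_gt.
  have m0 : 0 < m.+1%:R^-1 :> R by rewrite invr_gt0.
  have qx i : {q : rat | ball (ratr q : R) m.+1%:R^-1 (x ord0 i)}.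
    apply/cid; have [|q] := @rat_in_itvoo R (x ord0 i - m.+1%:R^-1) (x ord0 i + m.+1%:R^-1).
      by move: m0; set p := m.+1%:R^-1; lra.
    by rewrite in_itv/= => qx; exists q; rewrite /ball/= ltr_distl.
  pose q : 'rV[rat]_n := \row_i sval (qx i).
  have Qx : Q (q, m) x by move=> i _; rewrite /= mxE; exact: (svalP (qx i)).
  exists (q, m) => //; split => // y Qy; apply: xeU; rewrite row_ballE// => i.
  have := Qx i I; have := Qy i I; rewrite /ball/= => h1 h2.
  have : `|y ord0 i - x ord0 i| < m.+1%:R^-1 + m.+1%:R^-1.
    rewrite (le_lt_trans (ler_distD (ratr (q ord0 i)) _ _))// ltrD//.
    by rewrite distrC.
  by move: me; set p := m.+1%:R^-1; lra.
apply: countable_bigcupT_measurable; first exact: countableP.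
move=> k; have [QU|QU] := pselect (Q k `<=` U); last first.
  by rewrite (_ : F k = set0)//; apply/seteqP; split => // y [].
rewrite (_ : F k = Q k); last by apply/seteqP; split => y //; case.
apply: fin_bigcap_measurable => // i _; apply: measurable_coord_preimage.
exact: measurable_ball.
Qed.

Lemma continuous_measurable_row n (g : 'rV[R]_n -> R) :
  continuous g -> measurable_fun [set: 'rV[R]_n] g.
Proof.
move=> cg; apply: (measurability _ (RGenOInfty.measurableE R)).
move=> _ [_ [a ->] <-]; rewrite setTI; apply: measurable_open_row.
by apply: open_comp; [move=> x _; exact: cg|exact: interval_open].
Qed.

Lemma lebesgue_row_measurable n (A : set 'rV[R]_n) : measurable A ->
  measurable (A : set (lebesgue_space R n)).
Proof. exact: caratheodory_measurable_mu_ext. Qed.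

Lemma lebesgue_rowE n (A : set 'rV[R]_n) : measurable A -> lr n A = bl n A.
Proof. exact: measurable_mu_extE. Qed.

Lemma measurable_fun_lebesgue n d' (T : measurableType d') (h : 'rV[R]_n -> T) :
  measurable_fun [set: 'rV[R]_n] h ->
  measurable_fun [set: lebesgue_space R n] (h : lebesgue_space R n -> T).
Proof.
move=> mh _ Y mY; rewrite setTI; apply: lebesgue_row_measurable.
by rewrite -[X in measurable X]setTI; exact: mh.
Qed.

(** The identity, seen as a map from the Lebesgue to the Borel sigma-algebra, pushes [lebesgue_row]
    forward to a measure that agrees with [borel_lebesgue] on Borel sets. *)
Lemma lebesgue_row_integral n (D : set 'rV[R]_n) (h : 'rV[R]_n -> \bar R) :
  measurable D -> measurable_fun setT h -> (forall x, 0 <= h x)%E ->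
  (\int[lr n]_(x in D) h x = \int[bl n]_(x in D) h x)%E.
Proof.
move=> mD mh h0.
have mid : measurable_fun [set: lebesgue_space R n]
    (id : lebesgue_space R n -> 'rV[R]_n).
  by apply: measurable_fun_lebesgue; exact: measurable_id.
have := @ge0_integral_pushforward _ _ (lebesgue_space R n) 'rV[R]_n R id mid (lr n) D h mD.
rewrite preimage_id => <-//; last exact: measurable_funTS.
apply: eq_measure_integral => A mA _.
exact: lebesgue_rowE.
Qed.

(** Lebesgue measure is the outer measure, so [P \ A] has a Borel cover exceeding it by less than
    [c / 2 * V]. Removing this cover from [P] leaves a Borel subset of [A] that has lost no more
    than that. *)
Lemma inner_borel n (c V : R) (P A : set 'rV[R]_n) : 0 < c -> 0 < V ->
  measurable P -> bl n P = V%:E -> A `<=` P ->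
  measurable (A : set (lebesgue_space R n)) -> ((c * V)%:E <= lr n A)%E ->
  exists E, [/\ measurable E, E `<=` A & ((c / 2 * V)%:E <= bl n E)%E].
Proof.
move=> c0 V0 mP PV AP mA cA.
have lrP : lr n P = V%:E by rewrite lebesgue_rowE.
have mP' := lebesgue_row_measurable mP.
have mPA : measurable (P `\` A : set (lebesgue_space R n)) by exact: measurableD.
have PAE : (lr n P = lr n A + lr n (P `\` A))%E.
  rewrite -measureU//; last by rewrite setDE setICA setICr setI0.
  by congr (lr n _); rewrite setDUK.
have PAfin : lr n (P `\` A) \is a fin_num.
  rewrite ge0_fin_numE//; apply: (@le_lt_trans _ _ (lr n P)); last by rewrite lrP ltry.
  by apply: le_measure; rewrite ?inE// => x [].
have e0 : 0 < c / 2 * V by rewrite mulr_gt0// divr_gt0.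
have [_ [F [mF PAF] <-] Flt] := lb_ereal_inf_adherent e0 PAfin.
pose B := \bigcup_k F k.
have mB : measurable B by exact: bigcupT_measurable.
have blB : (bl n B < lr n (P `\` A) + (c / 2 * V)%:E)%E.
  by apply: le_lt_trans Flt; apply: measure_sigma_subadditive.
exists (P `\` B); split.
- exact: measurableD.
- move=> x [Px Bx]; apply: contrapT => Ax; apply: Bx; exact: PAF.
have PB : (V%:E <= bl n (P `\` B) + bl n B)%E.
  rewrite -PV addeC -{1}(setUIDK P B).
  apply: (@le_trans _ _ (bl n (P `&` B) + bl n (P `\` B))%E).
    by apply: measureU2; [exact: measurableI|exact: measurableD].
  by rewrite leeD2r// le_measure ?inE//; exact: measurableI.
have : (lr n A + lr n (P `\` A) <= bl n (P `\` B) + (lr n (P `\` A) + (c / 2 * V)%:E))%E.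
  rewrite -PAE lrP (le_trans PB)// leeD2l//; exact: ltW.
rewrite addeC [leRHS]addeCA -(fineK PAfin) leeD2lE//.
move=> /(le_trans cA); rewrite -leeBlDr// -EFinB.
by rewrite (_ : c * V - _ = c / 2 * V)//; field.
Qed.

Lemma measurable_ball_row n (x : 'rV[R]_n) r : 0 < r -> measurable (ball x r).
Proof. by move=> r0; apply: measurable_open_row; exact: ball_open. Qed.

Definition cube n (x : 'rV[R]_n) (r : R) : set 'rV[R]_n :=
  box (fun i => x ord0 i - r) (fun i => x ord0 i + r).

Lemma borel_lebesgue_cube n (x : 'rV[R]_n) r : 0 < r ->
  bl n (cube x r) = ((2 * r) ^+ n)%:E.
Proof.
move=> r0; rewrite borel_lebesgue_box => [|i]; last lra.
congr EFin; rewrite -[in RHS](card_ord n) -prodr_const.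
by apply: eq_bigr => i _; lra.
Qed.

Lemma ball_sub_cube n (x : 'rV[R]_n) r : 0 < r -> ball x r `<=` cube x r.
Proof.
move=> r0 y; rewrite row_ballE// => xy i.
by have := xy i; rewrite ltr_distl => /andP[/ltW -> ->].
Qed.

Lemma coord_le_enorm n (x : 'rV[R]_n) i : `|x ord0 i| <= enorm x.
Proof.
rewrite /enorm -sqrtr_sqr ler_wsqrtr// (bigD1 i)//= lerDl sumr_ge0// => j _.
exact: sqr_ge0.
Qed.

Lemma enorm_le_sum n (x : 'rV[R]_n) : enorm x <= \sum_i `|x ord0 i|.
Proof.
have S0 (r : seq 'I_n) : 0 <= \sum_(i <- r) `|x ord0 i| by exact: sumr_ge0.
rewrite /enorm -[leRHS](ger0_norm (S0 _)) -sqrtr_sqr ler_wsqrtr//.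
elim: (index_enum _) => [|j r IHr]; first by rewrite !big_nil expr2 mulr0.
rewrite !big_cons sqrrD real_normK ?num_real// -addrA lerD2l.
by rewrite (le_trans IHr)// lerDr mulrn_wge0// mulr_ge0.
Qed.

Lemma eball_sub_ball n (x : 'rV[R]_n) r : 0 < r -> eball x r `<=` ball x r.
Proof.
move=> r0 y xy; rewrite row_ballE// => i.
by have := coord_le_enorm (y - x) i; rewrite !mxE => /le_lt_trans; apply.
Qed.

(** The crude factor [n + 1] in place of the square root of [n] makes the inequality strict and
    stays meaningful for [n = 0]. *)
Lemma cube_sub_eball n (x : 'rV[R]_n) r : 0 < r ->
  cube x (r / n.+1%:R) `<=` eball x r.
Proof.
move=> r0 y xy; apply: le_lt_trans (enorm_le_sum _) _.
apply: (@le_lt_trans _ _ (\sum_(i < n) r / n.+1%:R)).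
  apply: ler_sum => i _; rewrite !mxE ler_distl.
  by have /andP[-> /ltW ->] := xy i.
rewrite sumr_const card_ord -[ltLHS]mulr_natr -mulrA gtr_pMr//.
by rewrite mulrC ltr_pdivrMr// mul1r ltr_nat.
Qed.

Lemma enorm2 n (x : 'rV[R]_n) : enorm x ^+ 2 = \sum_(i < n) x ord0 i ^+ 2.
Proof. by rewrite sqr_sqrtr// sumr_ge0// => i _; exact: sqr_ge0. Qed.

Lemma enorm_ge0 n (x : 'rV[R]_n) : 0 <= enorm x.
Proof. exact: sqrtr_ge0. Qed.

Lemma measurable_eball n (x : 'rV[R]_n) r : 0 < r -> measurable (eball x r).
Proof.
move=> r0.
have mf : measurable_fun [set: 'rV[R]_n]
    (fun y : 'rV[R]_n => \sum_(i < n) (y ord0 i - x ord0 i) ^+ 2).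
  apply: measurable_sum => i; apply: measurable_funX; apply: measurable_funB => //.
  exact: measurable_row_coord.
have -> : eball x r = setT `&`
    (fun y : 'rV[R]_n => \sum_(i < n) (y ord0 i - x ord0 i) ^+ 2) @^-1` `]-oo, r ^+ 2[%classic.
  rewrite setTI; apply/funext => y; rewrite /eball/= in_itv/=; congr is_true.
  rewrite -(@ltr_pXn2r _ 2) ?nnegrE ?enorm_ge0 ?(ltW r0)// enorm2.
  by congr (_ < _); apply: eq_bigr => i _; rewrite !mxE.
by apply: mf => //; exact: measurable_itv.
Qed.

(* The Vitali argument is run with sup-norm balls, which contain the Euclidean
   balls of the hypothesis and are comparable to them. *)
Lemma thick_box d (gamma kappa : R) : 0 < gamma <= 1 -> 0 < kappa <= 1 ->
  exists2 c : R, 0 < c <= 1 &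
  forall (rho : 'rV[R]_d -> R) (omega : set 'rV[R]_d) (lo hi : 'I_d -> R),
  (forall x, 0 < rho x) -> measurable (omega : set (lebesgue_space R d)) ->
  (forall x, gamma%:E <= lr d (eball x (rho x) `&` omega) / lr d (eball x (rho x)))%E ->
  (forall i, lo i < hi i) ->
  (forall z : 'rV[R]_d,
     (forall i, `|z ord0 i - (lo i + hi i) / 2| <= kappa * (hi i - lo i) / 2) ->
     eball z (rho z) `<=` box lo hi) ->
  ((c * \prod_i (hi i - lo i))%:E <= lr d (box lo hi `&` omega))%E.
Proof.
move=> /andP[g0 g1] /andP[k0 k1].
have d3 : 1 <= 3 * d.+1%:R :> R.
  by have : 1 <= d.+1%:R :> R; [rewrite ler1n|lra].
(* [kappa^d] is the share of the middle part in the box, [3^d] the Vitali enlargement, and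
   [(d + 1)^d] the price of comparing a sup-norm ball with a cube inside the Euclidean ball of the
   same radius. *)
exists (gamma * kappa ^+ d / (3 * d.+1%:R) ^+ d).
  have p0 : 0 < (3 * d.+1%:R : R) ^+ d by rewrite exprn_gt0//; lra.
  rewrite divr_gt0 ?mulr_gt0 ?exprn_gt0//= ler_pdivrMr// mul1r.
  rewrite (le_trans _ (exprn_ege1 _ d3))// mulr_ile1 ?exprn_ge0 ?exprn_ile1//;
  exact: ltW.
move=> rho omega lo hi rho0 mo thick lohi Bbox.
pose K : set 'rV[R]_d := [set v | forall i,
  `[(lo i + hi i) / 2 - kappa * (hi i - lo i) / 2,
    (lo i + hi i) / 2 + kappa * (hi i - lo i) / 2]%classic (v ord0 i)].
have KE z : K z -> forall i, `|z ord0 i - (lo i + hi i) / 2| <= kappa * (hi i - lo i) / 2.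
  by move=> Kz i; have := Kz i; rewrite /= in_itv/= ler_distl.
have cK : compact K := rV_compact (fun i => @segment_compact R _ _).
have [D DK KD] : finite_subset_cover K (fun z => ball z (rho z)) K.
  move: cK; rewrite compact_cover; apply.
    by move=> z _; exact: ball_open.
  by move=> z Kz; exists z => //; exact: ballxx.
have [D' [uD' D'D dD' cD']] := finite_Vitali (finmap.enum_fset D) rho0.
have D'K z : z \in D' -> K z by move=> /D'D zD; exact/set_mem/DK.
(* [K] is closed, to be compact; [K'] is the half-open version, whose volume is known. *)
pose K' := box (fun i => (lo i + hi i) / 2 - kappa * (hi i - lo i) / 2)
               (fun i => (lo i + hi i) / 2 + kappa * (hi i - lo i) / 2).
have volK' : bl d K' = (kappa ^+ d * \prod_i (hi i - lo i))%:E.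
  rewrite borel_lebesgue_box => [|i]; last first.
    by have := mulr_gt0 k0 (_ : 0 < hi i - lo i); rewrite subr_gt0 => /(_ (lohi i)); lra.
  congr EFin; rewrite -[in kappa ^+ d](card_ord d) -prodr_const -big_split/=.
  by apply: eq_bigr => i _; lra.
have mK' : measurable K' by exact: measurable_box.
have K'cover : (bl d K' <= \sum_(z <- D') bl d (ball z (3 * rho z)))%E.
  apply: measure_seq_subadditive => //.
    by move=> z; apply: measurable_ball_row; rewrite mulr_gt0.
  move=> x K'x.
  have : K x by move=> i; rewrite /= in_itv/=; have /andP[-> /ltW ->] := K'x i.
  by move=> /KD[z /= /cD'[y yD' sub] /sub]; exists y.
have mE z : measurable (eball z (rho z)) by exact: measurable_eball.
have mEo z : measurable ((eball z (rho z) `&` omega) : set (lebesgue_space R d)).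
  by apply: measurableI => //; exact: lebesgue_row_measurable.
have mbox := measurable_box lo hi.
have sum_le : (\sum_(z <- D') lr d (eball z (rho z) `&` omega) <= lr d (box lo hi `&` omega))%E.
  apply: measure_seq_superadditive => //.
  - by apply: measurableI => //; exact: lebesgue_row_measurable.
  - move=> x y xD yD xy; apply/seteqP; split => z // [[xz _] [yz _]].
    have <- := dD' _ _ xD yD xy.
    by split; exact: eball_sub_ball.
  - by move=> z zD; apply: setSI; apply: Bbox; apply: KE; exact: D'K.
apply: le_trans sum_le.
have d0 : 0 < d.+1%:R :> R by rewrite ltr0n.
have each z : ((gamma / (3 * d.+1%:R) ^+ d)%:E * bl d (ball z (3 * rho z))
    <= lr d (eball z (rho z) `&` omega))%E.
  have r0 := rho0 z.
  have up : (bl d (ball z (3 * rho z)) <= ((6 * rho z) ^+ d)%:E)%E.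
    have -> : 6 * rho z = 2 * (3 * rho z) by lra.
    rewrite -(@borel_lebesgue_cube _ z) ?mulr_gt0//.
    apply: le_measure; rewrite ?inE.
    - by apply: measurable_ball_row; rewrite mulr_gt0.
    - exact: measurable_box.
    - by apply: ball_sub_cube; rewrite mulr_gt0.
  have low : (((2 * (rho z / d.+1%:R)) ^+ d)%:E <= lr d (eball z (rho z)))%E.
    rewrite lebesgue_rowE// -(@borel_lebesgue_cube _ z) ?divr_gt0//.
    apply: le_measure; rewrite ?inE//; first exact: measurable_box.
    exact: cube_sub_eball.
  have upE : (lr d (eball z (rho z)) < +oo)%E.
    rewrite lebesgue_rowE//; apply: (@le_lt_trans _ _ (bl d (cube z (rho z)))).
      apply: le_measure; rewrite ?inE//; first exact: measurable_box.
      by apply: subset_trans (ball_sub_cube r0); exact: eball_sub_ball.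
    by rewrite borel_lebesgue_cube// ltry.
  have e0 : 0 < (2 * (rho z / d.+1%:R)) ^+ d by rewrite exprn_gt0// mulr_gt0// divr_gt0.
  have := thick z; set v := lr d (eball z (rho z)) in low upE *.
  have vfin : v \is a fin_num by rewrite ge0_fin_numE// measure_ge0.
  have v0 : 0 < fine v.
    by rewrite -lte_fin fineK// (lt_le_trans _ low)// lte_fin.
  rewrite -(fineK vfin) inver gt_eqF// lee_pdivlMr//; apply: le_trans.
  rewrite fineK//; apply: (@le_trans _ _ (gamma%:E * ((2 * (rho z / d.+1%:R)) ^+ d)%:E)%E).
    apply: (@le_trans _ _ ((gamma / (3 * d.+1%:R) ^+ d)%:E * ((6 * rho z) ^+ d)%:E)%E).
      by rewrite lee_wpmul2l// lee_fin divr_ge0 ?exprn_ge0 ?mulr_ge0// ltW.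
    rewrite -!EFinM lee_fin -mulrA ler_pM2l// -exprVn -exprMn.
    rewrite le_eqVlt; apply/orP; left; apply/eqP; congr (_ ^+ _); field.
    by rewrite nat1r gt_eqF.
  by rewrite lee_wpmul2l// lee_fin ltW.
apply: (@le_trans _ _ (\sum_(z <- D') (gamma / (3 * d.+1%:R) ^+ d)%:E * bl d (ball z (3 * rho z)))%E); last first.
  by apply: lee_sum => z _; exact: each.
rewrite -ge0_sume_distrr; last by move=> z _; exact: measure_ge0.
apply: (@le_trans _ _ ((gamma / (3 * d.+1%:R) ^+ d)%:E * bl d K')%E); last first.
  by rewrite lee_wpmul2l// lee_fin divr_ge0 ?exprn_ge0 ?mulr_ge0// ltW.
rewrite volK' -EFinM lee_fin le_eqVlt; apply/orP; left; apply/eqP.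
by field; rewrite expf_neq0// mulf_neq0 ?nat1r ?gt_eqF.
Qed.

End borel_row.

(** * The Remez inequality on one thick box, and gluing of boxes *)

Section local_estimate.
Context {R : realType}.
Local Notation bl := (@borel_lebesgue R).
Local Notation lr := (lebesgue_row R).
Local Open Scope ereal_scope.

Definition thick_on d (gamma : R) (rho : 'rV[R]_d -> R) (omega : set 'rV[R]_d) :=
  [/\ forall x, (0 < rho x)%R, measurable (omega : set (lebesgue_space R d)) &
    forall x, gamma%:E <= lr d (eball x (rho x) `&` omega) / lr d (eball x (rho x))].

Definition inner_balls d (kappa : R) (rho : 'rV[R]_d -> R) (lo hi : 'I_d -> R) :=
  forall z : 'rV[R]_d,
    (forall i, `|z ord0 i - (lo i + hi i) / 2| <= kappa * (hi i - lo i) / 2)%R ->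
    eball z (rho z) `<=` box lo hi.

(** [thick_box] gives density [c] of [omega] in the box, and [inner_borel] a Borel subset of density
    [c / 2] to which [box_Remez] applies. Passing back from this subset to [omega] only enlarges the
    right-hand side. *)
Lemma local_Remez d (gamma kappa : R) :
  (0 < gamma <= 1)%R -> (0 < kappa <= 1)%R -> exists2 C : R, (1 <= C)%R &
  forall N (g : 'rV[R]_d -> R) rho omega (lo hi : 'I_d -> R) (l : R),
  pure_derivable g -> pure_measurable g ->
  measurable_fun [set: 'rV[R]_d] g -> thick_on gamma rho omega ->
  (forall i, lo i < hi i)%R -> (forall i, hi i - lo i <= l)%R ->
  inner_balls kappa rho lo hi ->
  \int[lr d]_(x in box lo hi) (g x ^+ 2)%:E <= (C ^+ N.+1)%:E *
    (\int[lr d]_(x in box lo hi `&` omega) (g x ^+ 2)%:E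
     + ((l ^+ N.+1 / N.+1`!%:R) ^+ 2)%:E * \sum_(i < d)
        (\int[lr d]_(x in box lo hi) (iter N.+1 (partial i) g x ^+ 2)%:E
         + (l ^+ 2)%:E *
           \int[lr d]_(x in box lo hi) (iter N.+2 (partial i) g x ^+ 2)%:E)).
Proof.
move=> g01 k01; have [c /andP[c0 c1] thickP] := @thick_box R d gamma kappa g01 k01.
have c2 : (0 < c / 2 <= 1)%R by rewrite divr_gt0//=; lra.
have [C C1 CP] := box_Remez d c2; exists C => // N g rho omega lo hi l dg mg mg0.
move=> [rho0 mo tho] lohi hil inn.
have mbox := measurable_box lo hi.
have mbox' := lebesgue_row_measurable mbox.
have V0 : (0 < \prod_i (hi i - lo i))%R by apply: prodr_gt0 => i _; rewrite subr_gt0.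
have VE : bl d (box lo hi) = (\prod_i (hi i - lo i))%:E.
  by rewrite borel_lebesgue_box// => i; exact: ltW.
have mbo : measurable (box lo hi `&` omega : set (lebesgue_space R d)).
  exact: measurableI.
have [E [mE Ebo cE]] := inner_borel c0 V0 mbox VE (@subIsetl _ _ _) mbo
  (thickP rho omega lo hi rho0 mo tho lohi inn).
have sq0 (h : 'rV[R]_d -> R) x : 0 <= (h x ^+ 2)%:E by rewrite lee_fin sqr_ge0.
have msq (h : 'rV[R]_d -> R) : measurable_fun [set: 'rV[R]_d] h ->
    measurable_fun [set: 'rV[R]_d] (fun x => (h x ^+ 2)%:E).
  by move=> mh; apply/measurable_EFinP; exact: measurable_funX.
have := CP N g lo hi l E dg mg lohi hil mE.
rewrite VE -EFinM => /(_ (subset_trans Ebo (@subIsetl _ _ _)) cE).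
rewrite (lebesgue_row_integral mbox (msq _ mg0) (sq0 _)).
move=> /le_trans; apply; apply: lee_wpmul2l.
  by rewrite lee_fin exprn_ge0// (le_trans _ C1).
apply: leeD.
  rewrite -(lebesgue_row_integral mE (msq _ mg0) (sq0 _)).
  apply: (ge0_subset_integral (lr d) (lebesgue_row_measurable mE) mbo _ _ Ebo).
    by apply: measurable_funTS; apply: measurable_fun_lebesgue; exact: msq.
  by move=> x _; exact: sq0.
apply: lee_wpmul2l; first by rewrite lee_fin sqr_ge0.
have e i k : \int[lr d]_(x in box lo hi) (iter k (partial i) g x ^+ 2)%:E
    = \int[bl d]_(x in box lo hi) (iter k (partial i) g x ^+ 2)%:E.
  exact: (lebesgue_row_integral mbox (msq _ (mg i k)) (sq0 _)).
by apply: lee_sum => i _; rewrite (e i N.+1) (e i N.+2).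
Qed.

Context (d : nat).
Implicit Types (f h : lebesgue_space R d -> \bar R) (lo hi : 'I_d -> R).

(** The local form of the final inequality, for one fixed [h] on every set. It is stable under
    countable disjoint unions, so that it can be checked on small boxes. *)
Definition dominates h f (A : set (lebesgue_space R d)) :=
  \int[lr d]_(x in A) f x <= \int[lr d]_(x in A) h x.

Section closure_properties.
Context (f h : lebesgue_space R d -> \bar R).
Hypothesis mf : measurable_fun setT f.
Hypothesis mh : measurable_fun setT h.
Hypothesis f0 : forall x, 0 <= f x.
Hypothesis h0 : forall x, 0 <= h x.

Lemma dominatesU A B : measurable A -> measurable B -> [disjoint A & B] ->
  dominates h f A -> dominates h f B -> dominates h f (A `|` B).
Proof.
move=> mA mB AB hA hB; rewrite /dominates !ge0_integral_setU//.
- exact: leeD.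
- exact: measurable_funTS.
- exact: measurable_funTS.
Qed.

Lemma dominates_bigcup (F : (set (lebesgue_space R d))^nat) :
  (forall k, measurable (F k)) -> trivIset setT F ->
  (forall k, dominates h f (F k)) -> dominates h f (\bigcup_k F k).
Proof.
move=> mF tF hF; rewrite /dominates !ge0_integral_bigcup//.
- by apply: lee_nneseries => [*|k _]; [exact: integral_ge0|exact: hF].
- exact: measurable_funTS.
- exact: measurable_funTS.
Qed.

Lemma integral_seq_subadditive (I : eqType) (s : seq I)
    (F : I -> set (lebesgue_space R d)) A :
  measurable A -> (forall i, measurable (F i)) ->
  A `<=` [set x | exists2 i, i \in s & F i x] ->
  \int[lr d]_(x in A) f x <= \sum_(i <- s) \int[lr d]_(x in F i) f x.
Proof.
move=> + mF; elim: s A => [|j s IHs] A mA AF.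
  rewrite big_nil (_ : A = set0) ?integral_set0//.
  by apply/seteqP; split => // x /AF[].
rewrite big_cons -{1}(setUIDK A (F j)) ge0_integral_setU//.
- apply: leeD.
    apply: ge0_subset_integral => //; first exact: measurableI.
    exact: measurable_funTS.
  apply: IHs; first exact: measurableD.
  move=> x [/AF[k +]]; rewrite inE => /predU1P[->//|ks] Fkx _.
  by exists k.
- exact: measurableI.
- exact: measurableD.
- exact: measurable_funTS.
- by apply/disj_setPS => x [[_ Fx] [_]]; apply.
Qed.

(** The sets may overlap; each contributes at most the full integral of [h], whence the factor
    [size s]. *)
Lemma integral_le_cover (I : eqType) (s : seq I) (F : I -> set (lebesgue_space R d)) :
  (forall i, measurable (F i)) -> (forall i, dominates h f (F i)) ->
  (forall x, exists2 i, i \in s & F i x) ->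
  \int[lr d]_x f x <= (size s)%:R%:E * \int[lr d]_x h x.
Proof.
move=> mF hF cF.
apply: (le_trans (@integral_seq_subadditive _ s F setT _ mF _)) => //.
  by move=> x _; exact: cF.
have hT i : \int[lr d]_(x in F i) f x <= \int[lr d]_x h x.
  by apply: le_trans (hF i) _; apply: ge0_subset_integral.
elim: s {cF} => [|j s IHs]; first by rewrite big_nil mul0e.
rewrite big_cons /= -nat1r EFinD ge0_muleDl ?lee_fin// mul1e.
exact: leeD.
Qed.

Definition set_coord lo (i : 'I_d) (c : R) j := if j == i then c else lo j.

Lemma dominates_split lo hi i c : (lo i <= c <= hi i)%R ->
  dominates h f (box lo (set_coord hi i c)) ->
  dominates h f (box (set_coord lo i c) hi) -> dominates h f (box lo hi).
Proof.
move=> /andP[loc chi] h1 h2.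
have -> : box lo hi = box lo (set_coord hi i c) `|` box (set_coord lo i c) hi.
  apply/seteqP; split => x.
    move=> xP; have [xc|cx] := ltP (x ord0 i) c; [left|right] => j;
      have /andP[h3 h4] := xP j; rewrite /set_coord; case: eqP => [->|_];
      rewrite ?h3 ?h4 ?xc ?cx ?andbT//=.
    by have /andP[-> _] := xP i.
    by have /andP[_ ->] := xP i.
  case=> xP j; have := xP j; rewrite /set_coord; case: eqP => [->|//] /andP[h3 h4].
    by rewrite h3 (lt_le_trans h4).
  by rewrite h4 (le_trans loc).
apply: (dominatesU (lebesgue_row_measurable (measurable_box _ _))
  (lebesgue_row_measurable (measurable_box _ _))) => //.
apply/disj_setPS => x [/(_ i) + /(_ i)]; rewrite /set_coord eqxx.
by move=> /andP[_ xc] /andP[+ _]; rewrite leNgt xc.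
Qed.

(** [s] lists the coordinates still to be halved. The pieces are not enumerated: the assumption
    quantifies over all sub-boxes with the right side lengths, which keeps the induction free of
    indices. *)
Lemma dominates_halve (s : seq 'I_d) lo hi : uniq s -> (forall j, lo j <= hi j)%R ->
  (forall lo' hi', (forall j, [/\ lo j <= lo' j, hi' j <= hi j &
     hi' j - lo' j = (hi j - lo j) / (if j \in s then 2 else 1)]%R) ->
     dominates h f (box lo' hi')) ->
  dominates h f (box lo hi).
Proof.
elim: s lo hi => [|i s IHs] lo hi.
  by move=> _ _; apply => j; rewrite in_nil divr1.
rewrite cons_uniq => /andP[iS us] lohi H.
have lohii := lohi i.
pose c := ((lo i + hi i) / 2)%R.
apply: (@dominates_split _ _ i c); first by apply/andP; split; rewrite /c; lra.
  apply: IHs => // [j|lo' hi' H'].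
    by rewrite /set_coord; case: eqP => [->|_ //]; rewrite /c; lra.
  apply: H => j; have [+ + +] := H' j.
  rewrite /set_coord inE; case: eqP => [->|_] h1 h2 h3; last by split.
  by move: h1 h2 h3; rewrite (negbTE iS)/= /c => h1 h2 h3; split => //; lra.
apply: IHs => // [j|lo' hi' H'].
  by rewrite /set_coord; case: eqP => [->|_ //]; rewrite /c; lra.
apply: H => j; have [+ + +] := H' j.
rewrite /set_coord inE; case: eqP => [->|_] h1 h2 h3; last by split.
by move: h1 h2 h3; rewrite (negbTE iS)/= /c => h1 h2 h3; split => //; lra.
Qed.

Lemma dominates_bisect n lo hi : (forall j, lo j <= hi j)%R ->
  (forall lo' hi', (forall j, [/\ lo j <= lo' j, hi' j <= hi j &
     hi' j - lo' j = (hi j - lo j) / 2 ^+ n]%R) -> dominates h f (box lo' hi')) ->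
  dominates h f (box lo hi).
Proof.
elim: n lo hi => [|n IHn] lo hi lohi H.
  by apply: H => j; rewrite expr0 divr1.
apply: (@dominates_halve (enum 'I_d)) => //; first exact: enum_uniq.
move=> lo1 hi1 H1; apply: IHn => [j|lo2 hi2 H2].
  have [_ _ e] := H1 j; rewrite -subr_ge0 e divr_ge0 ?subr_ge0//.
  by case: ifP.
apply: H => j; have [a1 b1 e1] := H1 j; have [a2 b2 e2] := H2 j.
split; [exact: le_trans a2|exact: le_trans b1|].
rewrite e2 e1 mem_enum exprS; field.
by rewrite expf_neq0.
Qed.

End closure_properties.

End local_estimate.

(** * Covering the space by boxes *)

Section geometric_scale.
Context {R : realType}.
Implicit Types a b y : R.

Lemma expr_unbounded a y : 1 < a -> exists n, y < a ^+ n.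
Proof.
move=> a1; have a10 : 0 < a - 1 by rewrite subr_gt0.
have [n yn] : exists n : nat, y / (a - 1) < n%:R.
  by exists (Num.truncn (y / (a - 1))).+1; rewrite truncnS_gt.
exists n; move: yn; rewrite ltr_pdivrMr// => /lt_le_trans; apply.
elim: n => [|n IHn]; first by rewrite mul0r.
rewrite exprS -nat1r mulrDl mul1r.
have : 1 <= a ^+ n by apply: exprn_ege1; exact: ltW.
by move: IHn; set u := a ^+ n; nra.
Qed.

Lemma geometric_bracket a b y : 0 < b -> 1 < a -> b <= y ->
  exists k, b * a ^+ k <= y < b * a ^+ k.+1.
Proof.
move=> b0 a1 yb.
have ex : exists n, y < b * a ^+ n.
  have [n yn] := expr_unbounded (y / b) a1; exists n.
  by rewrite mulrC -ltr_pdivrMr.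
case: (ex_minnP ex) => -[|k]; first by rewrite expr0 mulr1 ltNge yb.
move=> yk mink; exists k; rewrite yk andbT leNgt; apply/negP => /mink.
by rewrite ltnn.
Qed.

(** The variant closed on the right serves the slabs on the negative side of an axis, where
    reflection exchanges the closed and the open end. *)
Lemma geometric_bracketl a b y : 0 < b -> 1 < a -> b < y ->
  exists k, b * a ^+ k < y <= b * a ^+ k.+1.
Proof.
move=> b0 a1 yb.
have ex : exists n, y <= b * a ^+ n.
  have [n yn] := expr_unbounded (y / b) a1; exists n.
  by rewrite mulrC -ler_pdivrMr// ltW.
case: (ex_minnP ex) => -[|k]; first by rewrite expr0 mulr1 leNgt yb.
move=> yk mink; exists k; rewrite yk andbT ltNge; apply/negP => /mink.
by rewrite ltnn.
Qed.

Lemma halving_bracket a b : 0 < b -> b <= a -> exists n, b <= a / 2 ^+ n < 2 * b.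
Proof.
move=> b0 ab; have [n /andP[h1 h2]] := geometric_bracket b0 (ltr1n R 2) ab.
exists n; have p0 : 0 < 2 ^+ n :> R by rewrite exprn_gt0.
rewrite ler_pdivlMr// h1 ltr_pdivrMr//; move: h2; rewrite exprS; lra.
Qed.

End geometric_scale.

Section cover.
Context {R : realType}.
Local Notation lr := (lebesgue_row R).
Context (d : nat).
Implicit Types (M r eta delta t : R) (rho : 'rV[R]_d -> R) (z y : 'rV[R]_d).

Definition admissible_radius M r0 eta delta rho :=
  [/\ 1 <= M, 1 <= r0, 0 < eta < 1, 0 <= delta <= 1 &
  [/\ forall x, 0 < rho x,
    forall x, rho x <= M * (1 + enorm x ^+ 2) `^ (delta / 2) &
    forall x, r0 <= enorm x -> rho x <= eta * enorm x]].

(* Outside a base cube the space is cut into the slabs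
   [t <= +-x_i < L t, |x_j| <= 2 L t], with [L] the [cover_ratio], [t] running
   over a geometric progression; [cover_kappa] is the relative size of the middle
   part of a box whose balls must stay inside the box. *)
Definition cover_ratio eta : R := 4 / (1 - eta).
Definition cover_kappa eta : R := (1 - eta) / (8 * (2 * d%:R + 1)).
(** [192 = 64 * 3]: on a slab [rho] is at most [3 M (d + 1) L t^delta], and the boxes cut from it
    have sides at most 64 times that. The second summand is the side of the base cube. *)
Definition cover_scale M r0 eta : R :=
  192 * M * d.+1%:R * cover_ratio eta + 16 * M * r0.

(** The square of the profile [(1 + |x|^2)^(delta/2)], so that [l^(2k)] is compared with [weight^k]
    and no square root of the side length is taken. *)
Definition weight delta (x : 'rV[R]_d) : R := (1 + enorm x ^+ 2) `^ delta.

Definition good_box M r0 eta delta rho (lo hi : 'I_d -> R) :=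
  [/\ forall i, lo i < hi i, inner_balls (cover_kappa eta) rho lo hi &
    exists l, [/\ 0 <= l, forall i, hi i - lo i <= l &
      forall x, box lo hi x -> l ^+ 2 <= cover_scale M r0 eta ^+ 2 * weight delta x]].

Lemma cover_ratioP eta : 0 < eta < 1 ->
  (1 - eta) * cover_ratio eta = 4 /\ 4 <= cover_ratio eta.
Proof.
move=> /andP[e0 e1]; rewrite /cover_ratio; split; first by field; rewrite gt_eqF// subr_gt0.
by rewrite ler_pdivlMr ?subr_gt0//; lra.
Qed.

Lemma cover_kappaP eta : 0 < eta < 1 ->
  [/\ 0 < cover_kappa eta, cover_kappa eta <= 8^-1 &
      (2 * d%:R + 1) * cover_kappa eta = (1 - eta) / 8].
Proof.
move=> /andP[e0 e1]; rewrite /cover_kappa.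
move: (d%:R : R) (ler0n R d) => D D0.
split.
- by rewrite divr_gt0//; lra.
- by rewrite ler_pdivrMr; lra.
- by field; rewrite gt_eqF//; lra.
Qed.

Lemma one_enorm_ge1 (x : 'rV[R]_d) : 1 <= 1 + enorm x ^+ 2.
Proof. by rewrite lerDl sqr_ge0. Qed.

Lemma enorm_le_const z (b : R) : (forall j, `|z ord0 j| <= b) ->
  enorm z <= d%:R * b.
Proof.
move=> zb; apply: le_trans (enorm_le_sum z) _.
rewrite mulr_natl -[in leRHS](card_ord d) -sumr_const.
by apply: ler_sum => j _.
Qed.

Lemma enorm_le_constD1 z i (b : R) : 0 <= b ->
  (forall j, j != i -> `|z ord0 j| <= b) -> enorm z <= `|z ord0 i| + d%:R * b.
Proof.
move=> b0 zb; apply: le_trans (enorm_le_sum z) _.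
rewrite (bigD1 i)//= lerD2l mulr_natl -[in leRHS](card_ord d) -sumr_const.
rewrite [leRHS](bigD1 i)//= -[leLHS]add0r lerD//.
by apply: ler_sum => j ji; exact: zb.
Qed.

Lemma eball_coord z y r j : eball z r y -> `|y ord0 j - z ord0 j| < r.
Proof. by apply: le_lt_trans; have := coord_le_enorm (y - z) j; rewrite !mxE. Qed.

Lemma powR_half delta (y : R) : 0 <= y -> (y ^+ 2) `^ (delta / 2) = y `^ delta.
Proof.
move=> y0; rewrite -powR_mulrn// -powRrM; congr (_ `^ _); lra.
Qed.

Lemma powR_sqr delta (y : R) : 0 <= y -> (y ^+ 2) `^ delta = (y `^ delta) ^+ 2.
Proof.
by move=> y0; rewrite -[RHS]powR_mulrn ?powR_ge0// -powRrM mulrC powRrM powR_mulrn.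
Qed.

Lemma weight_half_le delta (x : 'rV[R]_d) (b : R) : 0 <= delta <= 1 -> 1 <= b ->
  1 + enorm x ^+ 2 <= b ^+ 2 -> (1 + enorm x ^+ 2) `^ (delta / 2) <= b `^ delta.
Proof.
move=> /andP[dl0 dl1] b1 xb; rewrite -(@powR_half delta b); last lra.
apply: ge0_ler_powR => //; rewrite ?nnegrE ?sqr_ge0//; first lra.
by rewrite (le_trans _ (one_enorm_ge1 x)).
Qed.

Lemma powR_le_self delta (b : R) : 0 <= delta <= 1 -> 1 <= b -> b `^ delta <= b.
Proof.
move=> /andP[dl0 dl1] b1; rewrite -[leRHS]powRr1; last lra.
by apply: ler_powR.
Qed.

Lemma powR_ge1 delta (b : R) : 0 <= delta -> 1 <= b -> 1 <= b `^ delta.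
Proof. by move=> dl0 b1; rewrite -[leLHS](powRr0 b); apply: ler_powR. Qed.

(** With [b = 8 M r0], a middle point [z] has [|z| <= b / 8]. Either [|z| >= r0] and [rho z <= |z|],
    or [1 + |z|^2 <= (2 r0)^2] and [rho z <= 2 M r0]; both are at most [b / 2], so the ball around
    [z] stays in the cube. *)
Lemma base_good M r0 eta delta rho : admissible_radius M r0 eta delta rho ->
  good_box M r0 eta delta rho (fun _ => - (8 * M * r0)) (fun _ => 8 * M * r0).
Proof.
move=> [M1 r01 eta01 delta01 [rho0 rhoM rhoeta]].
have [e0 e1] := andP eta01.
have [k0 k8 kE] := cover_kappaP eta01.
have [LamE Lam4] := cover_ratioP eta01.
set b := 8 * M * r0.
have b8 : 8 <= b by rewrite /b; nra.
have Mr0 : 0 < M * r0 by rewrite mulr_gt0//; lra.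
have bE : b = 8 * (M * r0) by rewrite mulrA.
set k := cover_kappa eta in k0 k8 kE.
have D0 : 0 <= d%:R :> R := ler0n R d.
split; first by move=> _; lra.
  move=> z; rewrite addNr mul0r -/k => zmid y zy i.
  have zk j : `|z ord0 j| <= k * b by have := zmid j; rewrite subr0; lra.
  have zn := enorm_le_const zk.
  have dkb : d%:R * (k * b) <= b / 8.
    rewrite mulrA mulrC ler_wpM2l//; first lra.
    by move: (d%:R : R) D0 kE => D D0 kE; have : 0 <= D * k; [rewrite mulr_ge0// ltW|nra].
  have rz : rho z <= b / 2.
    have [zr|zr] := leP r0 (enorm z).
      rewrite (le_trans (rhoeta _ zr))//.
      by have := enorm_ge0 z; move: (enorm z) zn => u; nra.
    rewrite (le_trans (rhoM z))// (_ : b / 2 = M * (4 * r0)); last by rewrite bE; field.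
    rewrite ler_wpM2l//; first lra.
    apply: (@le_trans _ _ ((2 * r0) `^ delta)).
      apply: weight_half_le => //; first lra.
      by have := enorm_ge0 z; move: (enorm z) zr => u; nra.
    by rewrite (le_trans (powR_le_self _ _))//; lra.
  have := eball_coord i zy; rewrite ltr_distl.
  have := zk i; rewrite ler_norml => /andP[h1 h2] /andP[h3 h4].
  have kb : k * b <= 8^-1 * b by rewrite ler_wpM2r//; lra.
  by apply/andP; split; lra.
exists (2 * b); split; [lra|by move=> _; lra|move=> x _].
have w1 : 1 <= weight delta x.
  by apply: powR_ge1; [case/andP: delta01|exact: one_enorm_ge1].
rewrite (le_trans (_ : _ <= cover_scale M r0 eta ^+ 2))//; last by rewrite ler_peMr ?sqr_ge0.
have c0 : 0 <= 192 * M * d.+1%:R * cover_ratio eta.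
  rewrite mulr_ge0//; last lra.
  by rewrite mulr_ge0 ?ler0n// mulr_ge0//; lra.
rewrite /cover_scale; move: (192 * M * _ * _) c0 => c c0.
rewrite lerXn2r ?nnegrE//; lra.
Qed.

(** Written as center minus half-width, so that the sign reflects the center only and the lower end
    stays below the upper one. In the direction [i] the interval is [[t, L t[] or [[- L t, - t[]. *)
Definition slab_lo eta t (i : 'I_d) (s : bool) (j : 'I_d) : R :=
  if j == i then (-1) ^+ s * ((cover_ratio eta + 1) / 2 * t)
                 - (cover_ratio eta - 1) / 2 * t
  else - (2 * cover_ratio eta * t).

Definition slab_hi eta t (i : 'I_d) (s : bool) (j : 'I_d) : R :=
  if j == i then (-1) ^+ s * ((cover_ratio eta + 1) / 2 * t)
                 + (cover_ratio eta - 1) / 2 * t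
  else 2 * cover_ratio eta * t.

Lemma slab_coordP eta t i s (x : 'rV[R]_d) :
  box (slab_lo eta t i s) (slab_hi eta t i s) x <->
  [/\ (if s then (t < - x ord0 i <= cover_ratio eta * t)%R
       else (t <= x ord0 i < cover_ratio eta * t)%R) &
      forall j, j != i ->
        - (2 * cover_ratio eta * t) <= x ord0 j < 2 * cover_ratio eta * t].
Proof.
rewrite /box /slab_lo /slab_hi /=; split => [xP|[xi xj] j].
  split => [|j ji]; last by have := xP j; rewrite (negbTE ji).
  have := xP i; rewrite eqxx; case: s xP => _ /=; rewrite ?expr1 ?expr0 => /andP[h1 h2];
    by apply/andP; split; lra.
case: eqP => [->|/eqP/xj//]; move: xi; case: s => /=;
  rewrite ?expr1 ?expr0 => /andP[h1 h2]; by apply/andP; split; lra.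
Qed.

Lemma slab_weight_ge eta delta t i s (x : 'rV[R]_d) : 0 <= delta -> 0 <= t ->
  box (slab_lo eta t i s) (slab_hi eta t i s) x -> (t `^ delta) ^+ 2 <= weight delta x.
Proof.
move=> dl0 t0 /slab_coordP[xi _]; rewrite -powR_sqr// /weight.
have tx : t <= enorm x.
  apply: le_trans (coord_le_enorm x i).
  case: s xi => /andP[h1 h2]; first by rewrite -normrN (le_trans _ (ler_norm _))// ltW.
  by rewrite (le_trans _ (ler_norm _)).
apply: ge0_ler_powR; rewrite ?nnegrE ?sqr_ge0//.
  by rewrite (le_trans _ (one_enorm_ge1 x)).
by have := enorm_ge0 x; nra.
Qed.

Lemma slab_rho_le M r0 eta delta rho t i s (x : 'rV[R]_d) :
  admissible_radius M r0 eta delta rho -> 1 <= t ->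
  box (slab_lo eta t i s) (slab_hi eta t i s) x ->
  rho x <= M * (3 * d.+1%:R * cover_ratio eta * t `^ delta).
Proof.
move=> [M1 r01 eta01 delta01 [rho0 rhoM rhoeta]] t1 /slab_coordP[xi xj].
have [LamE Lam4] := cover_ratioP eta01.
set Lam := cover_ratio eta in xi xj LamE Lam4 *.
have Lt0 : 0 <= Lam * t by rewrite mulr_ge0//; lra.
have xb j : `|x ord0 j| <= 2 * Lam * t.
  have [->|/xj/andP[h1 h2]] := eqVneq j i.
    rewrite ler_norml; case: (s) xi => /andP[h1 h2]; apply/andP; split; lra.
  by rewrite ler_norml h1 ltW.
have xn := enorm_le_const xb.
rewrite (le_trans (rhoM x))// ler_wpM2l//; first lra.
have D1 : 1 <= d.+1%:R :> R by rewrite ler1n.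
have dD : d%:R <= d.+1%:R :> R by rewrite ler_nat.
have D0 : 0 <= d%:R :> R := ler0n R d.
have c1 : 1 <= 3 * d.+1%:R * Lam.
  by move: (d.+1%:R : R) D1 => D D1; nra.
apply: (@le_trans _ _ ((3 * d.+1%:R * Lam * t) `^ delta)); last first.
  rewrite powRM; [|lra|lra].
  by rewrite ler_wpM2r ?powR_ge0// powR_le_self.
apply: weight_half_le => //; first by nra.
have u0 := enorm_ge0 x.
have v1 : 1 <= d.+1%:R * (Lam * t).
  by move: (d.+1%:R : R) D1 => D D1; have : 1 <= Lam * t; nra.
have xn' : enorm x <= 2 * (d.+1%:R * (Lam * t)).
  by rewrite (le_trans xn)//; have := ler_wpM2r Lt0 dD; lra.
rewrite (_ : 3 * d.+1%:R * Lam * t = 3 * (d.+1%:R * (Lam * t))); last by ring.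
by move: (d.+1%:R * (Lam * t)) v1 (enorm x) u0 xn' => v v1 u u0 uv; nra.
Qed.

(** At the midpoint [(L + 1) t / 2] of the [i]-th side, [rho <= eta |z|] leaves room at both ends
    because [L] satisfies [(1 - eta) L t = 4 t]. Moving [z] within the middle part, and replacing
    [|z|] by [|z_i|] plus the other coordinates, costs at most [(2 d + 1) kappa L t], and [kappa] is
    chosen to make this [t / 2]. *)
Lemma slab_inner M r0 eta delta rho t i s :
  admissible_radius M r0 eta delta rho -> r0 <= t ->
  inner_balls (cover_kappa eta) rho (slab_lo eta t i s) (slab_hi eta t i s).
Proof.
move=> [M1 r01 eta01 delta01 [rho0 rhoM rhoeta]] r0t z zmid y zy.
have [e0 e1] := andP eta01.
have [k0 k8 kE] := cover_kappaP eta01.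
have [LamE Lam4] := cover_ratioP eta01.
have t1 : 1 <= t by exact: le_trans r0t.
set k := cover_kappa eta in k0 k8 kE zmid.
set Lam := cover_ratio eta in LamE Lam4.
pose a := Lam * t; pose p := k * a.
have D0 : 0 <= d%:R :> R := ler0n R d.
have a4 : 4 * t <= a by rewrite ler_wpM2r//; lra.
have aE : (1 - eta) * a = 4 * t by rewrite /a mulrA LamE.
have p0 : 0 <= p by apply: mulr_ge0; [exact: ltW|lra].
have pE : d%:R * (2 * p) = t / 2 - p.
  have e : (2 * d%:R + 1) * p = t / 2.
    by rewrite /p mulrA kE mulrAC aE; field.
  by move: e; move: (d%:R : R) => D; lra.
have p2 : p <= t / 2.
  have : 0 <= d%:R * (2 * p) by apply: mulr_ge0 => //; apply: mulr_ge0.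
  by rewrite pE; lra.
have zi : `|z ord0 i - (-1) ^+ s * ((a + t) / 2)| <= p.
  have := zmid i; rewrite /slab_lo /slab_hi eqxx -/Lam.
  have -> : ((-1) ^+ s * ((Lam + 1) / 2 * t) - (Lam - 1) / 2 * t +
    ((-1) ^+ s * ((Lam + 1) / 2 * t) + (Lam - 1) / 2 * t)) / 2
    = (-1) ^+ s * ((a + t) / 2) by rewrite /a; field.
  move=> /le_trans; apply.
  rewrite (_ : k * _ / 2 = p / 2 - k * t / 2); last by rewrite /p /a; field.
  by have : 0 <= k * t; [rewrite mulr_ge0//; lra|move: (k * t) => u; lra].
have zj j : j != i -> `|z ord0 j| <= 2 * p.
  move=> ji; have := zmid j; rewrite /slab_lo /slab_hi (negbTE ji) -/Lam addNr mul0r subr0.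
  by move=> /le_trans; apply; rewrite /p /a; lra.
have p20 : 0 <= 2 * p by rewrite mulr_ge0.
have zn := enorm_le_constD1 p20 zj; rewrite pE in zn.
have xi_b : (a + t) / 2 - p <= `|z ord0 i| <= (a + t) / 2 + p.
  move: zi; rewrite ler_norml => /andP[].
  case: s {zmid zy} => /=; rewrite ?expr1 ?expr0 => h1 h2.
    by rewrite -normrN ger0_norm; [apply/andP; split|]; lra.
  by rewrite ger0_norm; [apply/andP; split|]; lra.
have tz : r0 <= enorm z.
  by apply: le_trans (coord_le_enorm z i); case/andP: xi_b; lra.
have rz : rho z <= eta * `|z ord0 i| + (t / 2 - p).
  rewrite (le_trans (rhoeta _ tz))//.
  have : 0 <= t / 2 - p by lra.
  move: (t / 2 - p) zn => q; move: (enorm z) (enorm_ge0 z) (`|z ord0 i|) => u u0 v uv q0.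
  by nra.
have etaE : eta * a = a - 4 * t by lra.
have [xi1 xi2] := andP xi_b.
have up : eta * `|z ord0 i| <= (a - 3 * t) / 2 + p.
  apply: (@le_trans _ _ (eta * ((a + t) / 2 + p))); first by rewrite ler_pM2l.
  have : eta * t <= t by rewrite ler_piMl//; lra.
  have : eta * p <= p by rewrite ler_piMl//; lra.
  by move: etaE; rewrite !mulrDr !mulrA; lra.
have lowb : 2 * t - p <= `|z ord0 i| - eta * `|z ord0 i|.
  rewrite -{1}[`|z ord0 i|]mul1r -mulrBl.
  apply: (@le_trans _ _ ((1 - eta) * ((a + t) / 2 - p))); last by rewrite ler_wpM2l//; lra.
  have : 0 <= (1 - eta) * t by rewrite mulr_ge0//; lra.
  have : 0 <= eta * p by rewrite mulr_ge0// ltW.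
  by move: aE; rewrite !mulrBl; lra.
apply/slab_coordP; split; last first.
  move=> j ji; have := eball_coord j zy; rewrite ltr_distl => /andP[h1 h2].
  have := zj j ji; rewrite ler_norml => /andP[h3 h4].
  by rewrite -mulrA -/a; apply/andP; split; lra.
have := eball_coord i zy; rewrite ltr_distl -/Lam -/a => /andP[h1 h2].
move: zi; rewrite ler_norml => /andP[].
case: s {zmid zy} => /=; rewrite ?expr1 ?expr0 => h3 h4.
  have ez : `|z ord0 i| = - z ord0 i by rewrite ler0_norm//; lra.
  rewrite ez in lowb up rz; clear -h1 h2 h3 h4 lowb up rz p2 p0 t1.
  by apply/andP; split; lra.
have ez : `|z ord0 i| = z ord0 i by rewrite ger0_norm//; lra.
rewrite ez in lowb up rz; clear -h1 h2 h3 h4 lowb up rz p2 p0 t1.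
  by apply/andP; split; lra.
Qed.

Lemma slab_threshold_gt0 M r0 eta delta rho t :
  admissible_radius M r0 eta delta rho -> 1 <= t ->
  0 < M * (3 * d.+1%:R * cover_ratio eta * t `^ delta).
Proof.
move=> [M1 _ /cover_ratioP[_ Lam4] _ _] t1.
apply: mulr_gt0; first lra.
apply: mulr_gt0; last by apply: powR_gt0; lra.
by apply: mulr_gt0; [apply: mulr_gt0|lra].
Qed.

(** Here only the power bound on [rho] is used: a middle point is within an eighth of a side from
    the center and its ball has radius at most a quarter of a side, which together stay below one
    half. *)
Lemma subslab_inner M r0 eta delta rho t i s (lo hi : 'I_d -> R) :
  admissible_radius M r0 eta delta rho -> 1 <= t ->
  box lo hi `<=` box (slab_lo eta t i s) (slab_hi eta t i s) ->
  (forall j, 4 * (M * (3 * d.+1%:R * cover_ratio eta * t `^ delta)) <= hi j - lo j) ->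
  inner_balls (cover_kappa eta) rho lo hi.
Proof.
move=> adm t1 sub side z zmid y zy.
have [M1 r01 eta01 delta01 [rho0 rhoM rhoeta]] := adm.
have [k0 k8 kE] := cover_kappaP eta01.
set k := cover_kappa eta in k0 k8 zmid.
set thr := M * _ in side.
have thr0 : 0 < thr by exact: slab_threshold_gt0 adm t1.
have zk j : `|z ord0 j - (lo j + hi j) / 2| <= (hi j - lo j) / 8.
  rewrite (le_trans (zmid j))//.
  have : 0 <= hi j - lo j by rewrite (le_trans _ (side j))// mulr_ge0// ltW.
  by move: (hi j - lo j) => u; nra.
have zbox : box lo hi z.
  move=> j; have := zk j; rewrite ler_distl => /andP[h1 h2].
  by have sj := side j; apply/andP; split; lra.
have rz : rho z <= thr by apply: slab_rho_le adm t1 (sub _ zbox).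
move=> j; have := eball_coord j zy; rewrite ltr_distl => /andP[h1 h2].
have := zk j; rewrite ler_distl => /andP[h3 h4].
by have sj := side j; apply/andP; split; lra.
Qed.

(** All sides of the slab lie between [a = (L - 1) t] and [8 a], a ratio preserved by simultaneous
    bisection of all coordinates; it therefore suffices to control the shortest side. *)
Lemma slab_dominates M r0 eta delta rho (f h : lebesgue_space R d -> \bar R) t i s :
  admissible_radius M r0 eta delta rho -> r0 <= t ->
  measurable_fun setT f -> measurable_fun setT h ->
  (forall x, 0 <= f x)%E -> (forall x, 0 <= h x)%E ->
  (forall lo hi, good_box M r0 eta delta rho lo hi -> dominates h f (box lo hi)) ->
  dominates h f (box (slab_lo eta t i s) (slab_hi eta t i s)).
Proof.
move=> adm r0t mf mh f0 h0 good.
have [M1 r01 eta01 delta01 _] := adm.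
have t1 : 1 <= t by exact: le_trans r0t.
have [LamE Lam4] := cover_ratioP eta01.
have thr0 := slab_threshold_gt0 adm t1.
set Lam := cover_ratio eta in LamE Lam4.
set thr := M * _ in thr0.
have th0 : 0 <= t `^ delta by exact: powR_ge0.
have Lt : 4 * t <= Lam * t by rewrite ler_wpM2r//; lra.
pose a := (Lam - 1) * t.
have a0 : 0 < a by apply: mulr_gt0; lra.
have sidei : slab_hi eta t i s i - slab_lo eta t i s i = a.
  by rewrite /slab_hi /slab_lo eqxx /a -/Lam; lra.
have sidej j : j != i -> slab_hi eta t i s j - slab_lo eta t i s j = 4 * Lam * t.
  by move=> ji; rewrite /slab_hi /slab_lo (negbTE ji) -/Lam; lra.
have side_le j : slab_hi eta t i s j - slab_lo eta t i s j <= 8 * a.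
  by have [->|/sidej ->] := eqVneq j i; rewrite ?sidei /a; lra.
have side_ge j : a <= slab_hi eta t i s j - slab_lo eta t i s j.
  by have [->|/sidej ->] := eqVneq j i; rewrite ?sidei /a; lra.
have lohi j : slab_lo eta t i s j < slab_hi eta t i s j.
  by rewrite -subr_gt0 (lt_le_trans a0).
have scale l x : 0 <= l -> l <= 64 * thr ->
    box (slab_lo eta t i s) (slab_hi eta t i s) x ->
    l ^+ 2 <= cover_scale M r0 eta ^+ 2 * weight delta x.
  move=> l0 lthr xS.
  have xw : (t `^ delta) ^+ 2 <= weight delta x.
    by apply: slab_weight_ge xS; [case/andP: delta01|lra].
  apply: (@le_trans _ _ (cover_scale M r0 eta ^+ 2 * (t `^ delta) ^+ 2)); last first.
    by rewrite ler_wpM2l ?sqr_ge0.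
  have u0 : 0 <= 192 * M * d.+1%:R * Lam.
    by clear -M1 Lam4; apply: mulr_ge0; [apply: mulr_ge0 => //|]; lra.
  have v0 : 0 <= 16 * M * r0 by apply: mulr_ge0; lra.
  have thrE : 64 * thr = 192 * M * d.+1%:R * Lam * t `^ delta by rewrite /thr /Lam; ring.
  rewrite /cover_scale -/Lam -exprMn; move: (192 * M * _ * _) u0 thrE => u u0 thrE.
  move: (16 * M * r0) v0 => v v0.
  apply: lerXn2r; rewrite ?nnegrE//; first by apply: mulr_ge0 => //; exact: addr_ge0.
  rewrite (le_trans lthr)// thrE; apply: ler_wpM2r => //; lra.
(* A slab that is already short is good as a whole, by [slab_inner]. A longer one is bisected until
   its shortest side lies between [4 * thr] and [8 * thr]; the longest is then below [64 * thr]. *)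
have [athr|thra] := ltP a (4 * thr).
  apply: good; split; [exact: lohi|exact: (@slab_inner M r0 eta delta rho t i s adm r0t)|].
  exists (8 * a); split => //; first by rewrite mulr_ge0// ltW.
  by move=> x; apply: scale; [rewrite mulr_ge0// ltW|lra].
have thr40 : 0 < 4 * thr by rewrite mulr_gt0.
have [n /andP[n1 n2]] := halving_bracket thr40 thra.
apply: (@dominates_bisect _ _ f h mf mh f0 h0 n); first by move=> j; exact/ltW/lohi.
move=> lo hi sub.
have p0 : 0 < 2 ^+ n :> R by rewrite exprn_gt0.
have subset : box lo hi `<=` box (slab_lo eta t i s) (slab_hi eta t i s).
  move=> x xP j; have [h1 h2 _] := sub j; have /andP[h3 h4] := xP j.
  by rewrite (le_trans h1 h3) (lt_le_trans h4 h2).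
have ge j : 4 * thr <= hi j - lo j.
  by have [_ _ ->] := sub j; rewrite (le_trans n1)// ler_wpM2r// invr_ge0 ltW.
apply: good; split.
- by move=> j; rewrite -subr_gt0 (lt_le_trans _ (ge j))// mulr_gt0.
- exact: subslab_inner adm t1 subset ge.
exists (8 * (a / 2 ^+ n)); split.
- by rewrite mulr_ge0// divr_ge0// ltW.
- move=> j; have [_ _ ->] := sub j.
  by rewrite mulrA ler_wpM2r ?invr_ge0// ltW.
- move=> x /subset; apply: scale; last lra.
  by rewrite mulr_ge0// divr_ge0// ltW.
Qed.

(** One family for each signed coordinate direction, plus the base cube: [2 d + 1] sets whatever the
    scale. The slabs of a family are disjoint, so only overlaps between families count in the
    multiplicity. *)
Definition slab_union M r0 eta (c : option ('I_d * bool)) : set 'rV[R]_d :=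
  if c is Some (i, s) then
    \bigcup_k box (slab_lo eta (4 * M * r0 * cover_ratio eta ^+ k) i s)
                  (slab_hi eta (4 * M * r0 * cover_ratio eta ^+ k) i s)
  else box (fun _ => - (8 * M * r0)) (fun _ => 8 * M * r0).

(** Outside the base cube a coordinate of largest modulus selects the direction, and the geometric
    bracket selects [t]. The other coordinates are then at most [L t] in modulus, and the width
    [2 L t] leaves room for the open ends. *)
Lemma slab_union_cover M r0 eta (x : 'rV[R]_d) : 1 <= M -> 1 <= r0 -> 0 < eta < 1 ->
  exists c, slab_union M r0 eta c x.
Proof.
move=> M1 r01 /cover_ratioP[_ Lam4].
have b0 : 0 < 4 * M * r0 by apply: mulr_gt0; lra.
have Lam1 : 1 < cover_ratio eta by lra.
have [small|/existsNP[j0 /negP]] :=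
    pselect (forall j, `|x ord0 j| < 8 * M * r0).
  by exists None => j; have := small j; rewrite ltr_norml => /andP[/ltW -> ->].
rewrite -leNgt => big.
case: (@arg_maxP _ _ _ j0 xpredT (fun j => `|x ord0 j|)) => // i _ imax.
have xi : 8 * M * r0 <= `|x ord0 i| by exact: le_trans big (imax _ _).
have xj j : `|x ord0 j| <= `|x ord0 i| by exact: imax.
pose T0 := 4 * M * r0.
have T0x : T0 < `|x ord0 i| by rewrite /T0; lra.
have LamS k : cover_ratio eta * (T0 * cover_ratio eta ^+ k)
    = T0 * cover_ratio eta ^+ k.+1 by rewrite exprS mulrCA.
have T0k k : 0 < T0 * cover_ratio eta ^+ k.+1 by rewrite mulr_gt0 ?exprn_gt0//; lra.
have [x0|x0] := leP 0 (x ord0 i).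
  rewrite ger0_norm// in xj T0x.
  have [k /andP[k1 k2]] := geometric_bracket b0 Lam1 (ltW T0x).
  exists (Some (i, false)), k => //; apply/slab_coordP; rewrite -/T0 -mulrA LamS.
  split=> [|j _]; first by apply/andP.
  have := xj j; rewrite ler_norml => /andP[h1 h2].
  move: k2 (T0k k); rewrite -/T0; move: (T0 * _) => u k2 u0.
by clear -h1 h2 k2 u0; apply/andP; split; lra.
rewrite ltr0_norm// in xj T0x.
have [k /andP[k1 k2]] := geometric_bracketl b0 Lam1 T0x.
exists (Some (i, true)), k => //; apply/slab_coordP; rewrite -/T0 -mulrA LamS.
split=> [|j _]; first by apply/andP.
have := xj j; rewrite ler_norml => /andP[h1 h2].
move: k2 (T0k k); rewrite -/T0; move: (T0 * _) => u k2 u0.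
by clear -h1 h2 k2 u0; apply/andP; split; lra.
Qed.

Lemma slab_disjoint b eta i s : 0 < b -> 0 < eta < 1 ->
  trivIset setT (fun k => box (slab_lo eta (b * cover_ratio eta ^+ k) i s)
                              (slab_hi eta (b * cover_ratio eta ^+ k) i s)).
Proof.
move=> b0 /cover_ratioP[_ Lam4]; apply: ltn_trivIset => n m mn.
apply/seteqP; split => // x [/slab_coordP[+ _] /slab_coordP[+ _]].
have LamS k : cover_ratio eta * (b * cover_ratio eta ^+ k) = b * cover_ratio eta ^+ k.+1.
  by rewrite exprS mulrCA.
rewrite !LamS => hm hn.
have le1 : b * cover_ratio eta ^+ m.+1 <= b * cover_ratio eta ^+ n.
  by rewrite ler_pM2l// ler_weXn2l//; lra.
by case: s hm hn => /andP[h1 h2] /andP[h3 h4]; lra.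
Qed.

Lemma cover_estimate M r0 eta delta rho (f h : lebesgue_space R d -> \bar R) :
  admissible_radius M r0 eta delta rho ->
  measurable_fun setT f -> measurable_fun setT h ->
  (forall x, 0 <= f x)%E -> (forall x, 0 <= h x)%E ->
  (forall lo hi, good_box M r0 eta delta rho lo hi -> dominates h f (box lo hi)) ->
  (\int[lr d]_x f x <= (#|{: option ('I_d * bool)}|)%:R%:E * \int[lr d]_x h x)%E.
Proof.
move=> adm mf mh f0 h0 good; have [M1 r01 eta01 _ _] := adm.
have [_ Lam4] := cover_ratioP eta01.
have b0 : 0 < 4 * M * r0 by apply: mulr_gt0; lra.
have mbox lo hi : measurable (box lo hi : set (lebesgue_space R d)).
  exact: (lebesgue_row_measurable (measurable_box lo hi)).
rewrite cardE; apply: (integral_le_cover mf mh f0 h0 (F := slab_union M r0 eta)).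
- by case=> [[i s]|] /=; [apply: bigcupT_measurable => k|]; exact: mbox.
- case=> [[i s]|] /=; last exact/good/base_good.
  apply: dominates_bigcup => // [|k]; first exact: slab_disjoint.
  apply: (@slab_dominates M r0 eta delta rho f h _ i s adm _ mf mh f0 h0 good).
  have : 1 <= cover_ratio eta ^+ k by apply: exprn_ege1; lra.
  move: (cover_ratio eta ^+ k) => q q1; have : r0 <= 4 * M * r0 by nra.
  by move: (4 * M * r0) b0 => b b0 rb; nra.
- move=> x; have [c cx] := @slab_union_cover M r0 eta x M1 r01 eta01.
  by exists c => //; rewrite mem_enum.
Qed.

End cover.

(** * The estimate on the whole space *)

Section global_estimate.
Context {R : realType}.
Local Notation lr := (lebesgue_row R).
Local Open Scope ereal_scope.

Lemma measurable_weight d (delta : R) :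
  measurable_fun [set: 'rV[R]_d] (@weight R d delta).
Proof.
have -> : @weight R d delta =
    (fun y => y `^ delta)%R \o (fun x : 'rV[R]_d => 1 + \sum_(i < d) x ord0 i ^+ 2)%R.
  by apply/funext => x; rewrite /weight enorm2.
apply: measurableT_comp; first exact: measurable_powR.
apply: measurable_funD => //; apply: measurable_sum => i; apply: measurable_funX.
exact: measurable_row_coord.
Qed.

Lemma scaled_integral_le d (T : measurableType d) (m : {measure set T -> \bar R})
    (D : set T) (a b : R) (p q : T -> \bar R) :
  (0 <= a)%R -> (0 <= b)%R -> measurable D ->
  measurable_fun setT p -> measurable_fun setT q ->
  (forall x, 0 <= p x) -> (forall x, 0 <= q x) ->
  (forall x, D x -> a%:E * p x <= b%:E * q x) ->
  a%:E * \int[m]_(x in D) p x <= b%:E * \int[m]_(x in D) q x.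
Proof.
move=> a0 b0 mD mp mq p0 q0 pq.
have mpD := measurable_funTS (D := D) mp; have mqD := measurable_funTS (D := D) mq.
rewrite -!ge0_integralZl_EFin//; apply: ge0_le_integral => //.
- by move=> x _; rewrite mule_ge0.
- exact: measurable_funeM.
- exact: measurable_funeM.
Qed.

(* Over a good box the side length is absorbed by the weight: [l^2 <= B^2 W]. *)
Lemma global_Remez d (gamma M r0 eta : R) :
  (0 < gamma <= 1)%R -> (1 <= M)%R -> (1 <= r0)%R -> (0 < eta < 1)%R ->
  exists C B : R, [/\ (1 <= C)%R, (1 <= B)%R &
  forall N (g : 'rV[R]_d -> R) omega delta rho,
  pure_derivable g -> pure_measurable g -> measurable_fun [set: 'rV[R]_d] g ->
  admissible_radius M r0 eta delta rho -> thick_on gamma rho omega ->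
  \int[lr d]_x (g x ^+ 2)%:E <= (C ^+ N.+1)%:E *
    (\int[lr d]_(x in omega) (g x ^+ 2)%:E
     + ((B ^+ N.+1 / N.+1`!%:R) ^+ 2)%:E * \sum_(i < d)
        (\int[lr d]_x (weight delta x ^+ N.+1 * iter N.+1 (partial i) g x ^+ 2)%:E
         + (B ^+ 2)%:E * \int[lr d]_x
             (weight delta x ^+ N.+2 * iter N.+2 (partial i) g x ^+ 2)%:E))].
Proof.
move=> g01 M1 r01 eta01.
have [k0 k8 _] := cover_kappaP d eta01.
have k01 : (0 < cover_kappa d eta <= 1)%R by rewrite k0/=; lra.
have [C C1 CP] := @local_Remez R d gamma _ g01 k01.
pose n := #|{: option ('I_d * bool)}|.
have n1 : (1 <= n%:R :> R)%R.
  by rewrite ler1n; apply/card_gt0P; exists None.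
pose B := cover_scale d M r0 eta.
have [_ Lam4] := cover_ratioP eta01.
have B1 : (1 <= B)%R.
  rewrite /B /cover_scale.
  have : (0 <= 192 * M * d.+1%:R * cover_ratio eta)%R.
    by apply: mulr_ge0; [apply: mulr_ge0 => //|]; lra.
  by move: (192 * M * _ * _)%R => u u0; nra.
exists (n%:R * C)%R, B; split => //; first by rewrite mulr_ege1.
move=> N g omega delta rho dg mg mg0 adm tho.
have [_ mo _] := tho.
pose W := @weight R d delta.
have W0 x : (0 <= W x)%R by exact: powR_ge0.
pose f x := (g x ^+ 2)%:E : \bar R.
pose w k i x := (W x ^+ k * iter k (partial i) g x ^+ 2)%:E : \bar R.
pose p k i x := (iter k (partial i) g x ^+ 2)%:E : \bar R.
have f0 x : 0 <= f x by rewrite lee_fin sqr_ge0.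
have w0 k i x : 0 <= w k i x.
  by rewrite lee_fin; apply: mulr_ge0; [exact: exprn_ge0|exact: sqr_ge0].
have p0 k i x : 0 <= p k i x by rewrite lee_fin sqr_ge0.
have mf : measurable_fun [set: lebesgue_space R d] f.
  by apply: measurable_fun_lebesgue; apply/measurable_EFinP; exact: measurable_funX.
have mp k i : measurable_fun [set: lebesgue_space R d] (p k i).
  apply: measurable_fun_lebesgue; apply/measurable_EFinP; apply: measurable_funX.
  exact: mg.
have mw k i : measurable_fun [set: lebesgue_space R d] (w k i).
  apply: measurable_fun_lebesgue; apply/measurable_EFinP; apply: measurable_funM.
    by apply: measurable_funX; exact: measurable_weight.
  by apply: measurable_funX; exact: mg.
pose E1 := ((B ^+ N.+1 / N.+1`!%:R) ^+ 2)%R.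
have E10 : (0 <= E1)%R by exact: sqr_ge0.
have B20 : (0 <= B ^+ 2)%R by exact: sqr_ge0.
pose v i x := w N.+1 i x + (B ^+ 2)%:E * w N.+2 i x.
have mv i : measurable_fun [set: lebesgue_space R d] (v i).
  exact: (measurable_addZ _ (mw N.+1 i) (mw N.+2 i)).
have v0 i x : 0 <= v i x by exact: (ge0_addZ B20 (w0 N.+1 i) (w0 N.+2 i)).
pose V x := \sum_(i < d) v i x.
have mV : measurable_fun [set: lebesgue_space R d] V by exact: emeasurable_sum.
have V0 x : 0 <= V x by exact: sume_ge0.
pose fo : lebesgue_space R d -> \bar R := f \_ omega.
have mfo : measurable_fun [set: lebesgue_space R d] fo.
  by apply/(measurable_restrictT _ _).1 => //; exact: measurable_funTS.
have fo0 x : 0 <= fo x by exact: erestrict_ge0.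
pose H x := fo x + E1%:E * V x.
have mH : measurable_fun [set: lebesgue_space R d] H by exact: (measurable_addZ _ mfo mV).
have H0 x : 0 <= H x by exact: (ge0_addZ E10 fo0 V0).
(* The side lengths of the local estimates have become pointwise weights, so this one function
   dominates [f] on every good box, whatever its size. *)
pose h x := (C ^+ N.+1)%:E * H x.
have CN0 : (0 <= C ^+ N.+1)%R by rewrite exprn_ge0// (le_trans _ C1).
have mh : measurable_fun [set: lebesgue_space R d] h by exact: measurable_funeM.
have h0 x : 0 <= h x by rewrite mule_ge0// lee_fin.
have intH (D : set (lebesgue_space R d)) : measurable D ->
    \int[lr d]_(x in D) h x = (C ^+ N.+1)%:E * (\int[lr d]_(x in D `&` omega) f x
      + E1%:E * \sum_(i < d) (\int[lr d]_(x in D) w N.+1 i x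
                              + (B ^+ 2)%:E * \int[lr d]_(x in D) w N.+2 i x)).
  move=> mD; rewrite ge0_integralZl_EFin//; last exact: measurable_funTS.
  rewrite (ge0_integral_addZ _ E10 mD mfo mV fo0 V0) -integral_mkcondr.
  congr (_ * (_ + _ * _)).
  rewrite ge0_integral_sum//; last by move=> i; exact: measurable_funTS.
  apply: eq_bigr => i _.
  exact: (ge0_integral_addZ _ B20 mD (mw N.+1 i) (mw N.+2 i) (w0 _ i) (w0 _ i)).
have := @cover_estimate R d M r0 eta delta rho f h adm mf mh f0 h0.
have good lo hi : good_box M r0 eta delta rho lo hi -> dominates h f (box lo hi).
  move=> [lohi inn [l [l0 hil lW]]].
  have mbox : measurable (box lo hi : set (lebesgue_space R d)).
    exact: (lebesgue_row_measurable (measurable_box lo hi)).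
  rewrite /dominates (intH _ mbox).
  have := CP N g rho omega lo hi l dg mg mg0 tho lohi hil inn.
  move=> /le_trans; apply; apply: lee_wpmul2l; first by rewrite lee_fin.
  apply: leeD => //.
  have T0 : (0 <= (l ^+ N.+1 / N.+1`!%:R) ^+ 2)%R by exact: sqr_ge0.
  have Tw k x : box lo hi x -> ((l ^+ 2) ^+ k <= (B ^+ 2) ^+ k * W x ^+ k)%R.
    move=> bx; rewrite -exprMn; apply: lerXn2r; rewrite ?nnegrE ?sqr_ge0//.
      by rewrite mulr_ge0.
    exact: lW.
  have sqE (u : R) : ((u ^+ N.+1 / N.+1`!%:R) ^+ 2 = (u ^+ 2) ^+ N.+1 * (N.+1`!%:R ^- 2))%R.
    by rewrite exprMn exprVn exprAC.
  have fi0 : (0 <= N.+1`!%:R ^- 2 :> R)%R by rewrite invr_ge0 exprn_ge0.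
  have P0 k i : 0 <= \int[lr d]_(x in box lo hi) p k i x by exact: integral_ge0.
  have Q0 k i : 0 <= \int[lr d]_(x in box lo hi) w k i x by exact: integral_ge0.
  have l20 : 0 <= (l ^+ 2)%:E by rewrite lee_fin sqr_ge0.
  rewrite !ge0_sume_distrr; last 2 first.
  - by move=> i _; exact: adde_ge0 (Q0 _ _) (mule_ge0 _ (Q0 _ _)).
  - by move=> i _; exact: adde_ge0 (P0 _ _) (mule_ge0 l20 (P0 _ _)).
  apply: lee_sum => i _.
  rewrite (ge0_muleDr _ (P0 N.+1 i) (mule_ge0 l20 (P0 N.+2 i))).
  rewrite (ge0_muleDr _ (Q0 N.+1 i) (mule_ge0 _ (Q0 N.+2 i)))//.
  rewrite !muleA -!EFinM; apply: leeD.
    have := @scaled_integral_le _ _ (lr d) _ _ _ _ _ T0 E10 mbox (mp N.+1 i) (mw N.+1 i) (p0 N.+1 i) (w0 N.+1 i).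
    apply => x bx.
    rewrite /p /w -!EFinM lee_fin [leRHS]mulrA; apply: ler_wpM2r; first exact: sqr_ge0.
    by rewrite /E1 !sqE [leRHS]mulrAC; apply: ler_wpM2r => //; exact: Tw.
  have T20 : (0 <= (l ^+ N.+1 / N.+1`!%:R) ^+ 2 * l ^+ 2)%R by rewrite mulr_ge0 ?sqr_ge0.
  have E20 : (0 <= E1 * B ^+ 2)%R by rewrite mulr_ge0.
  have := @scaled_integral_le _ _ (lr d) _ _ _ _ _ T20 E20 mbox (mp N.+2 i) (mw N.+2 i) (p0 N.+2 i) (w0 N.+2 i).
  apply => x bx.
  rewrite /p /w -!EFinM lee_fin [leRHS]mulrA; apply: ler_wpM2r; first exact: sqr_ge0.
  rewrite /E1 !sqE mulrAC -exprSr (mulrAC _ _ (B ^+ 2)%R) -exprSr [leRHS]mulrAC.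
  by apply: ler_wpM2r => //; exact: Tw.
move=> /(_ good) /le_trans; apply.
rewrite intH// setTI muleA -EFinM -/n.
apply: lee_wpmul2r.
  rewrite adde_ge0 ?integral_ge0// mule_ge0 ?lee_fin// sume_ge0// => i _.
  by rewrite adde_ge0 ?mule_ge0 ?integral_ge0.
rewrite lee_fin exprMn ler_wpM2r// exprS ler_peMr//; last exact: exprn_ege1.
Qed.

End global_estimate.

(** * Choice of the order of differentiation *)

Section choice_of_order.
Context {R : realType}.
Implicit Types (C B D nu mu delta s eps : R).

Lemma natr_le_expR n : n%:R <= expR 1 ^+ n :> R.
Proof.
by rewrite -expRM_natl mulr1; apply: le_trans (expR_ge1Dx _); rewrite lerDr.
Qed.

Lemma one_le_expR (a : R) : 0 <= a -> 1 <= expR a.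
Proof. by move=> a0; rewrite -expR0 ler_expR. Qed.

Lemma powR_fact_ge1 n (a : R) : 0 <= a -> 1 <= n`!%:R `^ a.
Proof. by move=> a0; apply: powR_ge1 => //; rewrite ler1n fact_gt0. Qed.

Lemma exprn_self_le_fact n : n%:R ^+ n <= expR 1 ^+ n * n`!%:R :> R.
Proof.
have f0 : 0 < n`!%:R :> R by rewrite ltr0n fact_gt0.
case: n f0 => [|n] f0; first by rewrite !expr0 mul1r fact0.
have := @exprn_fact_le R n.
rewrite factS natrM in f0 *; rewrite ler_pdivrMr ?ltr0n ?fact_gt0// => h.
by rewrite exprS (mulrCA (expR 1 ^+ _)) ler_wpM2l.
Qed.

(** [n] is the least integer above [delta k]. If [n > 0], then [n - 1 <= delta k] by minimality, so
    [(n - 1)! <= k^(delta k) <= (e^k k!)^delta], and the missing factor [n] is at most [e^k]. *)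
Lemma fact_ceil_le delta k : 0 <= delta <= 1 ->
  exists n, [/\ (n <= k)%N, delta * k%:R <= n%:R &
    n`!%:R <= expR 2 ^+ k * k`!%:R `^ delta].
Proof.
move=> /andP[d0 d1].
have Pk : delta * k%:R <= k%:R by rewrite ler_piMl.
have ex : exists n, delta * k%:R <= n%:R by exists k.
case: (ex_minnP ex) => n Pn nmin; exists n.
have nk : (n <= k)%N by exact: nmin.
split => //.
have e1 : 1 <= expR 1 :> R by rewrite one_le_expR.
have fk1 : 1 <= k`!%:R `^ delta by exact: powR_fact_ge1.
case: n => [|n] in Pn nmin nk *.
  by rewrite fact0 mulr_ege1// exprn_ege1// one_le_expR.
have nd : n%:R <= delta * k%:R.
  by rewrite leNgt; apply/negP => /ltW /nmin; rewrite ltnn.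
have k1 : 1 <= k%:R :> R by rewrite ler1n (leq_ltn_trans _ nk).
rewrite factS natrM (_ : expR 2 = expR 1 * expR 1); last by rewrite -expRD.
rewrite exprMn -mulrA; apply: ler_pM => //.
  apply: le_trans (natr_le_expR _); rewrite ler_nat //.
have fn : n`!%:R <= n%:R ^+ n :> R.
  rewrite -natrX ler_nat; elim: (n) => // m IH.
  by rewrite factS expnS leq_mul2l (leq_trans IH)//; case: (m) => // k'; rewrite leq_exp2r.
apply: (le_trans fn).
apply: (@le_trans _ _ (k%:R `^ (delta * k%:R))).
  rewrite -powR_mulrn//; apply: (@le_trans _ _ (k%:R `^ n%:R)).
    by apply: ge0_ler_powR; rewrite ?nnegrE// ler_nat ltnW.
  exact: ler_powR.
rewrite mulrC powRrM powR_mulrn//.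
apply: (@le_trans _ _ ((expR 1 ^+ k * k`!%:R) `^ delta)).
  by apply: ge0_ler_powR; rewrite ?nnegrE ?exprn_ge0 ?mulr_ge0 ?exprn_ge0 ?expR_ge0 ?exprn_self_le_fact.
rewrite powRM ?exprn_ge0 ?expR_ge0//; apply: ler_pM; rewrite ?powR_ge0//.
by apply: powR_le_self; [rewrite d0|exact: exprn_ege1].
Qed.

(** The square of the assumed bound for weight exponent [n] and derivatives of order [k], with [D_1]
    left out. *)
Definition growth D nu mu (n k : nat) : R :=
  (D ^+ (n + k) * n`!%:R `^ nu * k`!%:R `^ mu) ^+ 2.

(** [n <= k] turns [D^(n + k)] into [D^(2 k)], and the bound on [n!] turns [n!^nu] into
    [k!^(delta nu)], which joins [k!^mu] to form [k!^s]. From here on [nu], [mu] and [delta] matter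
    for the factorials only through [s]. *)
Lemma growth_le D nu mu delta s n k :
  1 <= D -> 0 <= nu -> 0 <= mu -> s = delta * nu + mu -> (n <= k)%N ->
  n`!%:R <= expR 2 ^+ k * k`!%:R `^ delta ->
  growth D nu mu n k <= (D ^+ 4 * expR (4 * nu)) ^+ k * (k`!%:R `^ s) ^+ 2.
Proof.
move=> D1 nu0 mu0 -> nk nf.
have f0 : (0 < k`!%:R :> R) by rewrite ltr0n fact_gt0.
have -> : (D ^+ 4 * expR (4 * nu)) ^+ k * (k`!%:R `^ (delta * nu + mu)) ^+ 2
   = (D ^+ (k + k) * (expR (2 * nu) ^+ k * k`!%:R `^ (delta * nu)) * k`!%:R `^ mu) ^+ 2.
  rewrite powRD; last by rewrite (gt_eqF f0) implybT.
  rewrite (_ : expR (4 * nu) = expR (2 * nu) ^+ 2); last first.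
    by rewrite -expRM_natl; congr expR; ring.
  by rewrite exprMn -exprM mulnC exprM (exprAC _ 2 k) exprD; ring.
have D0 : 0 <= D by exact: le_trans D1.
rewrite /growth; apply: lerXn2r; rewrite ?nnegrE ?mulr_ge0 ?powR_ge0 ?exprn_ge0 ?expR_ge0//.
apply: ler_wpM2r; first exact: powR_ge0.
apply: ler_pM; rewrite ?exprn_ge0 ?powR_ge0//.
  by rewrite ler_weXn2l// leq_add2r.
apply: (@le_trans _ _ ((expR 2 ^+ k * k`!%:R `^ delta) `^ nu)).
  by apply: ge0_ler_powR; rewrite ?nnegrE ?mulr_ge0 ?exprn_ge0 ?expR_ge0 ?powR_ge0.
rewrite powRM ?exprn_ge0 ?expR_ge0 ?powR_ge0// -powRrM.
rewrite -!expRM_natl -expRM -mulrA; exact: lexx.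
Qed.

Lemma powR_fact_ge m (a : R) : 0 <= a <= 1 ->
  (m%:R `^ a) ^+ m <= expR 1 ^+ m * m`!%:R `^ a.
Proof.
move=> /andP[a0 a1]; have e0 : 0 <= expR 1 ^+ m :> R by rewrite exprn_ge0 ?expR_ge0.
rewrite -powR_mulrn ?powR_ge0// -powRrM mulrC powRrM powR_mulrn//.
apply: (@le_trans _ _ ((expR 1 ^+ m * m`!%:R) `^ a)).
  by apply: ge0_ler_powR; rewrite ?nnegrE ?mulr_ge0 ?exprn_ge0// exprn_self_le_fact.
rewrite powRM//; apply: ler_wpM2r; first exact: powR_ge0.
by apply: powR_le_self; [rewrite a0|rewrite exprn_ege1// one_le_expR].
Qed.

(** Passing from order [m + 1] to [m] in the factorials costs [(m + 1)^(2 s) <= e^(2 m)]; the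
    remaining additional factor [D^4 expR (4 nu)] does not depend on [m]. Both orders thus share one
    bound. *)
Lemma growth_sum_le (B D nu mu delta s : R) n1 n2 m :
  1 <= B -> 1 <= D -> 0 <= nu -> 0 <= mu -> 0 <= delta ->
  s = delta * nu + mu -> s <= 1 ->
  (n1 <= m)%N -> n1`!%:R <= expR 2 ^+ m * m`!%:R `^ delta ->
  (n2 <= m.+1)%N -> n2`!%:R <= expR 2 ^+ m.+1 * m.+1`!%:R `^ delta ->
  growth D nu mu n1 m + B ^+ 2 * growth D nu mu n2 m.+1 <=
  2 * B ^+ 2 * expR (4 * nu) * D ^+ 4 *
    (D ^+ 4 * expR (4 * nu) * expR 2) ^+ m * (m`!%:R `^ s) ^+ 2.
Proof.
move=> B1 D1 nu0 mu0 d0 sE s1 n1m n1f n2m n2f.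
have s0 : 0 <= s by rewrite sE addr_ge0// mulr_ge0.
have h1 := growth_le D1 nu0 mu0 sE n1m n1f.
have h2 := growth_le D1 nu0 mu0 sE n2m n2f.
have E1 : 1 <= expR (4 * nu) by rewrite one_le_expR// mulr_ge0.
have D41 : 1 <= D ^+ 4 by exact: exprn_ege1.
have B21 : 1 <= B ^+ 2 by exact: exprn_ege1.
have h3 : (m.+1`!%:R `^ s) ^+ 2 <= expR 2 ^+ m * (m`!%:R `^ s) ^+ 2.
  rewrite factS natrM powRM// exprMn; apply: ler_wpM2r; first exact: sqr_ge0.
  rewrite (_ : expR 2 = expR 1 ^+ 2); last by rewrite -expRM_natl mulr1.
  rewrite exprAC; apply: lerXn2r; rewrite ?nnegrE ?powR_ge0 ?exprn_ge0 ?expR_ge0//.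
  apply: (@le_trans _ _ m.+1%:R).
    by apply: powR_le_self; [rewrite s0|rewrite ler1n].
  rewrite -expRM_natl mulr1 -natr1 addrC; exact: expR_ge1Dx.
have e1 : 1 <= expR 2 ^+ m :> R by rewrite exprn_ege1// one_le_expR.
move: h1 h2 h3 E1 D41 B21 e1.
set Y := (m`!%:R `^ s) ^+ 2; set Z := (m.+1`!%:R `^ s) ^+ 2.
have Y0 : 0 <= Y by exact: sqr_ge0.
have Z0 : 0 <= Z by exact: sqr_ge0.
have p0 : 0 <= (D ^+ 4) ^+ m by rewrite !exprn_ge0// (le_trans _ D1).
have q0 : 0 <= expR (4 * nu) ^+ m by rewrite exprn_ge0// expR_ge0.
move: Y0 Z0 p0 q0.
move: (growth _ _ _ _ _) => g1; move: (growth _ _ _ _ _) => g2.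
move: (expR (4 * nu)) (D ^+ 4) => E D4; rewrite !exprMn [E ^+ m.+1]exprS [D4 ^+ m.+1]exprS expr2.
move: (expR 2 ^+ m) (D4 ^+ m) (E ^+ m) => e p q Y0 Z0 p0 q0 h1 h2 h3 E1 D41 B21 e1.
clear - Y0 Z0 p0 q0 h1 h2 h3 E1 D41 B21 e1.
have pq0 : 0 <= p * q by exact: mulr_ge0.
have a1 : 1 <= B * B * E * D4 by apply: mulr_ege1 => //; exact: mulr_ege1.
have h1' : g1 <= B * B * E * D4 * (p * q * e) * Y.
  apply: (le_trans h1); apply: ler_wpM2r => //.
  rewrite -[leLHS]mul1r; apply: ler_pM => //; rewrite ler_peMr//.
have h2' : B * B * g2 <= B * B * E * D4 * (p * q * e) * Y.
  have -> : B * B * E * D4 * (p * q * e) * Y = B * B * (D4 * E * p * q * (e * Y)) by ring.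
  apply: ler_wpM2l; first by apply: le_trans B21.
  apply: (le_trans h2).
  have -> : D4 * p * (E * q) * Z = D4 * E * p * q * Z by ring.
  apply: ler_wpM2l => //; rewrite -mulrA; apply: mulr_ge0 => //.
  by rewrite mulr_ge0// (le_trans ler01).
have -> : 2 * (B * B) * E * D4 * (p * q * e) * Y =
  B * B * E * D4 * (p * q * e) * Y + B * B * E * D4 * (p * q * e) * Y by ring.
exact: lerD.
Qed.

Lemma order_exponent_le (Q X L c : R) : 0 <= Q -> 1 <= X -> 0 <= L -> 0 <= c ->
  (Q * X + L + 1) * c <= ((Q + 2) * c + 1) * (1 + L + X).
Proof.
move=> Q0 X1 L0 c0; rewrite -subr_ge0.
have -> : ((Q + 2) * c + 1) * (1 + L + X) - (Q * X + L + 1) * c =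
  c * (Q + Q * L + 1 + L + 2 * X) + (1 + L + X) by ring.
have X0 : 0 <= X by exact: le_trans X1.
by apply: addr_ge0; [apply: mulr_ge0 => //|]; rewrite !addr_ge0// mulr_ge0.
Qed.

(** With [m = N + 1] and [q = m^(1 - s)], the bound [m^m <= e^m m!] makes [m!^(2 s - 2)] at most
    [(e / q)^(2 m)], and the error becomes at most [(A^2 D^4 / q^2)^m e^(-m)]. Taking [m] above
    [Q D^(2/(1-s)) + log(1/eps)] makes the first factor at most 1 and the second at most [eps]. *)
Lemma optimal_order (C B nu s : R) d :
  (0 < d)%N -> 1 <= C -> 1 <= B -> 0 <= nu -> s < 1 ->
  exists K, 1 <= K /\ forall D mu delta eps,
  1 <= D -> 0 <= mu -> 0 <= delta <= 1 -> s = delta * nu + mu -> 0 < eps <= 1 ->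
  exists N n1 n2, [/\ delta * N.+1%:R <= n1%:R, delta * N.+2%:R <= n2%:R,
    C ^+ N.+1 <= expR (K * (1 + ln (1 / eps) + D `^ (2 / (1 - s)))) &
    C ^+ N.+1 * ((B ^+ N.+1 / N.+1`!%:R) ^+ 2 *
      (d%:R * (growth D nu mu n1 N.+1 + B ^+ 2 * growth D nu mu n2 N.+2))) <= eps].
Proof.
move=> d0 C1 B1 nu0 s1.
have sg0 : 0 < 1 - s by rewrite subr_gt0.
(* [A0] collects bases raised to the power [m], [A1] prefactors, later bounded by [A1^m]. In the
   [expR 5] below, two units pay for [m^m <= e^m m!], two for a leftover [D^4 <= e^(2 m)], and one
   provides [e^(-m)]. *)
pose A0 := C * B ^+ 2 * expR (4 * nu) * expR 2.
pose A1 := d%:R * (2 * B ^+ 2 * expR (4 * nu)).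
have E1 : 1 <= expR (4 * nu) by rewrite one_le_expR// mulr_ge0.
have B21 : 1 <= B ^+ 2 by exact: exprn_ege1.
have A01 : 1 <= A0 by rewrite /A0 !mulr_ege1// one_le_expR.
have A11 : 1 <= A1 by rewrite /A1 !mulr_ege1 ?ler1n.
pose A := Num.sqrt (A0 * A1 * expR 5).
have A_sqr : A ^+ 2 = A0 * A1 * expR 5.
  by rewrite sqr_sqrtr// !mulr_ge0 ?expR_ge0// (le_trans ler01).
have A1' : 1 <= A.
  by rewrite -sqrtr1; apply: ler_wsqrtr; apply: mulr_ege1; [exact: mulr_ege1|exact: one_le_expR].
(* Chosen so that [(Q * D^(2/(1-s)))^(1-s)] is exactly [A * D^2]. *)
pose Q := A `^ (1 - s)^-1.
have Q0 : 0 <= Q by exact: powR_ge0.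
have lC0 : 0 <= ln C by exact: ln_ge0.
exists ((Q + 2) * ln C + 1); split; first by rewrite lerDr mulr_ge0// addr_ge0.
move=> D mu delta eps D1 mu0 dl sE /andP[eps0 eps1].
have s0 : 0 <= s by rewrite sE addr_ge0// mulr_ge0//; case/andP: dl.
pose X := D `^ (2 / (1 - s)); pose L := ln (1 / eps).
have X1 : 1 <= X by apply: powR_ge1 => //; rewrite divr_ge0// ltW.
have L0 : 0 <= L by apply: ln_ge0; rewrite div1r invf_ge1.
have QX0 : 0 <= Q * X by rewrite mulr_ge0// (le_trans ler01).
(* Truncation keeps [N] below the threshold, which bounds [C^(N + 1)], and puts [N + 1] above it,
   which bounds the error. *)
pose N := Num.truncn (Q * X + L).
have N_le : N%:R <= Q * X + L by rewrite truncn_le// addr_ge0.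
have N_ge : Q * X + L < N.+1%:R by exact: truncnS_gt.
have [n1 [n1m n1d n1f]] := fact_ceil_le N.+1 dl.
have [n2 [n2m n2d n2f]] := fact_ceil_le N.+2 dl.
exists N, n1, n2; split => //.
  have -> : C ^+ N.+1 = expR (N.+1%:R * ln C).
    by rewrite expRM_natl lnK// posrE (lt_le_trans ltr01).
  rewrite ler_expR -/L -/X -natr1.
  have : (N%:R + 1) * ln C <= (Q * X + L + 1) * ln C by apply: ler_wpM2r => //; rewrite lerD2r.
  move=> /le_trans; apply.
  exact: order_exponent_le.
set m := N.+1 in N_ge n1m n1d n1f n2m n2d n2f *.
have sum_le := growth_sum_le B1 D1 nu0 mu0 (proj1 (andP dl)) sE (ltW s1) n1m n1f n2m n2f.
pose q := m%:R `^ (1 - s).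
have D0 : 0 <= D by exact: le_trans D1.
have q_ge : A * D ^+ 2 <= q.
  have -> : A * D ^+ 2 = (Q * X) `^ (1 - s).
    rewrite powRM// ?powR_ge0// /Q /X -!powRrM mulVf ?gt_eqF// -mulrA mulVf ?gt_eqF//.
    by rewrite mulr1 powRr1 ?sqrtr_ge0// powR_mulrn.
  apply: ge0_ler_powR; rewrite ?nnegrE ?(ltW sg0)//.
  by apply: ltW; apply: le_lt_trans N_ge; rewrite lerDl.
have A0' : 0 <= A by exact: sqrtr_ge0.
have q2_ge : A0 * A1 * expR 5 * D ^+ 4 <= q ^+ 2.
  rewrite -A_sqr (exprM D 2 2) -exprMn.
  by apply: lerXn2r; rewrite ?nnegrE ?mulr_ge0 ?exprn_ge0 ?powR_ge0.
have D41 : 1 <= D ^+ 4 by exact: exprn_ege1.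
have q2_le : q ^+ 2 <= expR 2 ^+ m.
  rewrite (_ : expR 2 = expR 1 ^+ 2); last by rewrite -expRM_natl mulr1.
  rewrite exprAC; apply: lerXn2r; rewrite ?nnegrE ?powR_ge0 ?exprn_ge0 ?expR_ge0//.
  apply: le_trans (natr_le_expR _); apply: powR_le_self; last by rewrite ler1n.
  by rewrite (ltW sg0) gerBl.
have fq : q ^+ m <= expR 1 ^+ m * m`!%:R `^ (1 - s).
  by apply: powR_fact_ge; rewrite (ltW sg0) gerBl.
have f0 : 0 < m`!%:R :> R by rewrite ltr0n fact_gt0.
have ff : m`!%:R = m`!%:R `^ s * m`!%:R `^ (1 - s) :> R.
  rewrite -powRD; last by rewrite (gt_eqF f0) implybT.
  by rewrite addrC subrK powRr1// ltW.
have fs0 : 0 < m`!%:R `^ s by exact: powR_gt0.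
have ft0 : 0 < m`!%:R `^ (1 - s) by exact: powR_gt0.
have q0 : 0 < q by apply: powR_gt0; rewrite ltr0n.
have Y_le : (m`!%:R `^ s) ^+ 2 / m`!%:R ^+ 2 <= (expR 2 / q ^+ 2) ^+ m.
  rewrite -expr_div_n [X in (_ / X) ^+ 2]ff invfM mulrA divff ?gt_eqF// mul1r.
  rewrite (_ : expR 2 = expR 1 ^+ 2); last by rewrite -expRM_natl mulr1.
  rewrite -expr_div_n exprAC; apply: lerXn2r; rewrite ?nnegrE ?invr_ge0 ?(ltW ft0) ?exprn_ge0 ?divr_ge0 ?expR_ge0 ?(ltW q0)//.
  by rewrite expr_div_n ler_pdivlMr ?exprn_gt0// mulrC ler_pdivrMr.
have C0 : 0 <= C by exact: le_trans C1.
have B0 : 0 <= B by exact: le_trans B1.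
have A00 : 0 <= A0 by exact: le_trans A01.
have A10 : 0 <= A1 by exact: le_trans A11.
have D40 : 0 <= D ^+ 4 by exact: le_trans D41.
have iq0 : 0 <= (q ^+ 2)^-1 by rewrite invr_ge0 sqr_ge0.
have e0 x : 0 <= expR x :> R by exact: expR_ge0.
have ratio0 : 0 <= A0 * A1 * expR 5 * D ^+ 4 / q ^+ 2 by rewrite !mulr_ge0.
apply: (@le_trans _ _ ((A0 * A1 * expR 5 * D ^+ 4 / q ^+ 2) ^+ m * expR (- m%:R))); last first.
  rewrite -[leRHS]mul1r; apply: ler_pM; rewrite ?expR_ge0//.
  - exact: exprn_ge0.
  - apply: exprn_ile1 => //.
    by rewrite ler_pdivrMr ?exprn_gt0// mul1r.
  - rewrite -[leRHS]lnK ?posrE// ler_expR.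
    have := N_ge; rewrite /L div1r lnV ?posrE// => h.
    by rewrite lerNl; apply: ltW; apply: le_lt_trans h; rewrite lerDr.
have D4_le : D ^+ 4 <= expR 2 ^+ m.
  apply: le_trans q2_le; apply: le_trans q2_ge; rewrite ler_peMl//.
  by apply: mulr_ege1; [exact: mulr_ege1|exact: one_le_expR].
apply: (@le_trans _ _ (C ^+ m * (B ^+ m) ^+ 2 * d%:R *
   (2 * B ^+ 2 * expR (4 * nu) * D ^+ 4 *
     (D ^+ 4 * expR (4 * nu) * expR 2) ^+ m) * (expR 2 / q ^+ 2) ^+ m)).
  rewrite (_ : C ^+ m * _ = C ^+ m * (B ^+ m) ^+ 2 * d%:R *
    ((growth D nu mu n1 m + B ^+ 2 * growth D nu mu n2 m.+1) / m`!%:R ^+ 2)); last first.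
    rewrite expr_div_n; clear; move: (growth _ _ _ n1 _ + _) (C ^+ m) ((B ^+ m) ^+ 2) (d%:R : R).
    by move: (m`!%:R ^- 2) => a b c e g; ring.
  rewrite -[leRHS]mulrA; apply: ler_wpM2l.
    by apply: mulr_ge0 => //; apply: mulr_ge0; rewrite !exprn_ge0.
  apply: (le_trans (ler_wpM2r _ sum_le)); first by rewrite invr_ge0 exprn_ge0.
  rewrite -[leLHS]mulrA; apply: ler_wpM2l => //.
  by apply: mulr_ge0; [rewrite !mulr_ge0// exprn_ge0|rewrite exprn_ge0// !mulr_ge0].
have A1m : A1 <= A1 ^+ m by rewrite exprS ler_peMr ?exprn_ege1.
have -> : expR (- m%:R) = (expR 1)^-1 ^+ m :> R.
  by rewrite -expRN -expRM_natl mulrN1.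
have -> : expR 5 = expR 2 * expR 2 * expR 1 :> R.
  by rewrite -!expRD; congr expR; ring.
have -> : (A0 * A1 * (expR 2 * expR 2 * expR 1) * D ^+ 4 / q ^+ 2) ^+ m * (expR 1)^-1 ^+ m =
    (A0 * D ^+ 4 * expR 2 / q ^+ 2) ^+ m * (A1 ^+ m * expR 2 ^+ m).
  rewrite -!exprMn; congr (_ ^+ m); have := gt_eqF (expR_gt0 (1 : R)).
  by move: (expR 1) (q ^+ 2)^-1 => u v /negbT u0; field.
have -> : C ^+ m * (B ^+ m) ^+ 2 * d%:R *
    (2 * B ^+ 2 * expR (4 * nu) * D ^+ 4 * (D ^+ 4 * expR (4 * nu) * expR 2) ^+ m) *
    (expR 2 / q ^+ 2) ^+ m =
    (A0 * D ^+ 4 * expR 2 / q ^+ 2) ^+ m * (A1 * D ^+ 4).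
  rewrite /A0 /A1 (exprAC B) (_ : C * _ * _ * _ * _ * _ / _ =
     C * B ^+ 2 * (D ^+ 4 * expR (4 * nu) * expR 2) * (expR 2 / q ^+ 2)); last by ring.
  rewrite (exprMn _ _ (_ / _)) (exprMn _ (C * _)) (exprMn _ C).
  by move: (_ ^+ m) (_ ^+ m) (_ ^+ m) (_ ^+ m) => a b c e; ring.
apply: ler_wpM2l.
  by rewrite exprn_ge0// !mulr_ge0.
exact: ler_pM.
Qed.

End choice_of_order.

(** * Squared norms, split into real and imaginary parts *)

Section L2_norms.
Context {R : realType}.
Local Notation lr := (lebesgue_row R).
Local Open Scope ereal_scope.

Lemma expe2_poweR (x : \bar R) : 0 <= x -> x ^+ 2 = x `^ 2.
Proof.
case: x => [r||]// r0; last by rewrite poweRyr ?pnatr_eq0.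
by rewrite poweR_EFin powR_mulrn.
Qed.

Lemma normc_sqr (z : R[i]) :
  ((Normc.normc z) ^+ 2 = complex.Re z ^+ 2 + complex.Im z ^+ 2)%R.
Proof. by case: z => a b /=; rewrite sqr_sqrtr// addr_ge0 ?sqr_ge0. Qed.

Lemma L2norm_sqr d D (f : 'rV[R]_d -> R[i]) :
  L2norm D f ^+ 2 =
  \int[lr d]_(x in D) (complex.Re (f x) ^+ 2 + complex.Im (f x) ^+ 2)%:E.
Proof.
rewrite expe2_poweR ?Lnorm_ge0// poweR_Lnorm ?pnatr_eq0// [RHS]integral_mkcond.
apply: eq_integral => x _; rewrite !patchE; case: ifP => _; last first.
  by rewrite abse0 poweR0r.
have n0 : (0 <= Normc.normc (f x))%R by case: (f x) => a b; exact: sqrtr_ge0.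
by rewrite -normc_sqr abse_EFin ger0_norm// poweR_EFin powR_mulrn.
Qed.

Lemma weighted_integral_le d (T : measurableType d) (m : {measure set T -> \bar R})
    (a w p q : T -> R) :
  measurable_fun setT a -> measurable_fun setT w ->
  measurable_fun setT p -> measurable_fun setT q ->
  (forall x, 0 <= a x)%R -> (forall x, a x <= w x)%R ->
  \int[m]_x (a x * p x ^+ 2)%:E + \int[m]_x (a x * q x ^+ 2)%:E <=
  \int[m]_x (w x * (p x ^+ 2 + q x ^+ 2))%:E.
Proof.
move=> ma mw mp mq a0 aw.
have mp2 : measurable_fun setT (fun x => p x ^+ 2)%R by exact: measurable_funX.
have mq2 : measurable_fun setT (fun x => q x ^+ 2)%R by exact: measurable_funX.
have s0 x : (0 <= p x ^+ 2 + q x ^+ 2)%R by rewrite addr_ge0 ?sqr_ge0.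
rewrite -(ge0_integralD m measurableT); last 4 first.
- by move=> x _; rewrite lee_fin; apply: mulr_ge0 => //; exact: sqr_ge0.
- by apply/measurable_EFinP; exact: measurable_funM.
- by move=> x _; rewrite lee_fin; apply: mulr_ge0 => //; exact: sqr_ge0.
- by apply/measurable_EFinP; exact: measurable_funM.
under eq_integral do rewrite -EFinD -mulrDr.
apply: ge0_le_integral => //.
- by move=> x _; rewrite lee_fin; apply: mulr_ge0.
- by apply/measurable_EFinP; apply: measurable_funM => //; exact: measurable_funD.
- by apply/measurable_EFinP; apply: measurable_funM => //; exact: measurable_funD.
- by move=> x _; rewrite lee_fin; exact: ler_wpM2r.
Qed.

Lemma ge0_integral_sqrD d D (p q : lebesgue_space R d -> R) : measurable D ->
  measurable_fun setT p -> measurable_fun setT q ->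
  \int[lr d]_(x in D) (p x ^+ 2 + q x ^+ 2)%:E =
  \int[lr d]_(x in D) (p x ^+ 2)%:E + \int[lr d]_(x in D) (q x ^+ 2)%:E.
Proof.
move=> mD mp mq; rewrite -(ge0_integralD (lr d) mD).
- by [].
- by move=> x _; rewrite lee_fin sqr_ge0.
- by apply: measurable_funTS; apply/measurable_EFinP; exact: measurable_funX.
- by move=> x _; rewrite lee_fin sqr_ge0.
- by apply: measurable_funTS; apply/measurable_EFinP; exact: measurable_funX.
Qed.

Lemma ge0_interchange (c : R) (a a' b b' : \bar R) : 0 <= b -> 0 <= b' ->
  (a + c%:E * b) + (a' + c%:E * b') = (a + a') + c%:E * (b + b').
Proof. by move=> b0 b'0; rewrite ge0_muleDr// addeACA. Qed.

(** Adds the estimates for the real part [u] and the imaginary part [v]. The derivative bounds are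
    on sums over both parts, since the hypothesis controls the modulus of the complex derivative. *)
Lemma scaled_sum_le d (c E b D G1 G2 : R) (Iu Iv Ou Ov : \bar R)
    (P1u P1v P2u P2v : 'I_d -> \bar R) :
  (0 <= c)%R -> (0 <= E)%R -> (0 <= b)%R -> 0 <= Ou -> 0 <= Ov ->
  (forall i, 0 <= P1u i) -> (forall i, 0 <= P1v i) ->
  (forall i, 0 <= P2u i) -> (forall i, 0 <= P2v i) ->
  Iu <= c%:E * (Ou + E%:E * \sum_(i < d) (P1u i + b%:E * P2u i)) ->
  Iv <= c%:E * (Ov + E%:E * \sum_(i < d) (P1v i + b%:E * P2v i)) ->
  (forall i, P1u i + P1v i <= (D * G1)%:E) ->
  (forall i, P2u i + P2v i <= (D * G2)%:E) ->
  Iu + Iv <= c%:E * (Ou + Ov) + (c * (E * (d%:R * (G1 + b * G2))) * D)%:E.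
Proof.
move=> c0 E0 b0 Ou0 Ov0 P1u0 P1v0 P2u0 P2v0 leu lev le1 le2.
have Qu0 i : 0 <= P1u i + b%:E * P2u i by rewrite adde_ge0// mule_ge0.
have Qv0 i : 0 <= P1v i + b%:E * P2v i by rewrite adde_ge0// mule_ge0.
have Su0 : 0 <= \sum_(i < d) (P1u i + b%:E * P2u i) by exact: sume_ge0.
have Sv0 : 0 <= \sum_(i < d) (P1v i + b%:E * P2v i) by exact: sume_ge0.
have EE0 : 0 <= E%:E by [].
apply: (le_trans (leeD leu lev)).
rewrite -(ge0_muleDr _ (adde_ge0 Ou0 (mule_ge0 EE0 Su0)) (adde_ge0 Ov0 (mule_ge0 EE0 Sv0))).
rewrite (ge0_interchange _ _ _ Su0 Sv0).
rewrite (ge0_muleDr _ (adde_ge0 Ou0 Ov0) (mule_ge0 EE0 (adde_ge0 Su0 Sv0))).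
apply: leeD => //; rewrite -big_split /=.
have -> : (c * (E * (d%:R * (G1 + b * G2))) * D)%:E =
    c%:E * (E%:E * \sum_(i < d) (D * (G1 + b * G2))%:E).
  by rewrite sumEFin sumr_const card_ord -mulr_natl -!EFinM; congr _%:E; ring.
apply: lee_wpmul2l => //; apply: lee_wpmul2l => //; apply: lee_sum => i _.
rewrite (ge0_interchange _ _ _ (P2u0 i) (P2v0 i)) mulrDr EFinD.
by apply: leeD; [exact: le1|rewrite mulrCA EFinM lee_wpmul2l].
Qed.

End L2_norms.

Local Open Scope complex_scope.

(** * The hypothesis on f read for pure derivatives *)

Section pure_derivatives.
Context {R : realType} {d : nat}.
Local Notation lr := (lebesgue_row R).

Lemma smooth_iter_partial (g : 'rV[R]_d -> R) i k : smoothR g ->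
  continuous (iter k (partial i) g) /\
  forall x, derivable (iter k (partial i) g) x (delta_mx ord0 i).
Proof.
move=> /(_ (nseq k i)); rewrite (_ : foldr _ _ _ = iter k (partial i) g).
  by move=> [cg dg]; split.
by elim: k => //= k ->.
Qed.

Lemma smooth_pure_derivable (g : 'rV[R]_d -> R) : smoothR g -> pure_derivable g.
Proof. by move=> sg i k x; have [] := smooth_iter_partial i k sg. Qed.

Lemma smooth_pure_measurable (g : 'rV[R]_d -> R) : smoothR g -> pure_measurable g.
Proof.
by move=> sg i k; apply: continuous_measurable_row; have [] := smooth_iter_partial i k sg.
Qed.

Lemma smooth_measurable (g : 'rV[R]_d -> R) : smoothR g -> measurable_fun setT g.
Proof. by move=> sg; apply: continuous_measurable_row; have [] := sg [::]. Qed.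

Definition pure_index (i : 'I_d) (k : nat) : 'I_d -> nat := fun j => if j == i then k else 0.

Lemma msize_pure i k : msize (pure_index i k) = k.
Proof. by rewrite /msize /pure_index -big_mkcond big_pred1_eq. Qed.

Lemma mpartialR_pure i k (g : 'rV[R]_d -> R) :
  mpartialR (pure_index i k) g = iter k (partial i) g.
Proof.
have fold_iter s : uniq s -> foldr (fun j => iter (pure_index i k j) (partial j)) g s =
    if i \in s then iter k (partial i) g else g.
  elim: s => //= j s IH /andP[js /IH ->]; rewrite /pure_index inE eq_sym.
  by have [->|//] := eqVneq i j; rewrite (negbTE js).
by rewrite /mpartialR fold_iter ?enum_uniq// mem_enum.
Qed.

Lemma weight_exprn_le (delta : R) k n (x : 'rV[R]_d) : delta * k%:R <= n%:R ->
  weight delta x ^+ k <= ((1 + enorm x ^+ 2) `^ (n%:R / 2)) ^+ 2.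
Proof.
move=> kn; rewrite /weight -(powR_mulrn k (powR_ge0 _ _)) -(powR_mulrn 2 (powR_ge0 _ _)).
by rewrite -!powRrM divfK ?pnatr_eq0//; apply: ler_powR => //; exact: one_enorm_ge1.
Qed.

(** The hypothesis for the multi-index [k e_i], squared. As [1 + |x|^2 >= 1] and [delta k <= n], the
    weight [(1 + |x|^2)^(delta k)] is below the assumed one, [(1 + |x|^2)^n]. *)
Lemma weighted_derivative_le (f : 'rV[R]_d -> R[i]) (D1 D2 nu mu delta : R) i k n :
  smooth f -> delta * k%:R <= n%:R ->
  (L2norm setT (fun x => (((1 + enorm x ^+ 2) `^ (n%:R / 2))%:C *
                          mpartial (pure_index i k) f x)%R)
    <= (D1 * D2 ^+ (n + k) * n`!%:R `^ nu * k`!%:R `^ mu)%:E)%E ->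
  0 <= D1 -> 0 <= D2 ->
  (\int[lr d]_x (weight delta x ^+ k * iter k (partial i) (fun y => complex.Re (f y)) x ^+ 2)%:E
   + \int[lr d]_x (weight delta x ^+ k * iter k (partial i) (fun y => complex.Im (f y)) x ^+ 2)%:E
   <= (D1 ^+ 2 * growth D2 nu mu n k)%:E)%E.
Proof.
move=> [su sv] kn fle D10 D20.
set u := fun y => complex.Re (f y); set v := fun y => complex.Im (f y).
have mw : measurable_fun [set: lebesgue_space R d] (fun x => weight delta x ^+ k).
  by apply: measurable_funX; apply: measurable_fun_lebesgue; exact: measurable_weight.
have mw' : measurable_fun [set: lebesgue_space R d] (fun x => weight (n%:R / 2) x ^+ 2).
  by apply: measurable_funX; apply: measurable_fun_lebesgue; exact: measurable_weight.
have mu' : measurable_fun [set: lebesgue_space R d] (iter k (partial i) u).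
  by apply: measurable_fun_lebesgue; exact: smooth_pure_measurable su i k.
have mv' : measurable_fun [set: lebesgue_space R d] (iter k (partial i) v).
  by apply: measurable_fun_lebesgue; exact: smooth_pure_measurable sv i k.
have w0 (x : 'rV[R]_d) : 0 <= weight delta x ^+ k by rewrite exprn_ge0// powR_ge0.
have le_w (x : 'rV[R]_d) : weight delta x ^+ k <= weight (n%:R / 2) x ^+ 2.
  exact: weight_exprn_le.
apply: (le_trans (weighted_integral_le (lr d) mw mw' mu' mv' w0 le_w)).
apply: (@le_trans _ _ (((D1 * D2 ^+ (n + k) * n`!%:R `^ nu * k`!%:R `^ mu)%:E ^+ 2)%E)); last first.
  rewrite expe2 -EFinM lee_fin -expr2 /growth -exprMn -!mulrA lexx//.
have b0 : 0 <= D1 * D2 ^+ (n + k) * n`!%:R `^ nu * k`!%:R `^ mu.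
  by rewrite !mulr_ge0 ?powR_ge0 ?exprn_ge0.
have := lee_pmul (Lnorm_ge0 _ _ _) (Lnorm_ge0 _ _ _) fle fle; rewrite -!expe2 L2norm_sqr.
move=> /(le_trans _); apply; rewrite le_eqVlt; apply/orP; left; apply/eqP.
apply: eq_integral => x _; congr EFin.
by rewrite /mpartial !mpartialR_pure /= !mul0r subr0 addr0 !exprMn mulrDr.
Qed.

End pure_derivatives.

(** [C] and [B] come from [gamma], [M], [r0], [eta] and [d] through [global_Remez]; [optimal_order]
    then adds [nu] and [s] to produce [K], before [f], [mu] and [delta] are introduced. Here [M] is
    the constant of the power bound on [rho]. *)
Theorem theorem1p1 (R : realType) (d : nat) (gamma M r0 eta nu s : R) :
  (0 < d)%N ->
  0 < gamma < 1 -> 1 <= M -> 1 <= r0 -> 0 < eta < 1 -> 0 <= nu -> s < 1 ->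
  exists K : R, 1 <= K /\
  forall (f : 'rV[R]_d -> R[i]) (D1 D2 mu delta : R),
    smooth f ->
    0 < D1 -> 1 <= D2 -> 0 <= mu < 1 -> 0 <= delta <= 1 ->
    s = delta * nu + mu ->
    (forall (n : nat) (beta : 'I_d -> nat),
      (L2norm setT (fun x => (((1 + enorm x ^+ 2) `^ (n%:R / 2))%:C *
                              mpartial beta f x)%R)
       <= (D1 * D2 ^+ (n + msize beta) *
           (n`!%:R) `^ nu * ((msize beta)`!%:R) `^ mu)%:E)%E) ->
  forall rho : 'rV[R]_d -> R,
    (forall x, 0 < rho x) ->
    measurable_fun setT (rho : lebesgue_space R d -> R) ->
    (forall x, rho x <= M * (1 + enorm x ^+ 2) `^ (delta / 2)) ->
    (forall x, r0 <= enorm x -> rho x <= eta * enorm x) ->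
  forall omega : set 'rV[R]_d,
    measurable (omega : set (lebesgue_space R d)) ->
    (forall x,
      (gamma%:E <= lebesgue_row R d (eball x (rho x) `&` omega)
                   / lebesgue_row R d (eball x (rho x)))%E) ->
  forall eps : R, 0 < eps <= 1 ->
    (L2norm setT f ^+ 2
     <= (expR (K * (1 + ln (1 / eps) + D2 `^ (2 / (1 - s)))))%:E
          * L2norm omega f ^+ 2
        + (eps * D1 ^+ 2)%:E)%E.
Proof.
move=> d0 /andP[g0 g1] M1 r01 eta01 nu0 s1.
have g01 : 0 < gamma <= 1 by rewrite g0 ltW.
have [C [B [C1 B1 CB]]] := @global_Remez R d gamma M r0 eta g01 M1 r01 eta01.
have [K [K1 KP]] := optimal_order d0 C1 B1 nu0 s1.
exists K; split => // f D1 D2 mu delta [su sv] D10 D21 /andP[mu0 _] dl sE fle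
  rho rho0 _ rhoM rhoeta omega mo tho eps eps01.
have [N [n1 [n2 [n1d n2d CK err]]]] := KP D2 mu delta eps D21 mu0 dl sE eps01.
have adm : admissible_radius M r0 eta delta rho by split.
have th : thick_on gamma rho omega by split.
set u := (fun y => complex.Re (f y)) in su; set v := (fun y => complex.Im (f y)) in sv.
have D20 : 0 <= D2 by exact: le_trans D21.
have Pbound i k n : delta * k%:R <= n%:R ->
    (\int[lebesgue_row R d]_x (weight delta x ^+ k * iter k (partial i) u x ^+ 2)%:E
     + \int[lebesgue_row R d]_x (weight delta x ^+ k * iter k (partial i) v x ^+ 2)%:E
     <= (D1 ^+ 2 * growth D2 nu mu n k)%:E)%E.
  move=> kn; have fn := fle n (pure_index i k); rewrite msize_pure in fn.
  exact: (weighted_derivative_le (conj su sv) kn fn (ltW D10) D20).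
have CBg g (sg : smoothR g) := CB N g omega delta rho (smooth_pure_derivable sg)
  (smooth_pure_measurable sg) (smooth_measurable sg) adm th.
have mlr g : smoothR g -> measurable_fun [set: lebesgue_space R d] g.
  by move=> sg; apply: measurable_fun_lebesgue; exact: smooth_measurable.
rewrite !L2norm_sqr.
rewrite !(ge0_integral_sqrD _ (mlr u su) (mlr v sv))//.
have W0 k g i x : 0 <= weight delta x ^+ k * iter k (partial i) g x ^+ 2.
  by apply: mulr_ge0; [apply: exprn_ge0; exact: powR_ge0|exact: sqr_ge0].
have P0 k g i : (0 <= \int[lebesgue_row R d]_x
    (weight delta x ^+ k * iter k (partial i) g x ^+ 2)%:E)%E.
  by apply: integral_ge0 => x _; rewrite lee_fin.
have O0 g : (0 <= \int[lebesgue_row R d]_(x in omega) (g x ^+ 2)%:E)%E.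
  by apply: integral_ge0 => x _; rewrite lee_fin sqr_ge0.
have C0 : 0 <= C ^+ N.+1 by rewrite exprn_ge0// (le_trans _ C1).
have := scaled_sum_le C0 (sqr_ge0 _) (sqr_ge0 _) (O0 u) (O0 v)
  (P0 _ u) (P0 _ v) (P0 _ u) (P0 _ v) (CBg u su) (CBg v sv)
  (fun i => Pbound i _ _ n1d) (fun i => Pbound i _ _ n2d).
move=> /le_trans; apply; apply: leeD.
  by apply: lee_wpmul2r; [exact: adde_ge0 (O0 u) (O0 v)|rewrite lee_fin].
by rewrite lee_fin; apply: ler_wpM2r; first exact: sqr_ge0.
Qed.
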